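(* Let $\chi$ be a primitive, non-principal Dirichlet character modulo $q$, let $v$ be a positive integer, $N>0$ real, and $\sigma_0<v$. For every $s=\sigma+i\tau$ with $\sigma\le\sigma_0$ and $s\notin\{1,\dots,v-1\}$, $$L(s,\chi)=D(s,\chi)+(2\pi)^{s-1}\Gamma(1-s)\,q^{-s}G(\chi)\sum_{\mu=\pm1}\chi(-\mu)\,e^{i\mu\frac{\pi}{2}(1-s)}E_{\mu}(s,\chi),$$ where $$D(s,\chi)=\sum_{n=1}^{\infty}\chi(n)n^{-s}Q\!\left(v,\tfrac{n}{N}\right),$$ $$E_{\mu}(s,\chi)=\sum_{m=1}^{\infty}\overline{\chi}(m)\left[m^{s-1}-\sum_{w=0}^{v-1}\binom{s-1}{w}\left(m+\frac{i\mu q}{2\pi N}\right)^{s-1-w}\left(\frac{-i\mu q}{2\pi N}\right)^{w}\right],$$ and all these series converge absolutely. For a positive integer $s=k<v$, the $\mu$-terms are to be understood as the limit $s\to k$ (which exists).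
   Context: $L(s,\chi)$ is the Dirichlet $L$-function of $\chi$ (given by $\sum_{n\ge1}\chi(n)n^{-s}$ for $\sigma>0$ and analytically continued). $G(\chi)=\sum_{p=1}^{q}\chi(p)e^{2\pi i p/q}$ is the Gauss sum. $\Gamma$ is the gamma function. $Q(v,m)=\sum_{w=0}^{v-1}\frac{m^{w}}{w!}e^{-m}$ is the normalized incomplete gamma function. $\binom{s-1}{w}=\frac{(s-1)(s-2)\cdots(s-w)}{w!}$. Complex powers use the principal branch of the logarithm. *)

(* Defs.v *)
From Stdlib Require Import Reals Lra Lia Arith ZArith ClassicalEpsilon.
Open Scope R_scope.

Definition Cplx : Type := (R * R)%type.
Definition Re (z : Cplx) : R := fst z.
Definition Im (z : Cplx) : R := snd z.
Definition RtoC (r : R) : Cplx := (r, 0).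
Definition C0 : Cplx := RtoC 0.
Definition C1 : Cplx := RtoC 1.
Definition Ci : Cplx := (0, 1).
Definition Cplus (z w : Cplx) : Cplx := (Re z + Re w, Im z + Im w).
Definition Copp (z : Cplx) : Cplx := (- Re z, - Im z).
Definition Cminus (z w : Cplx) : Cplx := Cplus z (Copp w).
Definition Cmult (z w : Cplx) : Cplx :=
  (Re z * Re w - Im z * Im w, Re z * Im w + Im z * Re w).
Definition Cinv (z : Cplx) : Cplx :=
  (Re z / (Re z ^ 2 + Im z ^ 2), - Im z / (Re z ^ 2 + Im z ^ 2)).
Definition Cdiv (z w : Cplx) : Cplx := Cmult z (Cinv w).
Definition Cconj (z : Cplx) : Cplx := (Re z, - Im z).
Definition Cmod (z : Cplx) : R := sqrt (Re z ^ 2 + Im z ^ 2).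

Fixpoint Cpown (z : Cplx) (n : nat) : Cplx :=
  match n with O => C1 | S k => Cmult z (Cpown z k) end.

Definition Cexp (z : Cplx) : Cplx := (exp (Re z) * cos (Im z), exp (Re z) * sin (Im z)).

(* principal argument, in (-PI, PI] *)
Definition Arg (z : Cplx) : R :=
  let x := Re z in let y := Im z in
  if Rlt_dec 0 x then atan (y / x)
  else if Rlt_dec x 0 then
         (if Rle_dec 0 y then atan (y / x) + PI else atan (y / x) - PI)
  else if Rlt_dec 0 y then PI / 2
  else if Rlt_dec y 0 then - (PI / 2)
  else 0.

Definition Cln (z : Cplx) : Cplx := (ln (Cmod z), Arg z).

Definition Cpow (z w : Cplx) : Cplx :=
  if Req_EM_T (Re z) 0 then
    (if Req_EM_T (Im z) 0 then C0 else Cexp (Cmult w (Cln z)))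
  else Cexp (Cmult w (Cln z)).

Fixpoint Csum_lt (n : nat) (f : nat -> Cplx) : Cplx :=
  match n with O => C0 | S k => Cplus (Csum_lt k f) (f k) end.
Fixpoint Cprod_lt (n : nat) (f : nat -> Cplx) : Cplx :=
  match n with O => C1 | S k => Cmult (Cprod_lt k f) (f k) end.
Fixpoint Rsum_lt (n : nat) (f : nat -> R) : R :=
  match n with O => 0 | S k => Rsum_lt k f + f k end.

Definition Ccv (u : nat -> Cplx) (l : Cplx) : Prop :=
  forall eps, 0 < eps -> exists N, forall n, (n >= N)%nat -> Cmod (Cminus (u n) l) < eps.

(* the limit of a sequence (a junk value if it does not converge) *)
Definition Clim (u : nat -> Cplx) : Cplx := epsilon (inhabits C0) (fun l => Ccv u l).

Definition Cpartial (f : nat -> Cplx) (N : nat) : Cplx := Csum_lt N (fun n => f (S n)).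

Definition Cseries_cv (f : nat -> Cplx) (l : Cplx) : Prop := Ccv (Cpartial f) l.

Definition Cseries (f : nat -> Cplx) : Cplx := Clim (Cpartial f).

Definition Cabs_conv (f : nat -> Cplx) : Prop :=
  exists r, Un_cv (fun N => Rsum_lt N (fun n => Cmod (f (S n)))) r.

Definition Clim_at (D : Cplx -> Prop) (F : Cplx -> Cplx) (z0 l : Cplx) : Prop :=
  forall eps, 0 < eps -> exists delta, 0 < delta /\
    forall z, D z -> z <> z0 -> Cmod (Cminus z z0) < delta ->
      Cmod (Cminus (F z) l) < eps.

Definition Cdifferentiable (F : Cplx -> Cplx) (z : Cplx) : Prop :=
  exists d, Clim_at (fun _ => True) (fun h => Cdiv (Cminus (F (Cplus z h)) (F z)) h) C0 d.
Definition entire (F : Cplx -> Cplx) : Prop := forall z, Cdifferentiable F z.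

(* ---------- Gamma function (Gauss's limit formula) ---------- *)
(* Gamma(z) = lim_n n! n^z / (z (z+1) ... (z+n)), valid for z not in {0,-1,-2,...} *)
Definition CGamma (z : Cplx) : Cplx :=
  Clim (fun n => Cdiv (Cmult (RtoC (INR (fact n))) (Cpow (RtoC (INR n)) z))
                      (Cprod_lt (S n) (fun k => Cplus z (RtoC (INR k))))).

Definition is_dirichlet_char (q : nat) (chi : nat -> Cplx) : Prop :=
  (0 < q)%nat /\
  (forall n, chi (n + q)%nat = chi n) /\
  (forall m n, chi (m * n)%nat = Cmult (chi m) (chi n)) /\
  chi 1%nat = C1 /\
  (forall n, Nat.gcd n q <> 1%nat -> chi n = C0).

Definition nonprincipal (q : nat) (chi : nat -> Cplx) : Prop :=
  exists n, Nat.gcd n q = 1%nat /\ chi n <> C1.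

(* d is an induced modulus if chi(a) = 1 whenever gcd(a,q)=1 and a = 1 mod d;
   chi is primitive if no proper divisor d < q of q is an induced modulus *)
Definition primitive_char (q : nat) (chi : nat -> Cplx) : Prop :=
  forall d, Nat.divide d q -> (d < q)%nat ->
    exists a, Nat.gcd a q = 1%nat /\ Nat.modulo a d = Nat.modulo 1 d /\ chi a <> C1.

Definition chiZ (q : nat) (chi : nat -> Cplx) (z : Z) : Cplx :=
  chi (Z.to_nat (Z.modulo z (Z.of_nat q))).

Definition gauss_sum (q : nat) (chi : nat -> Cplx) : Cplx :=
  Csum_lt q (fun p => Cmult (chi (S p))
     (Cexp (Cmult Ci (RtoC (2 * PI * INR (S p) / INR q))))).

Definition nC (n : nat) : Cplx := RtoC (INR n).

(* L(s,chi): value at s of the (unique) entire function agreeing with the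
   Dirichlet series sum chi(n) n^{-s} on Re s > 1 (analytic continuation). *)
Definition Lfun (chi : nat -> Cplx) (s : Cplx) : Cplx :=
  (epsilon (inhabits (fun _ : Cplx => C0))
     (fun F : Cplx -> Cplx => entire F /\
        forall z, 1 < Re z ->
          Cseries_cv (fun n => Cmult (chi n) (Cpow (nC n) (Copp z))) (F z))) s.

(* normalized incomplete gamma function Q(v,m) = sum_{w=0}^{v-1} m^w/w! e^{-m} *)
Definition Qinc (v : nat) (m : R) : R :=
  Rsum_lt v (fun w => m ^ w / INR (fact w) * exp (- m)).

Definition gbinom (z : Cplx) (w : nat) : Cplx :=
  Cdiv (Cprod_lt w (fun j => Cminus z (nC j))) (nC (fact w)).

Definition D_term (chi : nat -> Cplx) (v : nat) (N : R) (s : Cplx) (n : nat) : Cplx :=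
  Cmult (Cmult (chi n) (Cpow (nC n) (Copp s))) (RtoC (Qinc v (INR n / N))).

Definition Dfun (chi : nat -> Cplx) (v : nat) (N : R) (s : Cplx) : Cplx :=
  Cseries (D_term chi v N s).

Definition E_term (q : nat) (chi : nat -> Cplx) (v : nat) (N : R) (mu : Z) (s : Cplx)
  (m : nat) : Cplx :=
  let a : Cplx := Cmult Ci (RtoC (IZR mu * INR q / (2 * PI * N))) in
  let s1 : Cplx := Cminus s C1 in
  Cmult (Cconj (chi m))
    (Cminus (Cpow (nC m) s1)
       (Csum_lt v (fun w =>
          Cmult (Cmult (gbinom s1 w) (Cpow (Cplus (nC m) a) (Cminus s1 (nC w))))
                (Cpown (Copp a) w)))).

Definition Efun (q : nat) (chi : nat -> Cplx) (v : nat) (N : R) (mu : Z) (s : Cplx) : Cplx :=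
  Cseries (E_term q chi v N mu s).

Definition mu_summand (q : nat) (chi : nat -> Cplx) (v : nat) (N : R) (mu : Z) (s : Cplx) : Cplx :=
  Cmult (Cmult (chiZ q chi (- mu))
               (Cexp (Cmult (Cmult Ci (RtoC (IZR mu * PI / 2))) (Cminus C1 s))))
        (Efun q chi v N mu s).

Definition mu_terms (q : nat) (chi : nat -> Cplx) (v : nat) (N : R) (s : Cplx) : Cplx :=
  Cmult (Cmult (Cmult (Cmult (Cpow (RtoC (2 * PI)) (Cminus s C1)) (CGamma (Cminus C1 s)))
                      (Cpow (nC q) (Copp s)))
               (gauss_sum q chi))
        (Cplus (mu_summand q chi v N 1 s) (mu_summand q chi v N (-1) s)).

(* Main.v *)
From Stdlib Require Import Reals Lra Lia ZArith ClassicalEpsilon FunctionalExtensionality List Permutation.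
From Coquelicot Require Import Coquelicot.
Require Import Defs.
Open Scope R_scope.

(** Put [t = 1/N]. As a function of [t] the smoothed sum [D] has derivative
    [- t^(v-1) / (v-1)! * Phi(t)] with [Phi(t) = sum chi(n) n^(v-s) exp(-nt)], while the derivative of each
    Taylor remainder in [E_mu] telescopes to a single power [(m + i mu q t / 2 pi)^(s-1-v)]. Lipschitz's formula
    expresses [Phi(t)] as [G Gamma(v-s+1) / q] times the sum over [m <> 0] of
    [conj chi(m) (t + 2 pi i m / q)^(s-1-v)], so that [D] plus the mu-terms does not depend on [t]; as [t -> 0]
    the mu-terms vanish and [D] tends to [L(s, chi)].

    For Lipschitz's formula, average the binomial series of [(1-u)^(-z-1)] against [conj chi] over the [M q]-th
    roots of unity on the circle [|u| = exp(-t/M)] and let [M -> oo]: the coefficients grow like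
    [k^z / Gamma(z+1)] by Gauss's product. The formula also bounds [Phi] near [t = 0] locally uniformly
    in [s], which makes the limit of [D] an entire function. It is the only entire continuation of the Dirichlet
    series: by Goursat's theorem an entire function is bounded by its values on circles, and a suitable exponential weight
    pushes the half-plane where it vanishes to the left. *)

(* [Lfun] is chosen by [epsilon], so nothing about it can be used until an entire continuation has
   been built and proved unique. The bound on [Phi] that makes the formula work also builds that
   continuation, since it makes the smoothed sum Lipschitz in [t]. Infinite series are never
   differentiated: derivatives in [t] are taken of partial sums, the mean value inequality turns the
   tails of the differentiated series into errors, and only then do the truncations go to infinity.
   The complex analysis is kept to inequalities. Bounds on circles that lose a factor 2 are enough,
   because the identity principle lets a decaying power absorb any constant and the theorem on
   limits needs no sharp one. At an integer [k < v] the factor [Gamma(1 - s)] has a pole, but no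
   expansion is made there: near [k] the mu-terms equal [L - D], and both [L] and [D] are
   differentiable at [k]. *)
Declare Scope cplx_scope.
Delimit Scope cplx_scope with cx.
Bind Scope cplx_scope with Cplx.
Infix "+" := Cplus : cplx_scope.
Infix "-" := Cminus : cplx_scope.
Infix "*" := Cmult : cplx_scope.
Infix "/" := Cdiv : cplx_scope.
Notation "- x" := (Copp x) : cplx_scope.
Notation "/ x" := (Cinv x) : cplx_scope.
Infix "^" := Cpown : cplx_scope.
Arguments Cmod z%_cx.
Arguments Re z%_cx.
Arguments Im z%_cx.
Arguments Cexp z%_cx.
Arguments Cln z%_cx.
Arguments Cconj z%_cx.
Arguments Cpow (z w)%_cx.
Arguments Cpown z%_cx n%_nat.
Arguments Ccv u l%_cx.
Arguments Csum_lt n%_nat f.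
Arguments Rsum_lt n%_nat f.
Arguments Cplus (z w)%_cx.
Arguments Cminus (z w)%_cx.
Arguments Cmult (z w)%_cx.
Arguments Cdiv (z w)%_cx.
Arguments Copp z%_cx.
Arguments Cinv z%_cx.

(** * The field of complex numbers and the modulus *)

Lemma Cplx_ext (z w : Cplx) : Re z = Re w -> Im z = Im w -> z = w.
Proof. destruct z, w; unfold Re, Im; simpl; intros -> ->; reflexivity. Qed.

Ltac cplx := apply Cplx_ext; unfold Cminus, Cdiv, Cplus, Cmult, Copp, Cconj, C0, C1, Ci, nC, RtoC, Re, Im; simpl.

Ltac parts := unfold Cminus, Cdiv, Cplus, Cmult, Copp, Cconj, C0, C1, Ci, nC, RtoC, Re, Im; simpl; ring.

Lemma Cplx_ring_theory : ring_theory C0 C1 Cplus Cmult Cminus Copp (@eq Cplx).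
Proof. constructor; intros; cplx; ring. Qed.

Lemma Cplx_nonzero (z : Cplx) : z <> C0 -> Re z ^ 2 + Im z ^ 2 <> 0.
Proof.
  intros H E; apply H; destruct z as [x y]; unfold Re, Im in E; simpl in E.
  assert (x = 0) by nra. assert (y = 0) by nra. subst; reflexivity.
Qed.

Lemma C1_neq_0 : C1 <> C0.
Proof. intros H; apply (f_equal Re) in H; unfold Re in H; simpl in H; lra. Qed.

Lemma Cplx_field_theory : field_theory C0 C1 Cplus Cmult Cminus Copp Cdiv Cinv (@eq Cplx).
Proof.
  constructor; [exact Cplx_ring_theory | exact C1_neq_0 | reflexivity |].
  intros z H; apply Cplx_nonzero in H; destruct z as [x y].
  unfold Cinv; cplx; unfold Re, Im in H; simpl in H; field; lra.
Qed.
Add Field Cplx_field : Cplx_field_theory.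

Lemma RtoC_plus a b : RtoC (a + b) = (RtoC a + RtoC b)%cx.
Proof. cplx; ring. Qed.
Lemma RtoC_minus a b : RtoC (a - b) = (RtoC a - RtoC b)%cx.
Proof. cplx; ring. Qed.
Lemma RtoC_mult a b : RtoC (a * b) = (RtoC a * RtoC b)%cx.
Proof. cplx; ring. Qed.
Lemma RtoC_opp a : RtoC (- a) = (- RtoC a)%cx.
Proof. cplx; ring. Qed.
Lemma RtoC_neq a : a <> 0 -> RtoC a <> C0.
Proof. intros H E; apply (f_equal Re) in E; exact (H E). Qed.
Lemma RtoC_inv a : a <> 0 -> RtoC (/ a) = (/ RtoC a)%cx.
Proof. intros H. unfold Cinv; cplx; field; auto. Qed.
Lemma RtoC_div a b : b <> 0 -> RtoC (a / b) = (RtoC a / RtoC b)%cx.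
Proof. intros H. unfold Rdiv. rewrite RtoC_mult, RtoC_inv by auto. reflexivity. Qed.
Lemma RtoC_0 : RtoC 0 = C0. Proof. reflexivity. Qed.
Lemma RtoC_1 : RtoC 1 = C1. Proof. reflexivity. Qed.
Lemma RtoC_pow a n : RtoC (a ^ n) = (RtoC a ^ n)%cx.
Proof. induction n; simpl; auto. rewrite RtoC_mult, IHn; auto. Qed.
Lemma Ci_sqr : (Ci * Ci = - C1)%cx.
Proof. cplx; ring. Qed.
Lemma nC_S n : nC (S n) = (nC n + C1)%cx.
Proof. unfold nC. rewrite S_INR, RtoC_plus; auto. Qed.
Lemma nC_neq n : n <> 0%nat -> nC n <> C0.
Proof. intros H; apply RtoC_neq; apply not_0_INR; auto. Qed.
Lemma nC_mult m n : nC (m * n) = (nC m * nC n)%cx.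
Proof. unfold nC; rewrite mult_INR, RtoC_mult; auto. Qed.

(** The operations of the statement are convertible to Coquelicot's on pairs of reals, so its lemmas
    on the modulus apply as they stand. *)
Lemma Cmod_nonneg z : 0 <= Cmod z.
Proof. exact (Complex.Cmod_ge_0 z). Qed.
Lemma Cmod_tri z w : Cmod (z + w) <= Cmod z + Cmod w.
Proof. exact (Complex.Cmod_triangle z w). Qed.
Lemma Cmod_mul z w : Cmod (z * w) = Cmod z * Cmod w.
Proof. exact (Complex.Cmod_mult z w). Qed.
Lemma Cmod_neg z : Cmod (- z) = Cmod z.
Proof. exact (Complex.Cmod_opp z). Qed.
Lemma Cmod_RtoC a : Cmod (RtoC a) = Rabs a.
Proof. exact (Complex.Cmod_R a). Qed.
Lemma Cmod_C0 : Cmod C0 = 0.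
Proof. exact (Complex.Cmod_0). Qed.
Lemma Cmod_C1 : Cmod C1 = 1.
Proof. exact (Complex.Cmod_1). Qed.
Lemma Cmod_I : Cmod Ci = 1.
Proof. exact (Complex.Cmod_Ci). Qed.
Lemma Cmod_eq0 z : Cmod z = 0 -> z = C0.
Proof. exact (Complex.Cmod_eq_0 z). Qed.
Lemma Cmod_pos z : z <> C0 -> 0 < Cmod z.
Proof. exact (proj1 (Complex.Cmod_gt_0 z)). Qed.
Lemma Cmod_Cinv z : z <> C0 -> Cmod (/ z) = / Cmod z.
Proof. exact (Complex.Cmod_inv z). Qed.
Lemma Cmod_Cdiv z w : w <> C0 -> Cmod (z / w) = Cmod z / Cmod w.
Proof. exact (Complex.Cmod_div z w). Qed.
Lemma Cmod_Cconj z : Cmod (Cconj z) = Cmod z.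
Proof. exact (Complex.Cmod_conj z). Qed.
Lemma Cmod_Cpown z n : Cmod (z ^ n) = Cmod z ^ n.
Proof. induction n; simpl; [exact Cmod_C1|]. rewrite Cmod_mul, IHn; auto. Qed.
Lemma Cmod_minus z w : Cmod (z - w) <= Cmod z + Cmod w.
Proof. unfold Cminus. rewrite <- (Cmod_neg w). apply Cmod_tri. Qed.
Lemma Cmod_sym z w : Cmod (z - w) = Cmod (w - z).
Proof. rewrite <- Cmod_neg. f_equal. ring. Qed.
Lemma Cmod_tri3 x y z : Cmod (x - z) <= Cmod (x - y) + Cmod (y - z).
Proof. replace (x - z)%cx with ((x - y) + (y - z))%cx by ring. apply Cmod_tri. Qed.
Lemma Cmod_rev z w : Cmod z - Cmod w <= Cmod (z - w).
Proof.
  pose proof (Cmod_tri (z - w) w). replace (z - w + w)%cx with z in H by ring. lra.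
Qed.
Lemma Cmod_nC n : Cmod (nC n) = INR n.
Proof. unfold nC. rewrite Cmod_RtoC, Rabs_pos_eq; auto. apply pos_INR. Qed.
Lemma Re_le_Cmod z : Rabs (Re z) <= Cmod z.
Proof. exact (Complex.re_le_Cmod z). Qed.
Lemma Im_le_Cmod z : Rabs (Im z) <= Cmod z.
Proof.
  replace (Cmod z) with (Cmod (Ci * z)) by (rewrite Cmod_mul, Cmod_I; ring).
  eapply Rle_trans; [|apply Re_le_Cmod]. right. rewrite <- Rabs_Ropp. f_equal. parts.
Qed.
Lemma Cmod_le_parts z : Cmod z <= Rabs (Re z) + Rabs (Im z).
Proof.
  replace z with (RtoC (Re z) + Ci * RtoC (Im z))%cx at 1 by (cplx; ring).
  eapply Rle_trans; [apply Cmod_tri|]. rewrite Cmod_mul, Cmod_I, !Cmod_RtoC. lra.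
Qed.
Lemma Cmod_sqr z : Cmod z ^ 2 = Re z ^ 2 + Im z ^ 2.
Proof. unfold Cmod. apply pow2_sqrt. nra. Qed.

(** * Finite sums *)

Lemma Csum_ext n f g : (forall k, (k < n)%nat -> f k = g k) -> Csum_lt n f = Csum_lt n g.
Proof. intros H; induction n; simpl; auto. rewrite IHn, (H n); auto. Qed.
Lemma Csum_plus n f g : Csum_lt n (fun k => f k + g k)%cx = (Csum_lt n f + Csum_lt n g)%cx.
Proof. induction n; simpl; [|rewrite IHn]; ring. Qed.
Lemma Csum_scal n c f : Csum_lt n (fun k => c * f k)%cx = (c * Csum_lt n f)%cx.
Proof. induction n; simpl; [|rewrite IHn]; ring. Qed.
Lemma Csum_zero n f : (forall k, (k < n)%nat -> f k = C0) -> Csum_lt n f = C0.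
Proof. intros H; induction n; simpl; auto. rewrite IHn, (H n); auto. ring. Qed.
Lemma Csum_add m n f : Csum_lt (m + n) f = (Csum_lt m f + Csum_lt n (fun k => f (m + k)%nat))%cx.
Proof.
  induction n; simpl. rewrite Nat.add_0_r; ring.
  rewrite Nat.add_succ_r. simpl. rewrite IHn. ring.
Qed.
Lemma Csum_S n f : Csum_lt (S n) f = (f 0%nat + Csum_lt n (fun k => f (S k)))%cx.
Proof. replace (S n) with (1 + n)%nat by lia. rewrite Csum_add; simpl; ring. Qed.
Lemma Csum_const n c : Csum_lt n (fun _ => c) = (nC n * c)%cx.
Proof. induction n; simpl. cplx; ring. rewrite IHn, nC_S; ring. Qed.
Lemma Csum_exch m n f : Csum_lt m (fun i => Csum_lt n (fun j => f i j)) = Csum_lt n (fun j => Csum_lt m (fun i => f i j)).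
Proof.
  induction m; simpl. symmetry; apply Csum_zero; auto. rewrite IHm, <- Csum_plus; auto.
Qed.
Lemma Csum_mul_block m n f :
  Csum_lt (m * n) f = Csum_lt m (fun i => Csum_lt n (fun j => f (i * n + j)%nat)).
Proof.
  induction m; simpl; auto. rewrite Nat.add_comm, Csum_add, IHm. auto.
Qed.
Lemma Csum_rev n f : Csum_lt n f = Csum_lt n (fun k => f (n - 1 - k)%nat).
Proof.
  induction n; auto. rewrite (Csum_S n (fun k => f (S n - 1 - k)%nat)). simpl.
  rewrite IHn, (Csum_ext n (fun k => f (n - 0 - S k)%nat) (fun k => f (n - 1 - k)%nat)).
  replace (n - 0 - 0)%nat with n by lia. ring. intros; f_equal; lia.
Qed.
Lemma Csum_conj n f : Cconj (Csum_lt n f) = Csum_lt n (fun k => Cconj (f k)).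
Proof. induction n; simpl. cplx; ring. rewrite <- IHn. cplx; ring. Qed.
Lemma Csum_mod_le n f : Cmod (Csum_lt n f) <= Rsum_lt n (fun k => Cmod (f k)).
Proof.
  induction n; simpl. rewrite Cmod_C0; lra. eapply Rle_trans; [apply Cmod_tri|]. lra.
Qed.
Lemma Rsum_le n f g : (forall k, (k < n)%nat -> f k <= g k) -> Rsum_lt n f <= Rsum_lt n g.
Proof. intros H; induction n; simpl. lra. assert (f n <= g n) by auto. assert (Rsum_lt n f <= Rsum_lt n g) by auto. lra. Qed.
Lemma Rsum_nonneg n f : (forall k, (k < n)%nat -> 0 <= f k) -> 0 <= Rsum_lt n f.
Proof. intros H; induction n; simpl. lra. assert (0 <= f n) by auto. assert (0 <= Rsum_lt n f) by auto. lra. Qed.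
Lemma Rsum_scal n c f : Rsum_lt n (fun k => c * f k) = c * Rsum_lt n f.
Proof. induction n; simpl; [|rewrite IHn]; ring. Qed.
Lemma Rsum_add m n f : Rsum_lt (m + n) f = Rsum_lt m f + Rsum_lt n (fun k => f (m + k)%nat).
Proof.
  induction n; simpl. rewrite Nat.add_0_r; ring.
  rewrite Nat.add_succ_r. simpl. rewrite IHn. ring.
Qed.
Lemma Rsum_mono m n f : (forall k, 0 <= f k) -> (m <= n)%nat -> Rsum_lt m f <= Rsum_lt n f.
Proof.
  intros H L. replace n with (m + (n - m))%nat by lia. rewrite Rsum_add.
  assert (0 <= Rsum_lt (n - m) (fun k => f (m + k)%nat)) by (apply Rsum_nonneg; auto). lra.
Qed.
Lemma Rsum_RtoC n f : RtoC (Rsum_lt n f) = Csum_lt n (fun k => RtoC (f k)).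
Proof. induction n; simpl; auto. rewrite RtoC_plus, IHn; auto. Qed.
(** * Limits and dominated series *)

Lemma Ccv_iff u l : Ccv u l <-> Un_cv (fun n => Cmod (u n - l)) 0.
Proof.
  split; intros H e He; destruct (H e He) as [K HK]; exists K; intros n Hn; specialize (HK n Hn).
  - unfold R_dist, Rdist. rewrite Rminus_0_r, Rabs_pos_eq; auto; apply Cmod_nonneg.
  - unfold R_dist, Rdist in HK. rewrite Rminus_0_r, Rabs_pos_eq in HK; auto; apply Cmod_nonneg.
Qed.

Lemma Ccv_squeeze u l (a : nat -> R) K :
  Un_cv a 0 -> (forall n, (K <= n)%nat -> Cmod (u n - l) <= a n) -> Ccv u l.
Proof.
  intros Ha Hu e He. destruct (Ha e He) as [K' HK]. exists (K + K')%nat. intros n Hn.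
  eapply Rle_lt_trans; [apply Hu; lia|]. specialize (HK n ltac:(lia)).
  unfold R_dist, Rdist in HK. rewrite Rminus_0_r in HK. pose proof (Rle_abs (a n)). lra.
Qed.

Lemma small_eq z w : (forall e, 0 < e -> Cmod (z - w) <= e) -> z = w.
Proof.
  intros H. assert (Cmod (z - w) = 0).
  { pose proof (Cmod_nonneg (z - w)). destruct (Rle_lt_or_eq_dec _ _ H0); auto.
    specialize (H (Cmod (z - w) / 2)). lra. }
  apply Cmod_eq0 in H0. replace z with (z - w + w)%cx by ring. rewrite H0. ring.
Qed.

Lemma Ccv_unique u l l' : Ccv u l -> Ccv u l' -> l = l'.
Proof.
  intros H H'. apply small_eq. intros e He.
  destruct (H (e / 2)) as [K HK]; [lra|]. destruct (H' (e / 2)) as [K' HK']; [lra|].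
  specialize (HK (K + K')%nat ltac:(lia)). specialize (HK' (K + K')%nat ltac:(lia)).
  pose proof (Cmod_tri3 l (u (K + K')%nat) l'). rewrite (Cmod_sym l (u _)) in H0. lra.
Qed.

Lemma Clim_eq u l : Ccv u l -> Clim u = l.
Proof.
  intros H. apply (Ccv_unique u); auto. unfold Clim.
  apply epsilon_spec. exists l; auto.
Qed.

Lemma Ccv_const c : Ccv (fun _ => c) c.
Proof. intros e He. exists 0%nat. intros. replace (c - c)%cx with C0 by ring. rewrite Cmod_C0; auto. Qed.

Lemma Ccv_ext u v l K : (forall n, (K <= n)%nat -> u n = v n) -> Ccv u l -> Ccv v l.
Proof.
  intros E H e He. destruct (H e He) as [K' HK]. exists (K + K')%nat. intros n Hn.
  rewrite <- E by lia. apply HK. lia.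
Qed.

Lemma Un_cv_const c : Un_cv (fun _ => c) c.
Proof. intros e He. exists 0%nat. intros. rewrite Rdist_eq; auto. Qed.

Lemma Ccv_plus u v l m : Ccv u l -> Ccv v m -> Ccv (fun n => u n + v n)%cx (l + m).
Proof.
  intros H H' e He. destruct (H (e / 2)) as [K HK]; [lra|]. destruct (H' (e / 2)) as [K' HK']; [lra|].
  exists (K + K')%nat. intros n Hn. specialize (HK n ltac:(lia)). specialize (HK' n ltac:(lia)).
  replace (u n + v n - (l + m))%cx with ((u n - l) + (v n - m))%cx by ring.
  eapply Rle_lt_trans; [apply Cmod_tri|]. lra.
Qed.

Lemma Ccv_scal c u l : Ccv u l -> Ccv (fun n => c * u n)%cx (c * l).
Proof.
  intros H e He. destruct (H (e / (Cmod c + 1))) as [K HK].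
  { apply Rdiv_lt_0_compat; auto. pose proof (Cmod_nonneg c); lra. }
  exists K. intros n Hn. specialize (HK n Hn).
  replace (c * u n - c * l)%cx with (c * (u n - l))%cx by ring. rewrite Cmod_mul.
  pose proof (Cmod_nonneg c). pose proof (Cmod_nonneg (u n - l)).
  apply Rle_lt_trans with ((Cmod c) * (e / (Cmod c + 1))).
  apply Rmult_le_compat_l; lra.
  apply Rmult_lt_reg_r with (Cmod c + 1); [lra|]. field_simplify; [|lra]. nra.
Qed.

Lemma Ccv_bounded u l : Ccv u l -> exists B, 0 < B /\ forall n, Cmod (u n) <= B.
Proof.
  intros H. destruct (H 1) as [K HK]; [lra|].
  exists (Rsum_lt K (fun n => Cmod (u n)) + (Cmod l + 1)). split.
  { pose proof (Cmod_nonneg l). assert (0 <= Rsum_lt K (fun n => Cmod (u n))) by (apply Rsum_nonneg; intros; apply Cmod_nonneg). lra. }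
  intros n. destruct (le_lt_dec K n).
  - specialize (HK n l0). pose proof (Cmod_tri (u n - l) l). replace (u n - l + l)%cx with (u n) in H0 by ring.
    assert (0 <= Rsum_lt K (fun n => Cmod (u n))) by (apply Rsum_nonneg; intros; apply Cmod_nonneg). lra.
  - pose proof (Rsum_mono (S n) K (fun n => Cmod (u n)) (fun k => Cmod_nonneg _) ltac:(lia)). simpl in H0.
    assert (0 <= Rsum_lt n (fun n => Cmod (u n))) by (apply Rsum_nonneg; intros; apply Cmod_nonneg).
    pose proof (Cmod_nonneg l). lra.
Qed.

Lemma Ccv_mult u v l m : Ccv u l -> Ccv v m -> Ccv (fun n => u n * v n)%cx (l * m).
Proof.
  intros H H'. destruct (Ccv_bounded v m H') as (B & HB & Hv).
  apply (Ccv_squeeze _ _ (fun n => Cmod (u n - l) * B + Cmod l * Cmod (v n - m)) 0).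
  - replace 0 with (0 * B + Cmod l * 0) by ring. apply CV_plus; apply CV_mult;
      try (apply Ccv_iff; assumption); apply Un_cv_const.
  - intros n _. replace (u n * v n - l * m)%cx with ((u n - l) * v n + l * (v n - m))%cx by ring.
    eapply Rle_trans; [apply Cmod_tri|]. rewrite !Cmod_mul.
    apply Rplus_le_compat_r. apply Rmult_le_compat_l; auto. apply Cmod_nonneg.
Qed.

Lemma Ccv_mod u l : Ccv u l -> Un_cv (fun n => Cmod (u n)) (Cmod l).
Proof.
  intros H e He. destruct (H e He) as [K HK]. exists K. intros n Hn. specialize (HK n Hn).
  unfold R_dist, Rdist. pose proof (Cmod_rev (u n) l). pose proof (Cmod_rev l (u n)).
  rewrite (Cmod_sym l) in H1. apply Rabs_def1; lra.
Qed.

Lemma Un_cv_le_bound u l B K : Un_cv u l -> (forall n, (K <= n)%nat -> u n <= B) -> l <= B.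
Proof.
  intros H Hb. destruct (Rle_or_lt l B); auto. destruct (H (l - B)) as [K' HK]; [lra|].
  specialize (HK (K + K')%nat ltac:(lia)). specialize (Hb (K + K')%nat ltac:(lia)).
  unfold R_dist, Rdist in HK. apply Rabs_def2 in HK. lra.
Qed.

Lemma Ccv_le u l w B K : Ccv u l -> (forall n, (K <= n)%nat -> Cmod (u n - w) <= B) -> Cmod (l - w) <= B.
Proof.
  intros H Hb. apply (Un_cv_le_bound (fun n => Cmod (u n - w)) _ B K); auto.
  apply Ccv_mod. apply Ccv_plus; auto. apply Ccv_const.
Qed.

Lemma Ccv_subseq u l (f : nat -> nat) : (forall n, (n <= f n)%nat) -> Ccv u l -> Ccv (fun n => u (f n)) l.
Proof. intros Hf H e He. destruct (H e He) as [K HK]. exists K. intros n Hn. apply HK. specialize (Hf n); lia. Qed.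

Lemma Ccv_S u l : Ccv (fun n => u (S n)) l -> Ccv u l.
Proof.
  intros H e He. destruct (H e He) as [K HK]. exists (S K). intros n Hn.
  destruct n; [lia|]. apply HK; lia.
Qed.

Lemma Ccauchy_complete u :
  (forall e, 0 < e -> exists K, forall m n, (K <= m)%nat -> (K <= n)%nat -> Cmod (u m - u n) <= e) ->
  exists l, Ccv u l.
Proof.
  intros H.
  (* [p] stands for [Re] and then for [Im], so the completeness of the reals is invoked in one place
     for both coordinates. *)
  assert (HR : forall p : Cplx -> R, (forall z w, p (z - w)%cx = p z - p w) -> (forall z, Rabs (p z) <= Cmod z) ->
     exists l, Un_cv (fun n => p (u n)) l).
  { intros p Hp Hb. destruct (Rcomplete.R_complete (fun n => p (u n))) as [l Hl]; [|exists l; auto].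
    intros e He. destruct (H (e / 2)) as [K HK]; [lra|]. exists K. intros m n Hm Hn.
    unfold R_dist, Rdist. rewrite <- Hp. eapply Rle_lt_trans; [apply Hb|].
    specialize (HK m n Hm Hn). lra. }
  destruct (HR Re) as [x Hx]; [intros; parts | apply Re_le_Cmod |].
  destruct (HR Im) as [y Hy]; [intros; parts | apply Im_le_Cmod |].
  exists (x, y). apply (Ccv_squeeze _ _ (fun n => Rabs (Re (u n) - x) + Rabs (Im (u n) - y)) 0).
  - intros e He. destruct (Hx (e / 2)) as [K HK]; [lra|]. destruct (Hy (e / 2)) as [K' HK']; [lra|].
    exists (K + K')%nat. intros n Hn. specialize (HK n ltac:(lia)). specialize (HK' n ltac:(lia)).
    unfold R_dist, Rdist in *. rewrite Rminus_0_r, Rabs_pos_eq. lra.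
    pose proof (Rabs_pos (Re (u n) - x)). pose proof (Rabs_pos (Im (u n) - y)). lra.
  - intros n _. eapply Rle_trans; [apply Cmod_le_parts|]. right. reflexivity.
Qed.

Definition Rsummable (a : nat -> R) (A : R) : Prop := Un_cv (fun K => Rsum_lt K a) A.

Lemma Rsummable_bounded (a : nat -> R) B :
  (forall n, 0 <= a n) -> (forall K, Rsum_lt K a <= B) -> exists A, Rsummable a A.
Proof.
  intros H0 HB. destruct (growing_cv (fun K => Rsum_lt K a)) as [A HA].
  - intros n. simpl. specialize (H0 n). lra.
  - exists B. intros x [n ->]. apply HB.
  - exists A. exact HA.
Qed.

Lemma Rsummable_ge (a : nat -> R) A : (forall n, 0 <= a n) -> Rsummable a A -> forall K, Rsum_lt K a <= A.
Proof.
  intros H0 HA K. apply (growing_ineq (fun K => Rsum_lt K a)); auto.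
  intros n. simpl. specialize (H0 n). lra.
Qed.

Lemma Rsummable_scal c (a : nat -> R) A : Rsummable a A -> Rsummable (fun n => c * a n) (c * A).
Proof.
  intros H. unfold Rsummable. replace (fun K => Rsum_lt K (fun n => c * a n)) with (fun K => c * Rsum_lt K a).
  apply CV_mult; auto. apply Un_cv_const.
  apply functional_extensionality; intros; rewrite Rsum_scal; auto.
Qed.

Lemma Rsummable_le (a b : nat -> R) B :
  (forall n, 0 <= a n <= b n) -> Rsummable b B -> exists A, Rsummable a A.
Proof.
  intros H HB. apply Rsummable_bounded with B. intros n; apply H. intros K.
  eapply Rle_trans; [apply Rsum_le|]. intros; apply H.
  apply Rsummable_ge; auto. intros n. specialize (H n); lra.
Qed.

(** For a nonnegative [a], the difference [A - Rsum_lt K a] is the tail; this expression is the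
    error term in all the estimates that follow. *)
Lemma Rsummable_tail (a : nat -> R) A : Rsummable a A -> forall e, 0 < e -> exists K0, forall K, (K0 <= K)%nat -> A - Rsum_lt K a < e.
Proof.
  intros H e He. destruct (H e He) as [K0 HK]. exists K0. intros K HK0. specialize (HK K HK0).
  unfold R_dist, Rdist in HK. apply Rabs_def2 in HK. lra.
Qed.

Lemma Csum_diff_le (g : nat -> Cplx) a K K' :
  (forall n, Cmod (g n) <= a n) -> (K <= K')%nat ->
  Cmod (Csum_lt K' g - Csum_lt K g) <= Rsum_lt K' a - Rsum_lt K a.
Proof.
  intros H L. replace K' with (K + (K' - K))%nat by lia. rewrite Csum_add, Rsum_add.
  match goal with |- Cmod (?x + ?y - ?x) <= _ => replace (x + y - x)%cx with y by ring end.
  eapply Rle_trans; [apply Csum_mod_le|].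
  assert (Rsum_lt (K' - K) (fun k => Cmod (g (K + k)%nat)) <= Rsum_lt (K' - K) (fun k => a (K + k)%nat)) by (apply Rsum_le; auto).
  lra.
Qed.

(** When [g n] is [f (S n)] this is convertible to [Cseries_cv f]: the shift of the index is made
    once, inside the terms. *)
Definition Ssum (g : nat -> Cplx) (l : Cplx) : Prop := Ccv (fun K => Csum_lt K g) l.

Lemma dominated_series (g : nat -> Cplx) a A :
  (forall n, Cmod (g n) <= a n) -> Rsummable a A -> exists l, Ssum g l.
Proof.
  intros H HA. assert (a0 : forall n, 0 <= a n) by (intros n; eapply Rle_trans; [apply Cmod_nonneg|apply H]).
  apply Ccauchy_complete. intros e He. destruct (Rsummable_tail a A HA e He) as [K HK].
  exists K. intros m n Hm Hn.
  assert (W : forall m n, (K <= m)%nat -> (m <= n)%nat -> Cmod (Csum_lt n g - Csum_lt m g) <= e).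
  { intros i j Hi Hj. eapply Rle_trans; [apply (Csum_diff_le g a); auto|].
    specialize (HK i Hi). pose proof (Rsummable_ge a A a0 HA j). lra. }
  destruct (le_lt_dec m n). rewrite Cmod_sym; auto. apply W; lia.
Qed.

Lemma dominated_tail (g : nat -> Cplx) a A l :
  (forall n, Cmod (g n) <= a n) -> Rsummable a A -> Ssum g l ->
  forall K, Cmod (l - Csum_lt K g) <= A - Rsum_lt K a.
Proof.
  intros H HA Hl K. assert (a0 : forall n, 0 <= a n) by (intros n; eapply Rle_trans; [apply Cmod_nonneg|apply H]).
  apply (Ccv_le _ _ _ _ K Hl). intros n Hn.
  eapply Rle_trans; [apply (Csum_diff_le g a); auto|]. pose proof (Rsummable_ge a A a0 HA n). lra.
Qed.

Lemma dominated_le (g : nat -> Cplx) a A l :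
  (forall n, Cmod (g n) <= a n) -> Rsummable a A -> Ssum g l -> Cmod l <= A.
Proof.
  intros H HA Hl. pose proof (dominated_tail g a A l H HA Hl 0). simpl in H0.
  replace (l - C0)%cx with l in H0 by ring. lra.
Qed.

Lemma dominated_abs (g : nat -> Cplx) a A :
  (forall n, Cmod (g n) <= a n) -> Rsummable a A -> exists r, Rsummable (fun n => Cmod (g n)) r.
Proof. intros H HA. apply Rsummable_le with a A; auto. intros n. split; auto. apply Cmod_nonneg. Qed.

Lemma Ssum_unique g l l' : Ssum g l -> Ssum g l' -> l = l'.
Proof. apply Ccv_unique. Qed.
Lemma Ssum_plus f g l m : Ssum f l -> Ssum g m -> Ssum (fun n => f n + g n)%cx (l + m).
Proof.
  intros H H'. eapply Ccv_ext with (K := 0%nat); [|apply (Ccv_plus _ _ _ _ H H')].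
  intros; simpl. rewrite Csum_plus; auto.
Qed.
Lemma Ssum_scal c f l : Ssum f l -> Ssum (fun n => c * f n)%cx (c * l).
Proof.
  intros H. eapply Ccv_ext with (K := 0%nat); [|apply (Ccv_scal c _ _ H)].
  intros; simpl. rewrite Csum_scal; auto.
Qed.
Lemma Ssum_ext f g l : (forall n, f n = g n) -> Ssum f l -> Ssum g l.
Proof. intros H Hf. eapply Ccv_ext with (K := 0%nat); [|apply Hf]. intros; simpl. apply Csum_ext; auto. Qed.

Lemma Csum_cv K (gj : nat -> nat -> Cplx) g :
  (forall n, (n < K)%nat -> Ccv (fun j => gj j n) (g n)) -> Ccv (fun j => Csum_lt K (gj j)) (Csum_lt K g).
Proof.
  induction K; simpl; intros H. apply Ccv_const. apply Ccv_plus; auto.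
Qed.

(* [T j] is any quantity that the partial sums of [gj j] approximate with the error of the
   dominating tail, so that the lemma covers both infinite sums and sums truncated at
   growing indices. *)
Lemma tannery (gj : nat -> nat -> Cplx) g a A (T : nat -> Cplx) l :
  (forall n, Ccv (fun j => gj j n) (g n)) -> Rsummable a A ->
  (forall K, exists J, forall j, (J <= j)%nat -> Cmod (T j - Csum_lt K (gj j)) <= A - Rsum_lt K a) ->
  (forall K, Cmod (l - Csum_lt K g) <= A - Rsum_lt K a) -> Ccv T l.
Proof.
  intros Hg HA HT Hl e He. destruct (Rsummable_tail a A HA (e / 3)) as [K HK]; [lra|].
  specialize (HK K (le_n K)). destruct (HT K) as [J HJ].
  destruct (Csum_cv K gj g (fun n _ => Hg n) (e / 3)) as [J' HJ']; [lra|].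
  exists (J + J')%nat. intros n Hn. specialize (HJ n ltac:(lia)). specialize (HJ' n ltac:(lia)).
  specialize (Hl K). pose proof (Cmod_tri3 (T n) (Csum_lt K (gj n)) l).
  pose proof (Cmod_tri3 (Csum_lt K (gj n)) (Csum_lt K g) l). rewrite Cmod_sym in Hl. lra.
Qed.

(** * Majorants: powers and exponentials *)

Lemma Rpower_ge_1_compat x y z : 1 <= x -> y <= z -> Rpower x y <= Rpower x z.
Proof.
  intros Hx Hy. unfold Rpower. assert (0 <= ln x). { rewrite <- ln_1. destruct Hx. left; apply ln_increasing; lra. subst; lra. }
  assert (y * ln x <= z * ln x) by nra. destruct H0. left; apply exp_increasing; auto. rewrite H0; lra.
Qed.

Lemma Rpower_pos x y : 0 < Rpower x y.
Proof. apply exp_pos. Qed.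

Lemma INR_S_ge1 n : 1 <= INR (S n).
Proof. rewrite S_INR. pose proof (pos_INR n). lra. Qed.

(** Mean value theorem for [t^(-x)] on [[p, p + 1]]: the slope at an interior point is at least as
    steep as at the right end. The right-hand side telescopes in [zeta_summable]. *)
Lemma Rpower_step x n : 0 < x -> x * Rpower (INR (S (S n))) (- (1 + x)) <= Rpower (INR (S n)) (- x) - Rpower (INR (S (S n))) (- x).
Proof.
  intros Hx. pose proof (INR_S_ge1 n). set (p := INR (S n)) in *.
  assert (E : INR (S (S n)) = p + 1) by (unfold p; rewrite (S_INR (S n)); auto). rewrite E.
  destruct (MVT_cor2 (fun t => Rpower t (- x)) (fun t => - x * Rpower t (- x - 1)) p (p + 1)) as (c & Hc & Hc1); [lra | |].
  { intros c Hc. apply derivable_pt_lim_power. lra. }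
  replace (p + 1 - p) with 1 in Hc by ring.
  assert (Rpower (p + 1) (- (1 + x)) <= Rpower c (- x - 1)).
  { replace (- x - 1) with (- (1 + x)) by ring. rewrite !Rpower_Ropp.
    apply Rinv_le_contravar. apply Rpower_pos. apply Rle_Rpower_l; lra. }
  nra.
Qed.

Lemma zeta_summable x : 0 < x -> exists A, Rsummable (fun n => Rpower (INR (S n)) (- (1 + x))) A.
Proof.
  intros Hx. apply Rsummable_bounded with (1 + / x). intros; left; apply Rpower_pos.
  (* The subtracted power makes the induction close; dropping it afterwards leaves the first term
     plus the integral [1 / x]. *)
  assert (H : forall K, Rsum_lt (S K) (fun n => Rpower (INR (S n)) (- (1 + x))) <= 1 + / x - / x * Rpower (INR (S K)) (- x)).
  { induction K. simpl. unfold Rpower at 1 2. rewrite ln_1, !Rmult_0_r, exp_0. lra.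
    change (Rsum_lt (S (S K)) ?f) with (Rsum_lt (S K) f + f (S K)). cbv beta.
    pose proof (Rpower_step x K Hx).
    assert (Rpower (INR (S (S K))) (- (1 + x)) <= / x * (Rpower (INR (S K)) (- x) - Rpower (INR (S (S K))) (- x))).
    { apply Rmult_le_reg_l with x; auto. rewrite <- Rmult_assoc, Rinv_r, Rmult_1_l; lra. }
    lra. }
  intros K. eapply Rle_trans; [apply (Rsum_mono K (S K)); auto; intros; left; apply Rpower_pos|].
  eapply Rle_trans; [apply H|]. pose proof (Rpower_pos (INR (S K)) (- x)). pose proof (Rinv_0_lt_compat x Hx). nra.
Qed.

(** Induction on [k]: the derivative of [exp t - t^(k+1) / (k+1)!] is the difference of the case
    [k], hence nonnegative. *)
Lemma exp_ge_pow k : forall y, 0 <= y -> y ^ k / INR (fact k) <= exp y.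
Proof.
  induction k; intros y Hy.
  - simpl. pose proof (exp_ineq1_le y). lra.
  - destruct (Req_dec y 0) as [->|N].
    { rewrite pow_i by lia. unfold Rdiv. rewrite Rmult_0_l. left; apply exp_pos. }
    assert (Hf : 0 < INR (fact k)) by (apply INR_fact_lt_0).
    assert (Hf' : 0 < INR (fact (S k))) by (apply INR_fact_lt_0).
    destruct (MVT_cor2 (fun t => exp t - t ^ (S k) / INR (fact (S k))) (fun t => exp t - t ^ k / INR (fact k)) 0 y) as (c & Hc & Hc1); [lra | |].
    { intros c _. apply derivable_pt_lim_minus. apply derivable_pt_lim_exp.
      replace (c ^ k / INR (fact k)) with (/ INR (fact (S k)) * (INR (S k) * c ^ pred (S k))).
      2:{ rewrite fact_simpl, mult_INR. simpl pred. field. split; [lra|]. apply not_0_INR; lia. }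
      replace (fun t => t ^ S k / INR (fact (S k))) with (mult_real_fct (/ INR (fact (S k))) (fun t => t ^ S k)).
      apply derivable_pt_lim_scal. apply derivable_pt_lim_pow.
      apply functional_extensionality. intros t. unfold mult_real_fct. field; lra. }
    specialize (IHk c ltac:(lra)). rewrite pow_i, exp_0 in Hc by lia. unfold Rdiv in Hc at 2. rewrite Rmult_0_l in Hc.
    nra.
Qed.

(** Comparing with [n^(-2)] serves twice: it gives summability, and it gives convergence to 0 in the
    proof of [binomial_series]. *)
Lemma pow_exp_bound (p e : R) : 0 < e -> exists B, 0 < B /\
  forall n, Rpower (INR (S n)) p * exp (- (INR (S n) * e)) <= B * Rpower (INR (S n)) (- (1 + 1)).
Proof.
  intros He. destruct (archimed (Rabs p + 2)) as [Hk _].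
  (* Any [k >= p + 2] will do: [(n e)^k / k! <= exp (n e)] then beats [n^p] by two powers of [n]. *)
  set (k := Z.to_nat (up (Rabs p + 2))).
  assert (Hk' : p + 2 <= INR k).
  { unfold k. rewrite INR_IZR_INZ, Z2Nat.id. pose proof (Rle_abs p). lra. apply le_IZR. pose proof (Rabs_pos p). lra. }
  exists (INR (fact k) / e ^ k). pose proof (INR_fact_lt_0 k). pose proof (pow_lt e k He). split.
  { apply Rdiv_lt_0_compat; auto. }
  intros n. set (y := INR (S n)). assert (Hy : 1 <= y) by apply INR_S_ge1.
  pose proof (exp_ge_pow k (y * e) ltac:(nra)). rewrite Rpow_mult_distr in H1.
  rewrite exp_Ropp.
  assert (E1 : 0 < y ^ k * e ^ k / INR (fact k)). { apply Rdiv_lt_0_compat; auto. apply Rmult_lt_0_compat; auto. apply pow_lt; lra. }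
  apply Rle_trans with (Rpower y p * / (y ^ k * e ^ k / INR (fact k))).
  { apply Rmult_le_compat_l. left; apply Rpower_pos. apply Rinv_le_contravar; auto. }
  replace (Rpower y p * / (y ^ k * e ^ k / INR (fact k))) with (INR (fact k) / e ^ k * (Rpower y p * / y ^ k)).
  2:{ field. repeat split; try lra. apply pow_nonzero; lra. }
  apply Rmult_le_compat_l. left; apply Rdiv_lt_0_compat; auto.
  rewrite <- Rpower_pow by lra. rewrite <- Rpower_Ropp, <- Rpower_plus. apply Rpower_ge_1_compat; lra.
Qed.

Lemma pow_exp_summable (p e : R) : 0 < e -> exists A, Rsummable (fun n => Rpower (INR (S n)) p * exp (- (INR (S n) * e))) A.
Proof.
  intros He. destruct (pow_exp_bound p e He) as (B & HB & H). destruct (zeta_summable 1) as [A HA]; [lra|].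
  apply Rsummable_le with (fun n => B * Rpower (INR (S n)) (- (1 + 1))) (B * A).
  - intros n. split; auto. apply Rmult_le_pos. left; apply Rpower_pos. left; apply exp_pos.
  - apply Rsummable_scal; auto.
Qed.
(** * Complex derivatives *)

(** The form without a quotient admits [h = 0], so sums, products and compositions need no case
    distinction. The next two lemmas convert to and from [Cdifferentiable]. *)
Definition cderiv (F : Cplx -> Cplx) (z d : Cplx) : Prop :=
  forall eps, 0 < eps -> exists delta, 0 < delta /\
    forall h, Cmod h < delta -> Cmod (F (z + h)%cx - F z - d * h) <= eps * Cmod h.

Lemma cderiv_Cdifferentiable F z d : cderiv F z d -> Cdifferentiable F z.
Proof.
  intros H. exists d. intros e He. destruct (H (e / 2)) as (r & Hr & Hd); [lra|].
  exists r. split; auto. intros h _ Hh Hm. replace (h - C0)%cx with h in Hm by ring.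
  specialize (Hd h Hm).
  replace ((F (z + h) - F z) / h - d)%cx with ((F (z + h) - F z - d * h) / h)%cx by (field; auto).
  rewrite Cmod_Cdiv by auto. pose proof (Cmod_pos h Hh).
  apply Rle_lt_trans with (e / 2); [|lra]. apply Rmult_le_reg_r with (Cmod h); auto.
  unfold Rdiv at 1. rewrite Rmult_assoc, Rinv_l, Rmult_1_r; lra.
Qed.

Lemma Cdifferentiable_cderiv F z : Cdifferentiable F z -> exists d, cderiv F z d.
Proof.
  intros [d H]. exists d. intros e He. destruct (H e He) as (r & Hr & Hd).
  exists r. split; auto. intros h Hm. destruct (classic (h = C0)) as [->|Hh].
  { replace (z + C0)%cx with z by ring. replace (F z - F z - d * C0)%cx with C0 by ring. rewrite Cmod_C0; lra. }
  specialize (Hd h I Hh). replace (h - C0)%cx with h in Hd by ring. specialize (Hd Hm).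
  replace ((F (z + h) - F z) / h - d)%cx with ((F (z + h) - F z - d * h) / h)%cx in Hd by (field; auto).
  rewrite Cmod_Cdiv in Hd by auto. pose proof (Cmod_pos h Hh).
  apply Rmult_le_reg_r with (/ Cmod h). apply Rinv_0_lt_compat; auto.
  rewrite (Rmult_assoc e), Rinv_r, Rmult_1_r by lra. unfold Rdiv in Hd; lra.
Qed.

Lemma cderiv_const c z : cderiv (fun _ => c) z C0.
Proof. intros e He. exists 1. split; [lra|]. intros h _. replace (c - c - C0 * h)%cx with C0 by ring. rewrite Cmod_C0. pose proof (Cmod_nonneg h). nra. Qed.

Lemma cderiv_id z : cderiv (fun w => w) z C1.
Proof. intros e He. exists 1. split; [lra|]. intros h _. replace (z + h - z - C1 * h)%cx with C0 by ring. rewrite Cmod_C0. pose proof (Cmod_nonneg h). nra. Qed.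

Lemma cderiv_eq F z d d' : cderiv F z d -> d = d' -> cderiv F z d'.
Proof. intros H <-; auto. Qed.

Lemma cderiv_plus F G z d d' : cderiv F z d -> cderiv G z d' -> cderiv (fun w => F w + G w)%cx z (d + d').
Proof.
  intros H H' e He. destruct (H (e / 2)) as (r & Hr & Hd); [lra|]. destruct (H' (e / 2)) as (r' & Hr' & Hd'); [lra|].
  exists (Rmin r r'). split. apply Rmin_pos; auto. intros h Hh.
  specialize (Hd h ltac:(eapply Rlt_le_trans; [apply Hh | apply Rmin_l])).
  specialize (Hd' h ltac:(eapply Rlt_le_trans; [apply Hh | apply Rmin_r])).
  match goal with |- Cmod ?x <= _ => replace x with ((F (z + h) - F z - d * h) + (G (z + h) - G z - d' * h))%cx by ring end.
  eapply Rle_trans; [apply Cmod_tri|]. lra.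
Qed.

Lemma cderiv_lipschitz F z d : cderiv F z d -> exists r, 0 < r /\ forall h, Cmod h < r -> Cmod (F (z + h)%cx - F z) <= (Cmod d + 1) * Cmod h.
Proof.
  intros H. destruct (H 1) as (r & Hr & Hd); [lra|]. exists r. split; auto. intros h Hh. specialize (Hd h Hh).
  replace (F (z + h) - F z)%cx with ((F (z + h) - F z - d * h) + d * h)%cx by ring.
  eapply Rle_trans; [apply Cmod_tri|]. rewrite Cmod_mul. lra.
Qed.

Lemma cderiv_comp F G z d d' : cderiv G z d -> cderiv F (G z) d' -> cderiv (fun w => F (G w)) z (d' * d).
Proof.
  intros HG HF e He. destruct (cderiv_lipschitz _ _ _ HG) as (r1 & Hr1 & HL).
  set (A := Cmod d + 1) in *. set (B := Cmod d' + 1).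
  assert (HA : 0 < A) by (unfold A; pose proof (Cmod_nonneg d); lra).
  assert (HB : 0 < B) by (unfold B; pose proof (Cmod_nonneg d'); lra).
  destruct (HF (e / (2 * A))) as (r2 & Hr2 & H2). { apply Rdiv_lt_0_compat; lra. }
  destruct (HG (e / (2 * B))) as (r3 & Hr3 & H3). { apply Rdiv_lt_0_compat; lra. }
  exists (Rmin r1 (Rmin r3 (r2 / A))). split.
  { repeat apply Rmin_pos; auto. apply Rdiv_lt_0_compat; auto. }
  intros h Hh. pose proof (Rmin_l r1 (Rmin r3 (r2 / A))). pose proof (Rmin_r r1 (Rmin r3 (r2 / A))).
  pose proof (Rmin_l r3 (r2 / A)). pose proof (Rmin_r r3 (r2 / A)).
  specialize (HL h ltac:(lra)). specialize (H3 h ltac:(lra)).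
  set (k := (G (z + h) - G z)%cx) in *.
  assert (Hk : Cmod k < r2). { eapply Rle_lt_trans; [apply HL|]. assert (Cmod h < r2 / A) by lra.
    apply Rmult_lt_reg_r with (/ A). apply Rinv_0_lt_compat; auto. replace (A * Cmod h * / A) with (Cmod h) by (field; lra). auto. }
  specialize (H2 k Hk). replace (G z + k)%cx with (G (z + h)%cx) in H2 by (unfold k; ring).
  replace (F (G (z + h)) - F (G z) - d' * d * h)%cx with ((F (G (z + h)) - F (G z) - d' * k) + d' * (k - d * h))%cx by ring.
  eapply Rle_trans; [apply Cmod_tri|]. rewrite Cmod_mul.
  assert (Cmod d' * Cmod (k - d * h) <= B * (e / (2 * B) * Cmod h)).
  { apply Rmult_le_compat; try apply Cmod_nonneg. unfold B; lra. exact H3. }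
  replace (B * (e / (2 * B) * Cmod h)) with (e / 2 * Cmod h) in H5 by (field; lra).
  assert (e / (2 * A) * Cmod k <= e / (2 * A) * (A * Cmod h)).
  { apply Rmult_le_compat_l; auto. left; apply Rdiv_lt_0_compat; lra. }
  replace (e / (2 * A) * (A * Cmod h)) with (e / 2 * Cmod h) in H6 by (field; lra). lra.
Qed.

Lemma cderiv_mult F G z d d' : cderiv F z d -> cderiv G z d' -> cderiv (fun w => F w * G w)%cx z (d * G z + F z * d').
Proof.
  intros HF HG e He. destruct (cderiv_lipschitz _ _ _ HF) as (r1 & Hr1 & HL).
  set (A := Cmod d + 1) in *. set (B := Cmod (F z) + 1). set (D := Cmod (G z) + 1). set (E := Cmod d' + 1).
  assert (HA : 0 < A) by (unfold A; pose proof (Cmod_nonneg d); lra).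
  assert (HB : 0 < B) by (unfold B; pose proof (Cmod_nonneg (F z)); lra).
  assert (HD : 0 < D) by (unfold D; pose proof (Cmod_nonneg (G z)); lra).
  assert (HE : 0 < E) by (unfold E; pose proof (Cmod_nonneg d'); lra).
  destruct (HF (e / (4 * D))) as (r2 & Hr2 & H2). { apply Rdiv_lt_0_compat; lra. }
  destruct (HG (e / (4 * B))) as (r3 & Hr3 & H3). { apply Rdiv_lt_0_compat; lra. }
  destruct (cderiv_lipschitz _ _ _ HG) as (r4 & Hr4 & HM). fold E in HM.
  exists (Rmin r1 (Rmin r2 (Rmin r3 (Rmin r4 (e / (2 * A * E)))))). split.
  { repeat apply Rmin_pos; auto. apply Rdiv_lt_0_compat; nra. }
  intros h Hh.
  assert (Cmod h < r1 /\ Cmod h < r2 /\ Cmod h < r3 /\ Cmod h < r4 /\ Cmod h < e / (2 * A * E)) as (L1 & L2 & L3 & L4 & L5).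
  { revert Hh. unfold Rmin. repeat destruct Rle_dec; lra. }
  specialize (HL h L1). specialize (H2 h L2). specialize (H3 h L3). specialize (HM h L4).
  replace (F (z + h) * G (z + h) - F z * G z - (d * G z + F z * d') * h)%cx
    with (G z * (F (z + h) - F z - d * h) + F z * (G (z + h) - G z - d' * h) + (F (z + h) - F z) * (G (z + h) - G z))%cx by ring.
  eapply Rle_trans; [apply Cmod_tri|]. eapply Rle_trans; [apply Rplus_le_compat_r; apply Cmod_tri|]. rewrite !Cmod_mul.
  assert (T1 : Cmod (G z) * Cmod (F (z + h) - F z - d * h)%cx <= D * (e / (4 * D) * Cmod h)).
  { apply Rmult_le_compat; try apply Cmod_nonneg. unfold D; lra. exact H2. }
  replace (D * (e / (4 * D) * Cmod h)) with (e / 4 * Cmod h) in T1 by (field; lra).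
  assert (T2 : Cmod (F z) * Cmod (G (z + h) - G z - d' * h)%cx <= B * (e / (4 * B) * Cmod h)).
  { apply Rmult_le_compat; try apply Cmod_nonneg. unfold B; lra. exact H3. }
  replace (B * (e / (4 * B) * Cmod h)) with (e / 4 * Cmod h) in T2 by (field; lra).
  assert (T3 : Cmod (F (z + h) - F z)%cx * Cmod (G (z + h) - G z)%cx <= (A * Cmod h) * (E * Cmod h)).
  { apply Rmult_le_compat; try apply Cmod_nonneg; auto. }
  pose proof (Cmod_nonneg h).
  assert (T4 : (A * Cmod h) * (E * Cmod h) <= e / 2 * Cmod h).
  { replace ((A * Cmod h) * (E * Cmod h)) with ((A * E * Cmod h) * Cmod h) by ring. apply Rmult_le_compat_r; auto.
    apply Rle_trans with (A * E * (e / (2 * A * E))). apply Rmult_le_compat_l; nra. right; field; lra. }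
  lra.
Qed.

Lemma cderiv_scal c F z d : cderiv F z d -> cderiv (fun w => c * F w)%cx z (c * d).
Proof. intros H. eapply cderiv_eq. apply cderiv_mult. apply cderiv_const. exact H. simpl; ring. Qed.

Lemma cderiv_opp F z d : cderiv F z d -> cderiv (fun w => - F w)%cx z (- d).
Proof.
  intros H. replace (fun w => - F w)%cx with (fun w => (- C1) * F w)%cx by (apply functional_extensionality; intros; ring).
  eapply cderiv_eq. apply cderiv_scal; eauto. ring.
Qed.

Lemma cderiv_minus F G z d d' : cderiv F z d -> cderiv G z d' -> cderiv (fun w => F w - G w)%cx z (d - d').
Proof. intros. apply cderiv_plus; auto. apply cderiv_opp; auto. Qed.

Lemma cderiv_sum n (F : nat -> Cplx -> Cplx) z d : (forall k, (k < n)%nat -> cderiv (F k) z (d k)) ->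
  cderiv (fun w => Csum_lt n (fun k => F k w)) z (Csum_lt n d).
Proof. induction n; simpl; intros H. apply cderiv_const. apply cderiv_plus; auto. Qed.

Lemma cderiv_pow n z : cderiv (fun w => w ^ n)%cx z (nC n * z ^ (n - 1)).
Proof.
  induction n. simpl. eapply cderiv_eq; [apply cderiv_const|]. cplx; ring.
  simpl. eapply cderiv_eq. apply cderiv_mult. apply cderiv_id. apply IHn.
  rewrite nC_S. destruct n; simpl. cplx; ring. rewrite !Nat.sub_0_r. simpl. rewrite nC_S. ring.
Qed.

Lemma cderiv_local F G z d r : 0 < r -> (forall h, Cmod h < r -> F (z + h)%cx = G (z + h)%cx) -> cderiv F z d -> cderiv G z d.
Proof.
  intros Hr E H e He. destruct (H e He) as (s & Hs & Hd). exists (Rmin r s). split. apply Rmin_pos; auto.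
  intros h Hh. pose proof (Rmin_l r s). pose proof (Rmin_r r s).
  rewrite <- E by lra. assert (E0 : F z = G z).
  { specialize (E C0). replace (z + C0)%cx with z in E by ring. apply E. rewrite Cmod_C0; auto. }
  rewrite <- E0. apply Hd; lra.
Qed.

Lemma cderiv_cont F z d : cderiv F z d -> forall e, 0 < e -> exists r, 0 < r /\ forall w, Cmod (w - z) < r -> Cmod (F w - F z) < e.
Proof.
  intros H e He. destruct (cderiv_lipschitz _ _ _ H) as (r & Hr & HL).
  assert (HA : 0 < Cmod d + 1) by (pose proof (Cmod_nonneg d); lra).
  exists (Rmin r (e / (Cmod d + 1))). split. apply Rmin_pos; auto. apply Rdiv_lt_0_compat; auto.
  intros w Hw. pose proof (Rmin_l r (e / (Cmod d + 1))). pose proof (Rmin_r r (e / (Cmod d + 1))).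
  specialize (HL (w - z)%cx ltac:(lra)). replace (z + (w - z))%cx with w in HL by ring.
  eapply Rle_lt_trans; [apply HL|]. apply Rmult_lt_reg_r with (/ (Cmod d + 1)). apply Rinv_0_lt_compat; auto.
  replace ((Cmod d + 1) * Cmod (w - z) * / (Cmod d + 1)) with (Cmod (w - z)) by (field; lra). unfold Rdiv in *; lra.
Qed.

Definition seg (a b : Cplx) (t : R) : Cplx := (a + RtoC t * (b - a))%cx.

Lemma mean_value F F' a b B :
  (forall t, 0 <= t <= 1 -> cderiv F (seg a b t) (F' (seg a b t))) ->
  (forall t, 0 <= t <= 1 -> Cmod (F' (seg a b t)) <= B) ->
  Cmod (F b - F a) <= B * Cmod (b - a).
Proof.
  intros HF HB. set (D := (F b - F a)%cx).
  (* Real mean value theorem for the component of [F] in the direction [D]. *)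
  set (p := fun t => Re (Cconj D * F (seg a b t))).
  set (p' := fun t => Re (Cconj D * (F' (seg a b t) * (b - a)))).
  destruct (MVT_cor2 p p' 0 1) as (c & Hc & Hc1); [lra| |].
  { intros t Ht e He. specialize (HF t Ht).
    set (A := Cmod D * Cmod (b - a) + 1).
    assert (HD : 0 <= Cmod D * Cmod (b - a)). { apply Rmult_le_pos; apply Cmod_nonneg. }
    destruct (HF (e / (2 * A))) as (r & Hr & Hd). { apply Rdiv_lt_0_compat; unfold A; lra. }
    assert (Hq : 0 < r / (Cmod (b - a) + 1)). { apply Rdiv_lt_0_compat; auto. pose proof (Cmod_nonneg (b - a)); lra. }
    exists (mkposreal _ Hq). intros h Hh0 Hh. simpl in Hh.
    specialize (Hd (RtoC h * (b - a))%cx).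
    replace (seg a b t + RtoC h * (b - a))%cx with (seg a b (t + h)) in Hd by (unfold seg; rewrite RtoC_plus; ring).
    rewrite Cmod_mul, Cmod_RtoC in Hd.
    assert (Hlt : Rabs h * Cmod (b - a) < r).
    { pose proof (Cmod_nonneg (b - a)). pose proof (Rabs_pos_lt h Hh0).
      apply Rle_lt_trans with (Rabs h * (Cmod (b - a) + 1)). nra.
      apply Rmult_lt_reg_r with (/ (Cmod (b - a) + 1)). apply Rinv_0_lt_compat; lra.
      rewrite Rmult_assoc, Rinv_r, Rmult_1_r by lra. auto. }
    specialize (Hd Hlt).
    replace ((p (t + h) - p t) / h - p' t) with (Re (Cconj D * (F (seg a b (t + h)) - F (seg a b t) - F' (seg a b t) * (RtoC h * (b - a)))) / h).
    2:{ unfold p, p'. unfold Cminus, Cmult, Cplus, Copp, RtoC, Cconj, Re, Im. simpl. field; auto. }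
    unfold Rdiv. rewrite Rabs_mult. rewrite Rabs_inv.
    pose proof (Rabs_pos_lt h Hh0). apply Rmult_lt_reg_r with (Rabs h); auto.
    rewrite Rmult_assoc, Rinv_l, Rmult_1_r by lra.
    eapply Rle_lt_trans; [apply Re_le_Cmod|]. rewrite Cmod_mul, Cmod_Cconj.
    eapply Rle_lt_trans; [apply Rmult_le_compat_l; [apply Cmod_nonneg | apply Hd]|].
    replace (Cmod D * (e / (2 * A) * (Rabs h * Cmod (b - a)))) with ((Cmod D * Cmod (b - a)) / A * (e / 2 * Rabs h)) by (field; unfold A; lra).
    assert (Cmod D * Cmod (b - a) / A <= 1). { apply Rmult_le_reg_r with A. unfold A; lra. unfold Rdiv; rewrite Rmult_assoc, Rinv_l by (unfold A; lra). unfold A; lra. }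
    assert (0 < e / 2 * Rabs h) by (apply Rmult_lt_0_compat; lra). nra. }
  assert (E : p 1 - p 0 = Cmod D * Cmod D).
  { replace (Cmod D * Cmod D) with (Cmod D ^ 2) by ring. rewrite Cmod_sqr. unfold p.
    replace (seg a b 1) with b by (unfold seg; rewrite RtoC_1; ring). replace (seg a b 0) with a by (unfold seg; rewrite RtoC_0; ring).
    unfold D. unfold Cminus, Cmult, Cplus, Copp, Cconj, Re, Im. simpl. ring. }
  rewrite E in Hc. assert (Hp : p' c <= Cmod D * (B * Cmod (b - a))).
  { unfold p'. eapply Rle_trans; [apply Rle_abs|]. eapply Rle_trans; [apply Re_le_Cmod|].
    rewrite !Cmod_mul, Cmod_Cconj. apply Rmult_le_compat_l. apply Cmod_nonneg.
    apply Rmult_le_compat_r. apply Cmod_nonneg. apply HB; lra. }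
  pose proof (Cmod_nonneg D). destruct H as [H|H].
  - apply Rmult_le_reg_l with (Cmod D); auto. lra.
  - rewrite <- H. apply Rmult_le_pos. 2: apply Cmod_nonneg.
    eapply Rle_trans; [apply Cmod_nonneg | apply (HB 0); lra].
Qed.

(** * The complex exponential *)

Lemma Cexp_plus z w : Cexp (z + w) = (Cexp z * Cexp w)%cx.
Proof.
  unfold Cexp, Cplus, Cmult, Re, Im; simpl. rewrite exp_plus, cos_plus, sin_plus. f_equal; ring.
Qed.
Lemma Cexp_0 : Cexp C0 = C1.
Proof. unfold Cexp, C0, C1, RtoC, Re, Im; simpl. rewrite exp_0, cos_0, sin_0. f_equal; ring. Qed.
Lemma Cmod_Cexp z : Cmod (Cexp z) = exp (Re z).
Proof.
  unfold Cmod, Cexp, Re, Im; simpl. pose proof (sin2_cos2 (snd z)) as H. unfold Rsqr in H.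
  replace (_ + _) with (exp (fst z) * exp (fst z) * (sin (snd z) * sin (snd z) + cos (snd z) * cos (snd z))) by ring.
  rewrite H, Rmult_1_r. apply sqrt_square. left; apply exp_pos.
Qed.
Lemma Cexp_neq z : Cexp z <> C0.
Proof. intros H. pose proof (Cmod_Cexp z). rewrite H, Cmod_C0 in H0. pose proof (exp_pos (Re z)). lra. Qed.
Lemma Cexp_opp z : Cexp (- z) = (/ Cexp z)%cx.
Proof.
  assert (Cexp z * Cexp (- z) = C1)%cx. { rewrite <- Cexp_plus. replace (z + - z)%cx with C0 by ring. apply Cexp_0. }
  pose proof (Cexp_neq z). replace (Cexp (- z)) with ((Cexp z * Cexp (- z)) / Cexp z)%cx by (field; auto). rewrite H. field; auto.
Qed.
Lemma Cexp_RtoC x : Cexp (RtoC x) = RtoC (exp x).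
Proof. unfold Cexp, RtoC, Re, Im; simpl. rewrite cos_0, sin_0. f_equal; ring. Qed.

Lemma sin_abs_le u : Rabs (sin u) <= Rabs u.
Proof.
  assert (P : forall u, 0 < u -> Rabs (sin u) <= u).
  { intros x Hx. destruct (MVT_cor2 sin cos 0 x Hx) as (c & Hc & _).
    { intros; apply derivable_pt_lim_sin. }
    rewrite sin_0 in Hc. replace (sin x) with (cos c * x) by lra. rewrite Rabs_mult, (Rabs_pos_eq x) by lra.
    pose proof (COS_bound c). assert (Rabs (cos c) <= 1) by (apply Rabs_le; lra). nra. }
  destruct (Rtotal_order u 0) as [H|[->|H]].
  - rewrite (Rabs_left u) by lra. rewrite <- (Rabs_Ropp (sin u)), <- sin_neg. apply P; lra.
  - rewrite sin_0, Rabs_R0; lra.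
  - rewrite (Rabs_pos_eq u) by lra. auto.
Qed.

Lemma cos_near0 u : 0 <= 1 - cos u <= u * u / 2.
Proof.
  pose proof (COS_bound u). split; [lra|]. replace u with (2 * (u / 2)) at 1 by field. rewrite cos_2a_sin.
  pose proof (sin_abs_le (u / 2)). pose proof (Rabs_pos (sin (u / 2))).
  assert (Rabs (sin (u / 2)) * Rabs (sin (u / 2)) <= Rabs (u / 2) * Rabs (u / 2)) by nra.
  rewrite <- !Rabs_mult, !Rabs_pos_eq in H2 by nra. nra.
Qed.

Lemma sin_near0 u : Rabs u <= 1 -> Rabs (sin u - u) <= u * u.
Proof.
  intros Hu.
  assert (P : forall u, 0 < u <= 1 -> Rabs (sin u - u) <= u * u).
  { intros x Hx. destruct (MVT_cor2 (fun t => sin t - t) (fun t => cos t - 1) 0 x) as (c & Hc & Hc1); [lra| |].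
    { intros; apply derivable_pt_lim_minus; [apply derivable_pt_lim_sin | apply derivable_pt_lim_id]. }
    rewrite sin_0 in Hc. replace (sin x - x) with ((cos c - 1) * x) by lra.
    pose proof (cos_near0 c). rewrite Rabs_mult, (Rabs_pos_eq x), <- Rabs_Ropp, Rabs_pos_eq by lra. nra. }
  destruct (Rtotal_order u 0) as [H|[->|H]].
  - rewrite <- Rabs_Ropp. replace (- (sin u - u)) with (sin (- u) - - u) by (rewrite sin_neg; ring).
    replace (u * u) with (- u * - u) by ring. apply P. rewrite Rabs_left in Hu; lra.
  - rewrite sin_0, Rminus_0_r, Rabs_R0; lra.
  - apply P. rewrite Rabs_pos_eq in Hu; lra.
Qed.

(** Everything follows from [1 + a <= exp a], used at [a] and at [- a]; the second use gives
    [exp a <= 1 / (1 - a)]. *)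
Lemma exp_near0 a : Rabs a <= 1 / 2 -> Rabs (exp a - 1 - a) <= 2 * a * a /\ exp a <= 2.
Proof.
  intros H. assert (Ha : -1/2 <= a <= 1/2). { revert H. unfold Rabs; destruct Rcase_abs; lra. }
  pose proof (exp_ineq1_le a). pose proof (exp_ineq1_le (- a)) as H2. rewrite exp_Ropp in H2.
  rewrite Rabs_pos_eq by lra. pose proof (exp_pos a).
  assert (exp a * (1 - a) <= 1). { apply Rle_trans with (exp a * / exp a). apply Rmult_le_compat_l; lra. right; apply Rinv_r; lra. }
  assert (exp a <= 2) by nra. split; nra.
Qed.

Lemma Cexp_near0 h : Cmod h <= 1 / 2 -> Cmod (Cexp h - C1 - h) <= 6 * (Cmod h * Cmod h).
Proof.
  intros Hh. pose proof (Re_le_Cmod h) as Ha. pose proof (Im_le_Cmod h) as Hb. pose proof (Cmod_sqr h) as Hs.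
  destruct h as [a b]. set (r := Cmod (a, b)) in *. unfold Re, Im in Ha, Hb, Hs; simpl in Ha, Hb, Hs.
  destruct (exp_near0 a) as [A A2]; [lra|]. pose proof (cos_near0 b) as Cs. pose proof (sin_near0 b ltac:(lra)) as Sn.
  pose proof (sin_abs_le b) as Sb. pose proof (exp_pos a) as Ep.
  eapply Rle_trans; [apply Cmod_le_parts|].
  replace (Re (Cexp (a, b) - C1 - (a, b))) with ((exp a - 1 - a) - exp a * (1 - cos b)).
  2:{ unfold Cexp, C1, Cminus, Cplus, Copp, RtoC, Re, Im; simpl; ring. }
  replace (Im (Cexp (a, b) - C1 - (a, b))) with ((exp a - 1) * sin b + (sin b - b)).
  2:{ unfold Cexp, C1, Cminus, Cplus, Copp, RtoC, Re, Im; simpl; ring. }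
  assert (T1 : Rabs (exp a - 1 - a - exp a * (1 - cos b)) <= 2 * a * a + b * b).
  { unfold Rminus at 1. eapply Rle_trans; [apply Rabs_triang|]. rewrite Rabs_Ropp, Rabs_mult, (Rabs_pos_eq (exp a)), (Rabs_pos_eq (1 - cos b)) by lra. nra. }
  assert (T2 : Rabs (exp a - 1) <= 2 * Rabs a).
  { replace (exp a - 1) with ((exp a - 1 - a) + a) by ring. eapply Rle_trans; [apply Rabs_triang|].
    assert (2 * a * a <= Rabs a); [|lra]. replace (2 * a * a) with (2 * (Rabs a * Rabs a)).
    2:{ rewrite <- Rabs_mult, Rabs_pos_eq by nra. ring. } pose proof (Rabs_pos a). nra. }
  assert (T3 : Rabs ((exp a - 1) * sin b + (sin b - b)) <= 2 * (Rabs a * Rabs b) + b * b).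
  { eapply Rle_trans; [apply Rabs_triang|]. rewrite Rabs_mult. pose proof (Rabs_pos (exp a - 1)). pose proof (Rabs_pos (sin b)). pose proof (Rabs_pos a). nra. }
  assert (T4 : 2 * (Rabs a * Rabs b) <= a * a + b * b).
  { rewrite <- Rabs_mult. pose proof (Rle_0_sqr (a - b)). pose proof (Rle_0_sqr (a + b)). unfold Rsqr in *. unfold Rabs; destruct Rcase_abs; lra. }
  clear - T1 T3 T4 Hs. pose proof (Rle_0_sqr a). pose proof (Rle_0_sqr b). unfold Rsqr in *. simpl in Hs. lra.
Qed.

Lemma cderiv_Cexp z : cderiv Cexp z (Cexp z).
Proof.
  intros e He. pose proof (Cmod_pos _ (Cexp_neq z)) as Hz. set (m := Cmod (Cexp z)) in *.
  exists (Rmin (1 / 2) (e / (6 * m))). split. apply Rmin_pos; [lra|]. apply Rdiv_lt_0_compat; lra.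
  intros h Hh. pose proof (Rmin_l (1 / 2) (e / (6 * m))). pose proof (Rmin_r (1 / 2) (e / (6 * m))).
  rewrite Cexp_plus. replace (Cexp z * Cexp h - Cexp z - Cexp z * h)%cx with (Cexp z * (Cexp h - C1 - h))%cx by ring.
  rewrite Cmod_mul. fold m. pose proof (Cexp_near0 h ltac:(lra)). pose proof (Cmod_nonneg h).
  apply Rle_trans with (m * (6 * (Cmod h * Cmod h))). apply Rmult_le_compat_l; lra.
  replace (m * (6 * (Cmod h * Cmod h))) with ((6 * m * Cmod h) * Cmod h) by ring. apply Rmult_le_compat_r; auto.
  apply Rle_trans with (6 * m * (e / (6 * m))). apply Rmult_le_compat_l; lra. right; field; lra.
Qed.

Lemma seg_mod t z : 0 <= t <= 1 -> Cmod (seg C0 z t) <= Cmod z.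
Proof.
  intros Ht. unfold seg. replace (C0 + RtoC t * (z - C0))%cx with (RtoC t * z)%cx by ring.
  rewrite Cmod_mul, Cmod_RtoC, Rabs_pos_eq by lra. pose proof (Cmod_nonneg z). nra.
Qed.

Lemma Cmod_Cexp_le u : Cmod (Cexp u) <= exp (Cmod u).
Proof.
  rewrite Cmod_Cexp. pose proof (Re_le_Cmod u). pose proof (Rle_abs (Re u)).
  destruct (Rle_lt_or_eq_dec (Re u) (Cmod u)); [lra | left; apply exp_increasing; auto | right; f_equal; auto].
Qed.
Lemma exp_le x y : x <= y -> exp x <= exp y.
Proof. intros [H| ->]; [left; apply exp_increasing; auto | right; auto]. Qed.

(** Now that [Cexp] is known to be its own derivative, the mean value inequality on the segment from
    0 to [u] replaces the local estimates by bounds for every [u]. A second round, applied to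
    [exp u - 1 - u], gives [Cexp_bound2]. *)
Lemma Cexp_bound1 u : Cmod (Cexp u - C1) <= Cmod u * exp (Cmod u).
Proof.
  rewrite <- Cexp_0. rewrite Rmult_comm. replace (Cmod u) with (Cmod (u - C0)) at 2 by (f_equal; ring).
  apply (mean_value Cexp Cexp). intros; apply cderiv_Cexp.
  intros t Ht. eapply Rle_trans; [apply Cmod_Cexp_le|]. apply exp_le. apply seg_mod; auto.
Qed.

Lemma Cexp_bound2 u : Cmod (Cexp u - C1 - u) <= Cmod u * Cmod u * exp (Cmod u).
Proof.
  replace (Cexp u - C1 - u)%cx with ((Cexp u - C1 - u) - (Cexp C0 - C1 - C0))%cx by (rewrite Cexp_0; ring).
  replace (Cmod u * Cmod u * exp (Cmod u)) with ((Cmod u * exp (Cmod u)) * Cmod (u - C0)).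
  2:{ replace (u - C0)%cx with u by ring. ring. }
  apply (mean_value (fun u => Cexp u - C1 - u)%cx (fun u => Cexp u - C1)%cx).
  - intros t _. eapply cderiv_eq. apply cderiv_minus. apply cderiv_minus. apply cderiv_Cexp. apply cderiv_const. apply cderiv_id. ring.
  - intros t Ht. eapply Rle_trans; [apply Cexp_bound1|]. pose proof (seg_mod t u Ht). pose proof (Cmod_nonneg (seg C0 u t)).
    apply Rmult_le_compat; auto. left; apply exp_pos. apply exp_le; auto.
Qed.
(** * Logarithm and powers on the right half-plane *)

Lemma Arg_pos z : 0 < Re z -> Arg z = atan (Im z / Re z).
Proof. intros H. unfold Arg. simpl. destruct Rlt_dec; [auto | lra]. Qed.

Lemma Re_pos_neq z : 0 < Re z -> z <> C0.
Proof. intros H ->. unfold Re in H; simpl in H; lra. Qed.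

Lemma Cmod_polar z : 0 < Re z -> Cmod z = Re z * sqrt (1 + (Im z / Re z)²).
Proof.
  intros H. unfold Cmod. rewrite <- (sqrt_square (Re z)) at 2 by lra. rewrite <- sqrt_mult.
  f_equal. unfold Rsqr. field. lra. nra. pose proof (Rle_0_sqr (Im z / Re z)); lra.
Qed.

Lemma Cexp_Cln z : 0 < Re z -> Cexp (Cln z) = z.
Proof.
  intros H. pose proof (Cmod_pos z (Re_pos_neq z H)) as Hm.
  unfold Cln, Cexp. unfold Re at 1 2, Im at 1 2. simpl. rewrite exp_ln by auto. rewrite (Arg_pos z H), cos_atan, sin_atan.
  pose proof (Cmod_polar z H) as E. set (r := sqrt _) in *.
  assert (0 < r). { unfold r. apply sqrt_lt_R0. pose proof (Rle_0_sqr (Im z / Re z)); lra. }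
  rewrite E. apply Cplx_ext; unfold Re at 1, Im at 1; simpl; field; lra.
Qed.

Lemma Cpow_exp z p : z <> C0 -> Cpow z p = Cexp (p * Cln z).
Proof.
  intros H. unfold Cpow. destruct Req_EM_T as [E|]; auto. destruct Req_EM_T as [E'|]; auto.
  exfalso; apply H. apply Cplx_ext; [rewrite E | rewrite E']; reflexivity.
Qed.

Lemma Cln_RtoC x : 0 < x -> Cln (RtoC x) = RtoC (ln x).
Proof.
  intros H. unfold Cln. rewrite Cmod_RtoC, Rabs_pos_eq, Arg_pos by (unfold Re; simpl; lra).
  unfold Re, Im, RtoC; simpl. unfold Rdiv. rewrite Rmult_0_l, atan_0. reflexivity.
Qed.

Lemma Cln_scale r z : 0 < r -> 0 < Re z -> Cln (RtoC r * z) = (RtoC (ln r) + Cln z)%cx.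
Proof.
  intros Hr Hz. assert (E1 : Re (RtoC r * z) = r * Re z) by (parts).
  assert (E2 : Im (RtoC r * z) = r * Im z) by (parts).
  unfold Cln. rewrite Cmod_mul, Cmod_RtoC, Rabs_pos_eq by lra.
  rewrite ln_mult; auto. 2:{ apply Cmod_pos, Re_pos_neq; auto. }
  rewrite !Arg_pos by (try rewrite E1; nra). rewrite E1, E2.
  replace (r * Im z / (r * Re z)) with (Im z / Re z) by (field; split; lra).
  unfold Cplus, RtoC, Re, Im; simpl. f_equal; ring.
Qed.

Lemma Re_Ci_mul z : Re (Ci * z) = - Im z.
Proof. parts. Qed.
Lemma Im_Ci_mul z : Im (Ci * z) = Re z.
Proof. parts. Qed.

(** Both [z] and [i z] lie in the right half-plane, where the principal argument is an arctangent,
    and [atan (1 / x) = PI / 2 - atan x] for positive [x]. This extracts the phase from the points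
    of Lipschitz's formula. *)
Lemma Cln_Ci_mul z : 0 < Re z -> Im z < 0 -> Cln (Ci * z) = (Cln z + Ci * RtoC (PI / 2))%cx.
Proof.
  intros H H'. unfold Cln. rewrite Cmod_mul, Cmod_I, Rmult_1_l.
  rewrite !Arg_pos by (try rewrite Re_Ci_mul; lra). rewrite Re_Ci_mul, Im_Ci_mul.
  assert (0 < (- Im z / Re z)) by (apply Rdiv_lt_0_compat; lra).
  replace (Re z / - Im z) with (/ (- Im z / Re z)) by (field; lra).
  rewrite atan_inv by auto. replace (- Im z / Re z) with (- (Im z / Re z)) by (field; lra). rewrite atan_opp.
  cplx; ring.
Qed.

Lemma Cln_conj z : 0 < Re z -> Cln (Cconj z) = Cconj (Cln z).
Proof.
  intros H. unfold Cln. rewrite Cmod_Cconj, !Arg_pos by auto.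
  replace (Im (Cconj z) / Re (Cconj z)) with (- (Im z / Re z)).
  2:{ unfold Cconj, Re, Im; simpl; unfold Re in H; field; lra. }
  rewrite atan_opp. reflexivity.
Qed.

Lemma Cln_mCi_mul z : 0 < Re z -> 0 < Im z -> Cln (- Ci * z) = (Cln z - Ci * RtoC (PI / 2))%cx.
Proof.
  intros H H'. pose proof (Cln_Ci_mul (Cconj z) H) as E. unfold Im in E at 1; simpl in E. specialize (E ltac:(unfold Im in *; lra)).
  replace (- Ci * z)%cx with (Cconj (Ci * Cconj z)) by (cplx; ring).
  rewrite Cln_conj, E, Cln_conj by (auto; rewrite Re_Ci_mul; unfold Cconj, Im in *; simpl; lra).
  apply Cplx_ext; parts.
Qed.

Lemma Cpow_neq z p : z <> C0 -> Cpow z p <> C0.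
Proof. intros H. rewrite Cpow_exp by auto. apply Cexp_neq. Qed.
Lemma Cpow_plus z p q : z <> C0 -> Cpow z (p + q) = (Cpow z p * Cpow z q)%cx.
Proof. intros H. rewrite !Cpow_exp by auto. rewrite <- Cexp_plus. f_equal; ring. Qed.
Lemma Cpow_opp z p : z <> C0 -> Cpow z (- p) = (/ Cpow z p)%cx.
Proof. intros H. rewrite !Cpow_exp by auto. rewrite <- Cexp_opp. f_equal; ring. Qed.
Lemma Cpow_0 z : z <> C0 -> Cpow z C0 = C1.
Proof. intros H. rewrite Cpow_exp by auto. replace (C0 * Cln z)%cx with C0 by ring. apply Cexp_0. Qed.
Lemma Cpow_1 z : 0 < Re z -> Cpow z C1 = z.
Proof. intros H. rewrite Cpow_exp by (apply Re_pos_neq; auto). replace (C1 * Cln z)%cx with (Cln z) by ring. apply Cexp_Cln; auto. Qed.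
Lemma Cpow_C1 p : Cpow C1 p = C1.
Proof.
  rewrite Cpow_exp by apply C1_neq_0. change C1 with (RtoC 1). rewrite Cln_RtoC, ln_1, RtoC_0 by lra.
  replace (p * C0)%cx with C0 by ring. apply Cexp_0.
Qed.
Lemma Cpow_scale r z p : 0 < r -> 0 < Re z -> Cpow (RtoC r * z) p = (Cpow (RtoC r) p * Cpow z p)%cx.
Proof.
  intros Hr Hz. assert (Re (RtoC r * z) = r * Re z) by (parts).
  assert (N : (RtoC r * z)%cx <> C0) by (apply Re_pos_neq; rewrite H; nra).
  rewrite !Cpow_exp by (auto using Re_pos_neq; apply RtoC_neq; lra).
  rewrite <- Cexp_plus, Cln_scale, (Cln_RtoC r) by auto. f_equal; ring.
Qed.
Lemma Cpow_RtoC_mod x p : 0 < x -> Cmod (Cpow (RtoC x) p) = Rpower x (Re p).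
Proof.
  intros H. rewrite Cpow_exp by (apply RtoC_neq; lra). rewrite Cln_RtoC, Cmod_Cexp by auto. unfold Rpower. f_equal.
  parts.
Qed.
Lemma Cpow_nC_mod n p : Cmod (Cpow (nC (S n)) p) = Rpower (INR (S n)) (Re p).
Proof. apply Cpow_RtoC_mod. pose proof (INR_S_ge1 n); lra. Qed.

(** The modulus is [|z|^(Re p) exp (- Im p Arg z)]. Bounding the argument by [PI] makes the second
    factor independent of [z], as majorants require. *)
Lemma Cpow_mod_le z p : 0 < Re z -> Cmod (Cpow z p) <= Rpower (Cmod z) (Re p) * exp (Rabs (Im p) * PI).
Proof.
  intros H. rewrite Cpow_exp by (apply Re_pos_neq; auto). rewrite Cmod_Cexp.
  replace (Re (p * Cln z)) with (Re p * ln (Cmod z) + - (Im p * Arg z)) by (unfold Cln, Cmult, Re, Im; simpl; ring).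
  rewrite exp_plus. apply Rmult_le_compat_l. left; apply exp_pos. apply exp_le.
  eapply Rle_trans; [apply Rle_abs|]. rewrite Rabs_Ropp, Rabs_mult. apply Rmult_le_compat_l. apply Rabs_pos.
  rewrite Arg_pos by auto. pose proof (atan_bound (Im z / Re z)). pose proof PI_RGT_0. apply Rabs_le. lra.
Qed.

Lemma Cpow_Cpown z n : 0 < Re z -> Cpow z (nC n) = (z ^ n)%cx.
Proof.
  intros H. induction n; simpl. apply Cpow_0, Re_pos_neq; auto.
  rewrite nC_S, Cpow_plus, IHn, Cpow_1 by (auto; apply Re_pos_neq; auto). ring.
Qed.

(** The logarithm will be differentiated as the inverse of [Cexp], which requires to know in advance
    that its increments are small and that nearby points stay in the half-plane. *)
Lemma Cln_cont z : 0 < Re z -> forall e, 0 < e -> exists r, 0 < r /\ forall w, Cmod (w - z) < r -> 0 < Re w /\ Cmod (Cln w - Cln z) < e.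
Proof.
  intros Hz e He. pose proof (Cmod_pos z (Re_pos_neq z Hz)) as Hm.
  destruct (ln_continue (Cmod z) Hm (e / 2)) as (r1 & Hr1 & H1); [lra|].
  destruct (derivable_continuous_pt _ _ (derivable_pt_atan (Im z / Re z)) (e / 2)) as (r2 & Hr2 & H2); [lra|].
  simpl in H1, H2. unfold R_dist, Rdist in H1, H2.
  set (x := Re z) in *. set (y := Im z) in *.
  (* [B] is a Lipschitz constant for the quotient [Im / Re] at [z] as long as the real part stays
     above [x / 2]. *)
  set (B := (Rabs x + Rabs y) / (x * (x / 2))).
  assert (HB : 0 < B). { apply Rdiv_lt_0_compat; [|nra]. rewrite (Rabs_pos_eq x) by lra. pose proof (Rabs_pos y); lra. }
  exists (Rmin (Cmod z) (Rmin r1 (Rmin (x / 2) (r2 / B)))). split.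
  { repeat apply Rmin_pos; auto; try lra. apply Rdiv_lt_0_compat; auto. }
  intros w Hw. assert (Cmod (w - z) < Cmod z /\ Cmod (w - z) < r1 /\ Cmod (w - z) < x / 2 /\ Cmod (w - z) < r2 / B) as (L0 & L1 & L2 & L3).
  { revert Hw. unfold Rmin. repeat destruct Rle_dec; lra. }
  pose proof (Re_le_Cmod (w - z)) as Rr. pose proof (Im_le_Cmod (w - z)) as Ri.
  replace (Re (w - z)) with (Re w - x) in Rr by (unfold x, Cminus, Cplus, Copp, Re, Im; simpl; ring).
  replace (Im (w - z)) with (Im w - y) in Ri by (unfold y, Cminus, Cplus, Copp, Re, Im; simpl; ring).
  assert (Hx2 : x / 2 <= Re w). { assert (Rabs (Re w - x) < x / 2) by lra. apply Rabs_def2 in H. lra. }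
  assert (Hw0 : 0 < Re w) by lra. split; auto.
  pose proof (Cmod_pos w (Re_pos_neq w Hw0)) as Hmw.
  eapply Rle_lt_trans; [apply Cmod_le_parts|].
  replace (Re (Cln w - Cln z)) with (ln (Cmod w) - ln (Cmod z)) by (unfold Cln, Cminus, Cplus, Copp, Re, Im; simpl; ring).
  replace (Im (Cln w - Cln z)) with (Arg w - Arg z) by (unfold Cln, Cminus, Cplus, Copp, Re, Im; simpl; ring).
  rewrite !Arg_pos by auto. fold x y.
  assert (T1 : Rabs (ln (Cmod w) - ln (Cmod z)) < e / 2).
  { destruct (Req_dec (Cmod w) (Cmod z)) as [->|N]. rewrite Rminus_diag, Rabs_R0; lra.
    apply H1. repeat split; auto. pose proof (Cmod_rev w z). pose proof (Cmod_rev z w). rewrite (Cmod_sym z w) in H0.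
    apply Rabs_def1; lra. }
  assert (T2 : Rabs (atan (Im w / Re w) - atan (y / x)) < e / 2).
  { destruct (Req_dec (Im w / Re w) (y / x)) as [->|N]. rewrite Rminus_diag, Rabs_R0; lra.
    apply H2. repeat split; auto.
    replace (Im w / Re w - y / x) with (((Im w - y) * x + - (y * (Re w - x))) / (x * Re w)) by (field; split; lra).
    unfold Rdiv. rewrite Rabs_mult, Rabs_inv, (Rabs_pos_eq (x * Re w)) by nra.
    apply Rle_lt_trans with (B * Cmod (w - z)).
    - unfold B, Rdiv. replace ((Rabs x + Rabs y) * / (x * (x * / 2)) * Cmod (w - z)) with (((Rabs x + Rabs y) * Cmod (w - z)) * / (x * (x * / 2))) by ring.
      apply Rmult_le_compat. apply Rabs_pos. left; apply Rinv_0_lt_compat; nra.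
      + eapply Rle_trans; [apply Rabs_triang|]. rewrite Rabs_Ropp, !Rabs_mult. pose proof (Rabs_pos x). pose proof (Rabs_pos y). nra.
      + apply Rinv_le_contravar; nra.
    - apply Rmult_lt_reg_r with (/ B). apply Rinv_0_lt_compat; auto.
      replace (B * Cmod (w - z) * / B) with (Cmod (w - z)) by (field; lra). unfold Rdiv in L3; lra. }
  lra.
Qed.

Lemma cderiv_Cln z : 0 < Re z -> cderiv Cln z (/ z).
Proof.
  intros Hz e He. pose proof (Re_pos_neq z Hz) as Hz0. pose proof (Cmod_pos z Hz0) as Hm.
  set (m := Cmod z) in *.
  (* The first bound on [eta] controls the increment of the logarithm by [h]; the second turns the
     error of [Cexp] into the required [e |h|]. *)
  set (eta := Rmin (m / 2) (e * (m * m) / 2)).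
  assert (He' : 0 < eta) by (unfold eta; apply Rmin_pos; [lra|]; apply Rdiv_lt_0_compat; [|lra]; repeat apply Rmult_lt_0_compat; auto).
  destruct (cderiv_Cexp (Cln z) eta He') as (r1 & Hr1 & H1). rewrite Cexp_Cln in H1 by auto.
  destruct (Cln_cont z Hz r1 Hr1) as (r & Hr & H2). exists r. split; auto.
  intros h Hh. destruct (H2 (z + h)%cx) as [Hp Hc]. { replace (z + h - z)%cx with h by ring; auto. }
  set (k := (Cln (z + h) - Cln z)%cx) in *. specialize (H1 k Hc).
  replace (Cln z + k)%cx with (Cln (z + h)) in H1 by (unfold k; ring). rewrite Cexp_Cln in H1 by auto.
  replace (z + h - z - z * k)%cx with (h - z * k)%cx in H1 by ring.
  (* [h = z k + o(k)] forces [|k| <= 2 |h| / |z|]. *)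
  assert (Hk : m * Cmod k <= 2 * Cmod h).
  { pose proof (Cmod_rev (z * k) h). rewrite Cmod_mul, Cmod_sym in H. fold m in H.
    assert (eta <= m / 2) by apply Rmin_l. pose proof (Cmod_nonneg k). nra. }
  replace (k - / z * h)%cx with (- (h - z * k) / z)%cx by (field; auto).
  rewrite Cmod_Cdiv, Cmod_neg by auto. fold m.
  assert (eta <= e * (m * m) / 2) by apply Rmin_r. pose proof (Cmod_nonneg k).
  apply Rmult_le_reg_r with m; auto. unfold Rdiv. rewrite Rmult_assoc, Rinv_l, Rmult_1_r by lra.
  eapply Rle_trans; [apply H1|]. apply Rle_trans with (e * (m * m) / 2 * Cmod k). apply Rmult_le_compat_r; auto.
  replace (e * (m * m) / 2 * Cmod k) with (e * m / 2 * (m * Cmod k)) by field.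
  replace (e * Cmod h * m) with (e * m / 2 * (2 * Cmod h)) by field.
  apply Rmult_le_compat_l; auto. apply Rmult_le_pos; [|lra]. apply Rmult_le_pos; lra.
Qed.

Lemma cderiv_Cpow z p : 0 < Re z -> cderiv (fun w => Cpow w p) z (p * Cpow z (p - C1)).
Proof.
  intros Hz. pose proof (Re_pos_neq z Hz) as Hz0.
  apply (cderiv_local (fun w => Cexp (p * Cln w)) _ _ _ (Re z)); auto.
  - intros h Hh. symmetry. apply Cpow_exp. apply Re_pos_neq.
    pose proof (Re_le_Cmod h). assert (Rabs (Re h) < Re z) by lra. apply Rabs_def2 in H0.
    unfold Cplus, Re in *; simpl; lra.
  - eapply cderiv_eq. apply (cderiv_comp Cexp (fun w => p * Cln w)%cx). apply cderiv_scal. apply cderiv_Cln; auto.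
    apply cderiv_Cexp. unfold Cminus. rewrite Cpow_plus, Cpow_opp, Cpow_1 by auto. cbv beta. rewrite <- Cpow_exp by auto. ring.
Qed.

Lemma cderiv_Cpow_exponent a z : a <> C0 -> cderiv (fun s => Cpow a s) z (Cln a * Cpow a z).
Proof.
  intros Ha. rewrite Cpow_exp by auto.
  replace (fun s => Cpow a s) with (fun s => Cexp (s * Cln a)) by (apply functional_extensionality; intros; symmetry; apply Cpow_exp; auto).
  eapply cderiv_eq. apply (cderiv_comp Cexp (fun s => s * Cln a)%cx). apply cderiv_mult. apply cderiv_id. apply cderiv_const.
  apply cderiv_Cexp. cbv beta. ring.
Qed.

(** * Goursat's theorem and the identity principle *)

Definition differentiable (F : Cplx -> Cplx) : Prop := forall z, exists d, cderiv F z d.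

Definition pcont (g : R -> Cplx) : Prop := forall t e, 0 < e -> exists r, 0 < r /\ forall s, Rabs (s - t) < r -> Cmod (g s - g t) < e.

Definition CInt (g : R -> Cplx) (a b : R) : Cplx := (RInt (fun t => Re (g t)) a b, RInt (fun t => Im (g t)) a b).

Lemma pcont_component (p : Cplx -> R) g t :
  (forall z w, p (z - w)%cx = p z - p w) -> (forall z, Rabs (p z) <= Cmod z) -> pcont g -> continuous (fun t => p (g t)) t.
Proof.
  intros Hp Hb H. apply continuity_pt_filterlim. intros e He. destruct (H t e He) as (r & Hr & Hd).
  exists r. split; auto. intros x [_ Hx]. simpl in *. unfold R_dist, Rdist in *.
  rewrite <- Hp. eapply Rle_lt_trans; [apply Hb|]. apply Hd; auto.
Qed.
Lemma Re_minus z w : Re (z - w) = Re z - Re w.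
Proof. parts. Qed.
Lemma Im_minus z w : Im (z - w) = Im z - Im w.
Proof. parts. Qed.
Lemma Re_plus z w : Re (z + w) = Re z + Re w.
Proof. reflexivity. Qed.

Lemma pcont_RInt_Re g a b : pcont g -> ex_RInt (fun t => Re (g t)) a b.
Proof. intros H. apply (@ex_RInt_continuous R_CompleteNormedModule). intros. apply (pcont_component Re); auto using Re_minus, Re_le_Cmod. Qed.
Lemma pcont_RInt_Im g a b : pcont g -> ex_RInt (fun t => Im (g t)) a b.
Proof. intros H. apply (@ex_RInt_continuous R_CompleteNormedModule). intros. apply (pcont_component Im); auto using Im_minus, Im_le_Cmod. Qed.

Lemma CInt_Chasles g a b c : pcont g -> (CInt g a b + CInt g b c)%cx = CInt g a c.
Proof.
  intros H. apply Cplx_ext.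
  apply (@RInt_Chasles R_CompleteNormedModule); apply pcont_RInt_Re; auto.
  apply (@RInt_Chasles R_CompleteNormedModule); apply pcont_RInt_Im; auto.
Qed.

Lemma CInt_minus f g a b : pcont f -> pcont g -> CInt (fun t => f t - g t)%cx a b = (CInt f a b - CInt g a b)%cx.
Proof.
  intros Hf Hg. unfold CInt. apply Cplx_ext.
  - rewrite Re_minus. change (RInt (fun t => Re (f t - g t)%cx) a b = RInt (fun t => Re (f t)) a b - RInt (fun t => Re (g t)) a b).
    transitivity (RInt (fun t => minus (Re (f t)) (Re (g t))) a b). apply RInt_ext; intros; apply Re_minus.
    apply (@RInt_minus R_CompleteNormedModule); auto using pcont_RInt_Re.
  - rewrite Im_minus. change (RInt (fun t => Im (f t - g t)%cx) a b = RInt (fun t => Im (f t)) a b - RInt (fun t => Im (g t)) a b).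
    transitivity (RInt (fun t => minus (Im (f t)) (Im (g t))) a b). apply RInt_ext; intros; apply Im_minus.
    apply (@RInt_minus R_CompleteNormedModule); auto using pcont_RInt_Im.
Qed.

(** The factor 2 comes from estimating real and imaginary parts separately; it reappears in
    [circle_bound] and [derivative_bound]. *)
Lemma CInt_bound g a b B : pcont g -> a <= b -> (forall t, a <= t <= b -> Cmod (g t) <= B) -> Cmod (CInt g a b) <= 2 * B * (b - a).
Proof.
  intros H Hab HB. eapply Rle_trans; [apply Cmod_le_parts|]. unfold CInt, Re at 1, Im at 1; simpl.
  assert (Rabs (RInt (fun t => Re (g t)) a b) <= (b - a) * B).
  { apply abs_RInt_le_const; auto. apply pcont_RInt_Re; auto. intros; eapply Rle_trans; [apply Re_le_Cmod|auto]. }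
  assert (Rabs (RInt (fun t => Im (g t)) a b) <= (b - a) * B).
  { apply abs_RInt_le_const; auto. apply pcont_RInt_Im; auto. intros; eapply Rle_trans; [apply Im_le_Cmod|auto]. }
  lra.
Qed.

Lemma CInt_ext f g a b : (forall t, f t = g t) -> CInt f a b = CInt g a b.
Proof. intros H. f_equal. apply functional_extensionality; auto. Qed.

Lemma CInt_affine al be a b :
  CInt (fun t => al + be * RtoC t)%cx a b = (al * RtoC (b - a) + be * RtoC ((b * b - a * a) / 2))%cx.
Proof.
  assert (E : forall p q, RInt (fun t => p + q * t) a b = p * (b - a) + q * ((b * b - a * a) / 2)).
  { intros p q. apply is_RInt_unique.
    replace (p * (b - a) + q * ((b * b - a * a) / 2)) with (minus (p * b + q * (b * b / 2)) (p * a + q * (a * a / 2))).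
    2:{ unfold minus, plus, opp; simpl. field. }
    apply (is_RInt_derive (fun t => p * t + q * (t * t / 2)) (fun t => p + q * t)).
    - intros x _. auto_derive; auto. field.
    - intros x _. apply continuity_pt_filterlim. apply derivable_continuous_pt. reg. }
  unfold CInt. apply Cplx_ext.
  - unfold Re at 1; simpl. rewrite (RInt_ext _ (fun t => Re al + Re be * t)), E.
    parts. intros; parts.
  - unfold Im at 1; simpl. rewrite (RInt_ext _ (fun t => Im al + Im be * t)), E.
    parts. intros; parts.
Qed.

Lemma CInt_const c a b : CInt (fun _ => c) a b = (c * RtoC (b - a))%cx.
Proof.
  rewrite (CInt_ext _ (fun t => c + C0 * RtoC t)%cx), CInt_affine. ring. intros; ring.
Qed.

Lemma pcont_line F p e : differentiable F -> pcont (fun t => F (p + e * RtoC t)%cx).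
Proof.
  intros H t eps He. destruct (H (p + e * RtoC t)%cx) as [d Hd]. destruct (cderiv_cont _ _ _ Hd eps He) as (r & Hr & Hc).
  exists (r / (Cmod e + 1)). pose proof (Cmod_nonneg e). split. apply Rdiv_lt_0_compat; lra.
  intros s Hs. apply Hc. replace (p + e * RtoC s - (p + e * RtoC t))%cx with (e * RtoC (s - t))%cx by (rewrite RtoC_minus; ring).
  rewrite Cmod_mul, Cmod_RtoC. apply Rle_lt_trans with ((Cmod e + 1) * Rabs (s - t)).
  { pose proof (Rabs_pos (s - t)). nra. }
  apply Rmult_lt_reg_r with (/ (Cmod e + 1)). apply Rinv_0_lt_compat; lra.
  replace ((Cmod e + 1) * Rabs (s - t) * / (Cmod e + 1)) with (Rabs (s - t)) by (field; lra). exact Hs.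
Qed.

(** The factor [C1] puts the line in the shape [p + e * t] that [pcont_line] expects. *)
Definition hline (f : Cplx -> Cplx) (y t : R) : Cplx := f (Ci * RtoC y + C1 * RtoC t)%cx.
Definition vline (f : Cplx -> Cplx) (x t : R) : Cplx := f (RtoC x + Ci * RtoC t)%cx.

(* The integral of [f] along the boundary of the rectangle with corner [a + ic], width [w] and height [h]. *)
Definition rect_int (f : Cplx -> Cplx) (a c w h : R) : Cplx :=
  (CInt (hline f c) a (a + w) - CInt (hline f (c + h)) a (a + w)
   + Ci * (CInt (vline f (a + w)) c (c + h) - CInt (vline f a) c (c + h)))%cx.

(** Each inner edge is traversed twice in opposite directions. Once the outer sides are cut at their
    midpoints, [ring] carries out this cancellation. *)
Lemma rect_int_split f a c w h : differentiable f ->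
  rect_int f a c w h =
  (rect_int f a c (w / 2) (h / 2) + rect_int f (a + w / 2) c (w / 2) (h / 2)
   + (rect_int f a (c + h / 2) (w / 2) (h / 2) + rect_int f (a + w / 2) (c + h / 2) (w / 2) (h / 2)))%cx.
Proof.
  intros H. assert (HH : forall y, pcont (hline f y)) by (intros; apply pcont_line; auto).
  assert (HV : forall x, pcont (vline f x)) by (intros; apply pcont_line; auto).
  unfold rect_int. replace (a + w / 2 + w / 2) with (a + w) by field. replace (c + h / 2 + h / 2) with (c + h) by field.
  rewrite <- (CInt_Chasles (hline f c) a (a + w / 2) (a + w)), <- (CInt_Chasles (hline f (c + h)) a (a + w / 2) (a + w)) by auto.
  rewrite <- (CInt_Chasles (vline f (a + w)) c (c + h / 2) (c + h)), <- (CInt_Chasles (vline f a) c (c + h / 2) (c + h)) by auto.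
  ring.
Qed.

Lemma rect_int_affine al be a c w h : rect_int (fun z => al + be * z)%cx a c w h = C0.
Proof.
  unfold rect_int.
  assert (HH : forall y, CInt (hline (fun z => al + be * z)%cx y) a (a + w) = ((al + be * (Ci * RtoC y)) * RtoC (a + w - a) + be * RtoC (((a + w) * (a + w) - a * a) / 2))%cx).
  { intros y. rewrite <- CInt_affine. apply CInt_ext. intros; unfold hline; ring. }
  assert (HV : forall x, CInt (vline (fun z => al + be * z)%cx x) c (c + h) = ((al + be * RtoC x) * RtoC (c + h - c) + (be * Ci) * RtoC (((c + h) * (c + h) - c * c) / 2))%cx).
  { intros y. rewrite <- CInt_affine. apply CInt_ext. intros; unfold vline; ring. }
  rewrite !HH, !HV. rewrite !RtoC_plus. replace (a + w - a) with w by ring. replace (c + h - c) with h by ring. ring.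
Qed.

Lemma rect_int_minus f g a c w h : differentiable f -> differentiable g ->
  rect_int (fun z => f z - g z)%cx a c w h = (rect_int f a c w h - rect_int g a c w h)%cx.
Proof.
  intros Hf Hg. unfold rect_int, hline, vline. rewrite !CInt_minus by (apply pcont_line; auto). ring.
Qed.

Lemma rect_int_bound f a c w h B : differentiable f -> 0 <= w -> 0 <= h ->
  (forall x y, a <= x <= a + w -> c <= y <= c + h -> Cmod (f (x, y)) <= B) ->
  Cmod (rect_int f a c w h) <= 4 * B * (w + h).
Proof.
  intros H Hw Hh HB.
  assert (HH : forall y, c <= y <= c + h -> Cmod (CInt (hline f y) a (a + w)) <= 2 * B * w).
  { intros y Hy. replace w with (a + w - a) at 2 by ring. apply CInt_bound. apply pcont_line; auto. lra.
    intros t Ht. unfold hline. replace (Ci * RtoC y + C1 * RtoC t)%cx with (t, y) by (cplx; ring). auto. }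
  assert (HV : forall x, a <= x <= a + w -> Cmod (CInt (vline f x) c (c + h)) <= 2 * B * h).
  { intros x Hx. replace h with (c + h - c) at 2 by ring. apply CInt_bound. apply pcont_line; auto. lra.
    intros t Ht. unfold vline. replace (RtoC x + Ci * RtoC t)%cx with (x, t) by (cplx; ring). auto. }
  unfold rect_int. eapply Rle_trans; [apply Cmod_tri|]. rewrite Cmod_mul, Cmod_I, Rmult_1_l.
  eapply Rle_trans; [apply Rplus_le_compat; apply Cmod_minus|].
  pose proof (HH c ltac:(lra)). pose proof (HH (c + h) ltac:(lra)). pose proof (HV a ltac:(lra)). pose proof (HV (a + w) ltac:(lra)). lra.
Qed.

Lemma differentiable_affine al be : differentiable (fun z => al + be * z)%cx.
Proof. intros z. eexists. apply cderiv_plus. apply cderiv_const. apply cderiv_scal. apply cderiv_id. Qed.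

(** The first-order Taylor polynomial at [(x, y)] integrates to zero around the rectangle, so only
    the error of differentiability counts; [e / 4] offsets the constant of [rect_int_bound]. *)
Lemma rect_int_local f x y : differentiable f -> forall e, 0 < e -> exists r, 0 < r /\
  forall a c w h, 0 <= w -> 0 <= h -> w + h < r -> a <= x <= a + w -> c <= y <= c + h ->
  Cmod (rect_int f a c w h) <= e * ((w + h) * (w + h)).
Proof.
  intros H e He. destruct (H (x, y)) as [d Hd]. destruct (Hd (e / 4)) as (r & Hr & HD); [lra|].
  exists r. split; auto. intros a c w h Hw Hh Hwh Hx Hy.
  set (al := (f (x, y) - d * (x, y))%cx).
  assert (E : rect_int f a c w h = rect_int (fun z => f z - (al + d * z))%cx a c w h).
  { rewrite (rect_int_minus f (fun z => al + d * z)%cx), rect_int_affine by (auto using differentiable_affine). ring. }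
  rewrite E. replace (e * ((w + h) * (w + h))) with (4 * (e / 4 * (w + h)) * (w + h)) by field.
  apply rect_int_bound; auto.
  { intros z. destruct (H z) as [d' Hd']. eexists. apply cderiv_minus. apply Hd'. apply cderiv_plus. apply cderiv_const. apply cderiv_scal, cderiv_id. }
  intros x' y' Hx' Hy'. specialize (HD ((x', y') - (x, y))%cx).
  assert (Hm : Cmod ((x', y') - (x, y)) <= w + h).
  { eapply Rle_trans; [apply Cmod_le_parts|]. rewrite Re_minus, Im_minus. unfold Re, Im; simpl.
    apply Rplus_le_compat; apply Rabs_le; lra. }
  specialize (HD ltac:(lra)). replace ((x, y) + ((x', y') - (x, y)))%cx with (x', y') in HD by (cplx; ring).
  replace (f (x', y') - (al + d * (x', y')))%cx with (f (x', y') - f (x, y) - d * ((x', y') - (x, y)))%cx by (unfold al; ring).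
  eapply Rle_trans; [apply HD|]. apply Rmult_le_compat_l; lra.
Qed.

(** By [rect_int_split] and the triangle inequality, one of the four quarters carries at least a
    quarter of the integral. *)
Lemma quarter_choice f a c w h : differentiable f -> exists a' c' : R,
  (a' = a \/ a' = a + w / 2) /\ (c' = c \/ c' = c + h / 2) /\
  Cmod (rect_int f a c w h) <= 4 * Cmod (rect_int f a' c' (w / 2) (h / 2)).
Proof.
  intros H. pose proof (rect_int_split f a c w h H) as E.
  set (q1 := rect_int f a c (w / 2) (h / 2)) in *. set (q2 := rect_int f (a + w / 2) c (w / 2) (h / 2)) in *.
  set (q3 := rect_int f a (c + h / 2) (w / 2) (h / 2)) in *. set (q4 := rect_int f (a + w / 2) (c + h / 2) (w / 2) (h / 2)) in *.
  assert (L : Cmod (rect_int f a c w h) <= Cmod q1 + Cmod q2 + (Cmod q3 + Cmod q4)).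
  { rewrite E. eapply Rle_trans; [apply Cmod_tri|]. apply Rplus_le_compat; apply Cmod_tri. }
  destruct (Rle_dec (Cmod (rect_int f a c w h)) (4 * Cmod q1)). { exists a, c. auto. }
  destruct (Rle_dec (Cmod (rect_int f a c w h)) (4 * Cmod q2)). { exists (a + w / 2), c. auto. }
  destruct (Rle_dec (Cmod (rect_int f a c w h)) (4 * Cmod q3)). { exists a, (c + h / 2). auto. }
  destruct (Rle_dec (Cmod (rect_int f a c w h)) (4 * Cmod q4)). { exists (a + w / 2), (c + h / 2). auto. }
  exfalso; lra.
Qed.

(** The nested interval principle in one coordinate; it is applied to the abscissas and to the
    ordinates of the corners. *)
Lemma nested_halves (u : nat -> R) w : 0 <= w ->
  (forall n, u (S n) = u n \/ u (S n) = u n + w / 2 ^ n / 2) ->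
  exists x, forall n, u n <= x <= u n + w / 2 ^ n.
Proof.
  intros Hw H. assert (P : forall n, 0 < 2 ^ n) by (intros; apply pow_lt; lra).
  assert (Q : forall n, w / 2 ^ S n = w / 2 ^ n / 2) by (intros; simpl; field; pose proof (P n); lra).
  assert (Z : forall n, 0 <= w / 2 ^ n) by (intros; apply Rdiv_le_0_compat; auto).
  assert (G : Un_growing u). { intros n. specialize (Z n). destruct (H n); lra. }
  assert (U : forall n k, u (n + k)%nat + w / 2 ^ (n + k) <= u n + w / 2 ^ n).
  { intros n k. induction k. rewrite Nat.add_0_r; lra. rewrite Nat.add_succ_r, Q. specialize (H (n + k)%nat).
    specialize (Z (n + k)%nat). destruct H; lra. }
  destruct (growing_cv u G) as [x Hx].
  { exists (u 0%nat + w / 2 ^ 0). intros y [n ->]. specialize (U 0%nat n). simpl (0 + n)%nat in U. specialize (Z n). lra. }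
  exists x. intros n. split. apply growing_ineq; auto.
  apply (Un_cv_le_bound u _ _ n Hx). intros m Hm. specialize (U n (m - n)%nat). replace (n + (m - n))%nat with m in U by lia. specialize (Z m); lra.
Qed.

Lemma goursat f a c w h : differentiable f -> 0 <= w -> 0 <= h -> rect_int f a c w h = C0.
Proof.
  intros H Hw Hh. assert (P : forall n, 0 < 2 ^ n) by (intros; apply pow_lt; lra).
  (* A choice function is needed to iterate the halving. The depth [n] is part of its argument
     because it determines the size of the rectangle. *)
  destruct (choice (fun (p : nat * (R * R)) (q : R * R) =>
     let '(n, (a, c)) := p in
     (fst q = a \/ fst q = a + w / 2 ^ n / 2) /\ (snd q = c \/ snd q = c + h / 2 ^ n / 2) /\
     Cmod (rect_int f a c (w / 2 ^ n) (h / 2 ^ n)) <= 4 * Cmod (rect_int f (fst q) (snd q) (w / 2 ^ n / 2) (h / 2 ^ n / 2)))) as [step Hstep].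
  { intros (n & a' & c'). destruct (quarter_choice f a' c' (w / 2 ^ n) (h / 2 ^ n) H) as (a2 & c2 & Q). exists (a2, c2). exact Q. }
  set (pt := fix pt n := match n with O => (a, c) | S k => step (k, pt k) end).
  assert (S1 : forall n, let p := pt n in let q := pt (S n) in
     (fst q = fst p \/ fst q = fst p + w / 2 ^ n / 2) /\ (snd q = snd p \/ snd q = snd p + h / 2 ^ n / 2) /\
     Cmod (rect_int f (fst p) (snd p) (w / 2 ^ n) (h / 2 ^ n)) <= 4 * Cmod (rect_int f (fst q) (snd q) (w / 2 ^ n / 2) (h / 2 ^ n / 2))).
  { intros n p q. specialize (Hstep (n, pt n)). unfold q, p. simpl. destruct (pt n) as [a' c']. exact Hstep. }
  destruct (nested_halves (fun n => fst (pt n)) w Hw) as [x Hx]. { intros n; apply (S1 n). }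
  destruct (nested_halves (fun n => snd (pt n)) h Hh) as [y Hy]. { intros n; apply (S1 n). }
  set (J := fun n => Cmod (rect_int f (fst (pt n)) (snd (pt n)) (w / 2 ^ n) (h / 2 ^ n))).
  assert (HJ : forall n, J 0%nat <= 4 ^ n * J n).
  { induction n. simpl; lra. destruct (S1 n) as (_ & _ & L). unfold J at 2.
    replace (w / 2 ^ S n) with (w / 2 ^ n / 2) by (simpl; field; pose proof (P n); lra).
    replace (h / 2 ^ S n) with (h / 2 ^ n / 2) by (simpl; field; pose proof (P n); lra).
    eapply Rle_trans; [apply IHn|]. assert (0 < 4 ^ n) by (apply pow_lt; lra).
    change (4 ^ S n) with (4 * 4 ^ n). unfold J. simpl in L |- *. nra. }
  apply small_eq. intros e He.
  replace (rect_int f a c w h - C0)%cx with (rect_int f a c w h) by ring.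
  assert (HL : 0 < (w + h) * (w + h) + 1) by nra.
  destruct (rect_int_local f x y H (e / ((w + h) * (w + h) + 1))) as (r & Hr & HD). { apply Rdiv_lt_0_compat; auto. }
  (* At this depth the rectangle is small enough for [rect_int_local] at the limit point. *)
  destruct (pow_lt_1_zero (1 / 2)) with (y := r / (w + h + 1)) as (n & Hn). rewrite Rabs_pos_eq; lra. apply Rdiv_lt_0_compat; lra.
  specialize (Hn n (le_n n)).
  rewrite Rabs_pos_eq in Hn by (apply pow_le; lra).
  assert (Ep : (1 / 2) ^ n = / 2 ^ n). { unfold Rdiv. rewrite Rmult_1_l, pow_inv; auto. }
  rewrite Ep in Hn. pose proof (P n) as Pn. pose proof (Rinv_0_lt_compat _ Pn) as Ip.
  assert (Hsz : w / 2 ^ n + h / 2 ^ n < r).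
  { replace (w / 2 ^ n + h / 2 ^ n) with ((w + h) * / 2 ^ n) by (field; lra).
    apply Rle_lt_trans with ((w + h + 1) * / 2 ^ n). nra.
    apply Rmult_lt_reg_r with (/ (w + h + 1)). apply Rinv_0_lt_compat; lra.
    replace ((w + h + 1) * / 2 ^ n * / (w + h + 1)) with (/ 2 ^ n) by (field; lra). exact Hn. }
  specialize (HD (fst (pt n)) (snd (pt n)) (w / 2 ^ n) (h / 2 ^ n)).
  specialize (HD ltac:(apply Rdiv_le_0_compat; lra) ltac:(apply Rdiv_le_0_compat; lra) Hsz (Hx n) (Hy n)).
  specialize (HJ n). replace (Cmod (rect_int f a c w h)) with (J 0%nat).
  2:{ unfold J. simpl. f_equal. f_equal; field. }
  eapply Rle_trans; [apply HJ|]. unfold J.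
  apply Rle_trans with (4 ^ n * (e / ((w + h) * (w + h) + 1) * ((w / 2 ^ n + h / 2 ^ n) * (w / 2 ^ n + h / 2 ^ n)))).
  { apply Rmult_le_compat_l; auto. apply pow_le; lra. }
  (* The factor [4^n] lost in the choices cancels against the square of the size of the
     rectangle. *)
  replace (4 ^ n) with (2 ^ n * 2 ^ n) by (rewrite <- Rpow_mult_distr; f_equal; ring).
  replace (2 ^ n * 2 ^ n * (e / ((w + h) * (w + h) + 1) * ((w / 2 ^ n + h / 2 ^ n) * (w / 2 ^ n + h / 2 ^ n)))) with (e * (((w + h) * (w + h)) / ((w + h) * (w + h) + 1))) by (field; split; lra).
  assert ((w + h) * (w + h) / ((w + h) * (w + h) + 1) <= 1).
  { apply Rmult_le_reg_r with ((w + h) * (w + h) + 1); auto. unfold Rdiv. rewrite Rmult_assoc, Rinv_l by lra. lra. }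
  nra.
Qed.

(* Cauchy's theorem on [rho, 0] x [0, 2 PI]: the horizontal sides cancel by periodicity, so the mean over a
   vertical period does not depend on the abscissa. *)
Lemma periodic_mean g l B : differentiable g -> (forall z, g (z + Ci * RtoC (2 * PI))%cx = g z) ->
  (forall e, 0 < e -> exists rho, rho < 0 /\ forall y, Cmod (g (RtoC rho + Ci * RtoC y) - l)%cx <= e) ->
  (forall y, 0 <= y <= 2 * PI -> Cmod (g (Ci * RtoC y)%cx) <= B) -> Cmod l <= 2 * B.
Proof.
  intros H Hper Hl HB. pose proof PI_RGT_0 as Hpi. apply Rnot_lt_le. intros Hlt.
  destruct (Hl ((Cmod l - 2 * B) / 4)) as (rho & Hrho & HR); [lra|].
  pose proof (goursat g rho 0 (- rho) (2 * PI) H ltac:(lra) ltac:(lra)) as G.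
  unfold rect_int in G. replace (rho + - rho) with 0 in G by ring. replace (0 + 2 * PI) with (2 * PI) in G by ring.
  rewrite (CInt_ext (hline g (2 * PI)) (hline g 0)) in G.
  2:{ intros t. unfold hline. rewrite <- (Hper (Ci * RtoC 0 + C1 * RtoC t)%cx). f_equal. rewrite RtoC_0; ring. }
  (* With the horizontal sides gone, Goursat's theorem reads [i (u - v) = 0]; multiplication by
     [- i] gives [u = v]. *)
  assert (E : CInt (vline g 0) 0 (2 * PI) = CInt (vline g rho) 0 (2 * PI)).
  { set (u := CInt (vline g 0) 0 (2 * PI)) in *. set (v := CInt (vline g rho) 0 (2 * PI)) in *.
    replace u with (v + (- Ci) * (Ci * (u - v)))%cx.
    2:{ replace (v + - Ci * (Ci * (u - v)))%cx with (v + (- (Ci * Ci)) * (u - v))%cx by ring. rewrite Ci_sqr; ring. }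
    replace (Ci * (u - v))%cx with (CInt (hline g 0) rho 0 - CInt (hline g 0) rho 0 + Ci * (u - v))%cx by ring. rewrite G. ring. }
  assert (B1 : Cmod (CInt (vline g 0) 0 (2 * PI)) <= 2 * B * (2 * PI - 0)).
  { apply CInt_bound. apply pcont_line; auto. lra. intros t Ht. unfold vline. rewrite RtoC_0.
    replace (C0 + Ci * RtoC t)%cx with (Ci * RtoC t)%cx by ring. auto. }
  assert (B2 : Cmod (CInt (fun t => vline g rho t - l)%cx 0 (2 * PI)) <= 2 * ((Cmod l - 2 * B) / 4) * (2 * PI - 0)).
  { apply CInt_bound. 2: lra. 2: intros; apply HR.
    apply (pcont_line (fun z => g z - l)%cx). intros z. destruct (H z) as [d Hd]. exists (d - C0)%cx. apply cderiv_minus; auto. apply cderiv_const. }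
  assert (HC : pcont (fun _ : R => l)). { intros t e He. exists 1. split; [lra|]. intros. replace (l - l)%cx with C0 by ring. rewrite Cmod_C0; auto. }
  rewrite CInt_minus, CInt_const in B2 by (auto; apply pcont_line; auto). rewrite <- E in B2.
  pose proof (Cmod_rev (l * RtoC (2 * PI - 0)) (CInt (vline g 0) 0 (2 * PI))) as T. rewrite Cmod_sym in T.
  rewrite Cmod_mul, Cmod_RtoC, Rabs_pos_eq in T by lra. nra.
Qed.

(** * Cauchy estimates and the identity principle *)

Lemma Cexp_per z : Cexp (z + Ci * RtoC (2 * PI)) = Cexp z.
Proof.
  rewrite Cexp_plus. replace (Cexp (Ci * RtoC (2 * PI))) with C1; [ring|].
  unfold Cexp, Ci, RtoC, C1, Cmult, Re, Im; simpl. replace (0 * (2 * PI) - 1 * 0) with 0 by ring. replace (0 * 0 + 1 * (2 * PI)) with (2 * PI) by ring.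
  rewrite exp_0, cos_2PI, sin_2PI. unfold RtoC. f_equal; ring.
Qed.

Lemma differentiable_Cexp_shift F w : differentiable F -> differentiable (fun z => F (w + Cexp z)%cx).
Proof.
  intros H z. destruct (H (w + Cexp z)%cx) as [d Hd]. eexists. apply (cderiv_comp F (fun z => w + Cexp z)%cx).
  apply cderiv_plus. apply cderiv_const. apply cderiv_Cexp. apply Hd.
Qed.

Lemma ln_small r : 0 < r -> exists rho, rho < 0 /\ exp rho < r.
Proof.
  intros Hr. exists (Rmin (-1) (ln r - 1)). split. pose proof (Rmin_l (-1) (ln r - 1)); lra.
  apply Rle_lt_trans with (exp (ln r - 1)). apply exp_le, Rmin_r. rewrite <- (exp_ln r) at 2 by auto. apply exp_increasing; lra.
Qed.

Lemma Re_polar rho y : Re (RtoC rho + Ci * RtoC y) = rho.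
Proof. parts. Qed.

(** The function [F (w + exp z)] has period [2 PI i] and tends to [F w] as [Re z] goes to minus
    infinity; its values on the imaginary axis are those of [F] on the unit circle around [w]. *)
Lemma circle_bound F w B : differentiable F ->
  (forall y, 0 <= y <= 2 * PI -> Cmod (F (w + Cexp (Ci * RtoC y))%cx) <= B) -> Cmod (F w) <= 2 * B.
Proof.
  intros H HB. apply (periodic_mean (fun z => F (w + Cexp z)%cx)); auto.
  - apply differentiable_Cexp_shift; auto.
  - intros z. rewrite Cexp_per; auto.
  - intros e He. destruct (H w) as [d Hd]. destruct (cderiv_cont _ _ _ Hd e He) as (r & Hr & Hc).
    destruct (ln_small r Hr) as (rho & H0 & H1). exists rho. split; auto. intros y. left. apply Hc.
    replace (w + Cexp (RtoC rho + Ci * RtoC y) - w)%cx with (Cexp (RtoC rho + Ci * RtoC y)) by ring.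
    rewrite Cmod_Cexp, Re_polar; auto.
Qed.

(** The same argument for the difference quotient [(F (w + u) - F w) / u] with [u = exp z]: it tends
    to [d], and on the unit circle it is at most [2 B]. *)
Lemma derivative_bound F w d B : differentiable F -> cderiv F w d ->
  (forall u, Cmod u <= 1 -> Cmod (F (w + u)%cx) <= B) -> Cmod d <= 4 * B.
Proof.
  intros H Hd HB. replace (4 * B) with (2 * (2 * B)) by ring.
  apply (periodic_mean (fun z => (F (w + Cexp z) - F w) * Cexp (- z))%cx).
  - intros z. destruct (differentiable_Cexp_shift F w H z) as [d' Hd']. eexists. apply cderiv_mult.
    apply cderiv_minus. apply Hd'. apply cderiv_const. apply (cderiv_comp Cexp (fun z => - z)%cx). apply cderiv_opp, cderiv_id. apply cderiv_Cexp.
  - intros z. rewrite !Cexp_opp, Cexp_per; auto.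
  - intros e He. destruct (Hd e He) as (r & Hr & Hc). destruct (ln_small r Hr) as (rho & H0 & H1). exists rho. split; auto. intros y.
    set (u := Cexp (RtoC rho + Ci * RtoC y)). assert (Hu : Cmod u = exp rho) by (unfold u; rewrite Cmod_Cexp, Re_polar; auto).
    rewrite Cexp_opp. fold u. pose proof (exp_pos rho).
    assert (u <> C0) by apply Cexp_neq.
    replace ((F (w + u) - F w) * / u - d)%cx with ((F (w + u) - F w - d * u) / u)%cx by (field; auto).
    rewrite Cmod_Cdiv by auto. specialize (Hc u ltac:(lra)). apply Rmult_le_reg_r with (Cmod u). lra.
    unfold Rdiv. rewrite Rmult_assoc, Rinv_l by lra. lra.
  - intros y Hy. rewrite Cmod_mul, Cmod_Cexp.
    replace (Re (- (Ci * RtoC y))) with 0 by (parts). rewrite exp_0, Rmult_1_r.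
    eapply Rle_trans; [apply Cmod_minus|].
    assert (Cmod (Cexp (Ci * RtoC y)) = 1). { rewrite Cmod_Cexp. replace (Re (Ci * RtoC y)) with 0 by (parts). apply exp_0. }
    pose proof (HB (Cexp (Ci * RtoC y)) ltac:(lra)). pose proof (HB C0 ltac:(rewrite Cmod_C0; lra)).
    replace (w + C0)%cx with w in H2 by ring. lra.
Qed.

Lemma circle_sup F w : differentiable F -> exists M, forall y, 0 <= y <= 2 * PI -> Cmod (F (w + Cexp (Ci * RtoC y))%cx) <= M.
Proof.
  intros H. set (g := fun t => F (w + Cexp (Ci * RtoC t))%cx).
  assert (Hg : pcont g).
  { unfold g. intros t e He. destruct (pcont_line (fun z => F (w + Cexp z)%cx) C0 Ci (differentiable_Cexp_shift F w H) t e He) as (r & Hr & Hd).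
    exists r. split; auto. intros s Hs. specialize (Hd s Hs). replace (C0 + Ci * RtoC s)%cx with (Ci * RtoC s)%cx in Hd by ring.
    replace (C0 + Ci * RtoC t)%cx with (Ci * RtoC t)%cx in Hd by ring. exact Hd. }
  destruct (continuity_ab_maj (fun t => Cmod (g t)) 0 (2 * PI)) as (M & HM & _).
  { pose proof PI_RGT_0; lra. }
  { intros c _ e He. destruct (Hg c e He) as (r & Hr & Hd). exists r. split; auto. intros x [_ Hx]. simpl in *. unfold R_dist, Rdist in *.
    specialize (Hd x Hx). pose proof (Cmod_rev (g x) (g c)). pose proof (Cmod_rev (g c) (g x)). rewrite (Cmod_sym (g c)) in H1. apply Rabs_def1; lra. }
  exists (Cmod (g M)). exact HM.
Qed.

(* The weight [exp (n (u + u^2 / 2))] is 1 at the centre and decays in [n] on the part of the unit circle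
   where [G] may be nonzero. *)
Lemma zero_halfplane_extend G x0 : differentiable G -> (forall z, x0 < Re z -> G z = C0) ->
  forall w, x0 - 3 / 10 < Re w -> G w = C0.
Proof.
  intros H H0 w Hw. destruct (circle_sup G w H) as [M HM].
  assert (M0 : 0 <= M). { eapply Rle_trans; [apply Cmod_nonneg|]. apply (HM 0). pose proof PI_RGT_0; lra. }
  assert (K : forall n : nat, Cmod (G w) <= 2 * (M * exp (- (1 / 10)) ^ n)).
  (* A linear exponent [n u] decays only where [cos y < 0] and could not move the edge of the
     half-plane. With [u^2 / 2] added, the real part divided by [n] is [c + c^2 - 1 / 2] for
     [c = cos y], negative up to [c = (sqrt 3 - 1) / 2], about 0.366. *)
  { intros n. set (p := fun z => (nC n * ((z - w) + (z - w) * (z - w) * RtoC (/ 2)))%cx).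
    assert (Ew : (G w * Cexp (p w))%cx = G w). { unfold p. replace (nC n * (w - w + (w - w) * (w - w) * RtoC (/ 2)))%cx with C0 by ring. rewrite Cexp_0; ring. }
    rewrite <- Ew. apply (circle_bound (fun z => G z * Cexp (p z))%cx).
    - intros z. destruct (H z) as [d Hd]. eexists. apply cderiv_mult. apply Hd. apply (cderiv_comp Cexp p); [|apply cderiv_Cexp].
      unfold p. apply cderiv_scal. assert (D : cderiv (fun z => z - w)%cx z (C1 - C0)) by (apply cderiv_minus; [apply cderiv_id | apply cderiv_const]).
      apply cderiv_plus. exact D. apply cderiv_mult. apply cderiv_mult; exact D. apply cderiv_const.
    - intros y Hy. set (u := Cexp (Ci * RtoC y)). rewrite Cmod_mul. destruct (Rlt_dec x0 (Re (w + u))) as [L|L].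
      { rewrite H0 by auto. rewrite Cmod_C0, Rmult_0_l. apply Rmult_le_pos; auto. apply pow_le. left; apply exp_pos. }
      apply Rmult_le_compat; try apply Cmod_nonneg. apply HM; auto.
      rewrite Cmod_Cexp. unfold p. replace (w + u - w)%cx with u by ring.
      assert (Eu : u = (cos y, sin y)). { unfold u, Cexp. replace (Re (Ci * RtoC y)) with 0. replace (Im (Ci * RtoC y)) with y. rewrite exp_0. f_equal; ring.
        parts. parts. }
      replace (Re (nC n * (u + u * u * RtoC (/ 2)))) with (INR n * (cos y + (cos y * cos y - sin y * sin y) / 2)).
      2:{ rewrite Eu. unfold nC, Cplus, Cmult, RtoC, Re, Im; simpl. field. }
      rewrite <- (Rpower_pow n) by apply exp_pos. unfold Rpower. rewrite ln_exp. apply exp_le. apply Rmult_le_compat_l. apply pos_INR.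
      rewrite Eu, Re_plus in L. unfold Re at 2 in L; simpl in L. pose proof (COS_bound y). pose proof (sin2_cos2 y) as SC. unfold Rsqr in SC.
      (* Outside the known zeros [cos y < 3 / 10]. The product inequality gives
         [c^2 + c <= 3 / 10 + 3 c / 10 <= 39 / 100], which leaves a decay rate of at least
         [1 / 10]. *)
      assert ((cos y + 1) * (cos y - 3 / 10) <= 0) by nra. lra. }
  apply small_eq. intros e He. replace (G w - C0)%cx with (G w) by ring.
  destruct (pow_lt_1_zero (exp (- (1 / 10)))) with (y := e / (2 * (M + 1))) as (n & Hn).
  { rewrite Rabs_pos_eq by (left; apply exp_pos). apply Rlt_le_trans with (exp 0); [apply exp_increasing; lra | rewrite exp_0; lra]. }
  { apply Rdiv_lt_0_compat; lra. }
  specialize (Hn n (le_n n)). assert (P : 0 <= exp (- (1 / 10)) ^ n) by (apply pow_le; left; apply exp_pos).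
  rewrite Rabs_pos_eq in Hn by auto. eapply Rle_trans; [apply (K n)|].
  apply Rle_trans with (2 * ((M + 1) * (e / (2 * (M + 1))))). 2: right; field; lra.
  apply Rmult_le_compat_l; [lra|]. apply Rmult_le_compat; lra.
Qed.

Lemma identity_halfplane G x0 : differentiable G -> (forall z, x0 < Re z -> G z = C0) -> forall w, G w = C0.
Proof.
  intros H H0 w.
  assert (K : forall n z, x0 - INR n * (3 / 10) < Re z -> G z = C0).
  { induction n. intros z Hz. apply H0. simpl in Hz; lra.
    intros z Hz. apply (zero_halfplane_extend G (x0 - INR n * (3 / 10))); auto. rewrite S_INR in Hz. lra. }
  destruct (INR_unbounded ((x0 - Re w) * (10 / 3))) as [n Hn]. apply (K n). lra.
Qed.

(** Each use of Cauchy's estimate costs one unit of radius: from [B] on radius 3 one gets [4 B] for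
    [Q] on radius 2 and [16 B] for its derivative on radius 1. Hence the first-order Taylor errors
    of all [P j] at [w] are at most [16 B |h|^2]. This uniformity makes [Q j w] a Cauchy sequence
    and survives in the limit. Taking [Q] as data, itself differentiable, avoids proving that
    derivatives are analytic; Dirichlet polynomials provide it. *)
Lemma limit_differentiable (P Q : nat -> Cplx -> Cplx) F w B :
  (forall j z, cderiv (P j) z (Q j z)) -> (forall j, differentiable (Q j)) ->
  (forall j z, Cmod (z - w) <= 3 -> Cmod (P j z) <= B) ->
  (forall z, Cmod (z - w) <= 1 -> Ccv (fun j => P j z) (F z)) -> exists d, cderiv F w d.
Proof.
  intros HP HQ HB HF.
  assert (B0 : 0 <= B). { eapply Rle_trans; [apply Cmod_nonneg|]. apply (HB 0%nat w). replace (w - w)%cx with C0 by ring. rewrite Cmod_C0; lra. }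
  assert (B1 : forall j z, Cmod (z - w) <= 2 -> Cmod (Q j z) <= 4 * B).
  { intros j z Hz. apply (derivative_bound (P j) z); auto. intros z'; eexists; apply HP.
    intros u Hu. apply HB. replace (z + u - w)%cx with ((z - w) + u)%cx by ring. eapply Rle_trans; [apply Cmod_tri|]; lra. }
  assert (B2 : forall j z d, Cmod (z - w) <= 1 -> cderiv (Q j) z d -> Cmod d <= 16 * B).
  { intros j z d Hz Hd. replace (16 * B) with (4 * (4 * B)) by ring. apply (derivative_bound (Q j) z); auto.
    intros u Hu. apply B1. replace (z + u - w)%cx with ((z - w) + u)%cx by ring. eapply Rle_trans; [apply Cmod_tri|]; lra. }
  assert (sg : forall t h, 0 <= t <= 1 -> Cmod (seg w (w + h) t - w) <= Cmod h).
  { intros t h Ht. unfold seg. replace (w + RtoC t * (w + h - w) - w)%cx with (RtoC t * h)%cx by ring. rewrite Cmod_mul, Cmod_RtoC, Rabs_pos_eq by lra.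
    pose proof (Cmod_nonneg h); nra. }
  assert (T1 : forall j h, Cmod h <= 1 -> Cmod (Q j (w + h) - Q j w)%cx <= 16 * B * Cmod h).
  { intros j h Hh. destruct (choice (fun z d => cderiv (Q j) z d) (HQ j)) as [D HD].
    replace h with (w + h - w)%cx at 2 by ring. apply (mean_value (Q j) D). auto.
    intros t Ht. apply (B2 j (seg w (w + h) t)); auto. eapply Rle_trans; [apply sg|]; auto. }
  assert (T2 : forall j h, Cmod h <= 1 -> Cmod (P j (w + h) - P j w - Q j w * h)%cx <= 16 * B * Cmod h * Cmod h).
  { intros j h Hh. replace (P j (w + h) - P j w - Q j w * h)%cx with ((P j (w + h) - Q j w * (w + h)) - (P j w - Q j w * w))%cx by ring.
    replace (Cmod h) with (Cmod (w + h - w)) at 2 by (f_equal; ring).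
    apply (mean_value (fun z => P j z - Q j w * z)%cx (fun z => Q j z - Q j w)%cx).
    - intros t _. eapply cderiv_eq. apply cderiv_minus. apply HP. apply cderiv_scal, cderiv_id. ring.
    - intros t Ht. pose proof (sg t h Ht). replace (seg w (w + h) t) with (w + (seg w (w + h) t - w))%cx by ring.
      eapply Rle_trans; [apply T1; lra|]. apply Rmult_le_compat_l; lra. }
  assert (Hw : Ccv (fun j => P j w) (F w)). { apply HF. replace (w - w)%cx with C0 by ring. rewrite Cmod_C0; lra. }
  destruct (Ccauchy_complete (fun j => Q j w)) as [d Hd].
  (* Compare the two derivatives through the real step [t]: the Taylor errors contribute
     [32 B t^2 <= e t / 2], and the four errors in the values at most [e t / 8] each. *)
  { intros e He. set (t := Rmin 1 (e / (64 * B + 1))). assert (Ht : 0 < t) by (unfold t; apply Rmin_pos; [lra|]; apply Rdiv_lt_0_compat; lra).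
    assert (Ht1 : t <= 1) by apply Rmin_l. assert (Ht2 : 64 * B * t <= e).
    { apply Rle_trans with ((64 * B + 1) * (e / (64 * B + 1))). apply Rmult_le_compat; try lra. apply Rmin_r. right; field; lra. }
    set (h := RtoC t). assert (Hh : Cmod h = t) by (unfold h; rewrite Cmod_RtoC, Rabs_pos_eq; lra).
    assert (Hh0 : h <> C0) by (apply RtoC_neq; lra).
    assert (Hz : Ccv (fun j => P j (w + h)%cx) (F (w + h)%cx)). { apply HF. replace (w + h - w)%cx with h by ring. lra. }
    destruct (Hw (e * t / 8)) as [K1 HK1]; [nra|]. destruct (Hz (e * t / 8)) as [K2 HK2]; [nra|].
    exists (K1 + K2)%nat. intros m n Hm Hn.
    pose proof (HK1 m ltac:(lia)). pose proof (HK1 n ltac:(lia)). pose proof (HK2 m ltac:(lia)). pose proof (HK2 n ltac:(lia)).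
    pose proof (T2 m h ltac:(lra)) as Tm. pose proof (T2 n h ltac:(lra)) as Tn. rewrite Hh in Tm, Tn.
    apply Rmult_le_reg_r with t; auto. rewrite <- Hh at 1. rewrite <- Cmod_mul.
    replace ((Q m w - Q n w) * h)%cx with
      ((P n (w + h) - P n w - Q n w * h) - (P m (w + h) - P m w - Q m w * h)
       + (((P m (w + h) - F (w + h)) - (P n (w + h) - F (w + h))) - ((P m w - F w) - (P n w - F w))))%cx by ring.
    eapply Rle_trans; [apply Cmod_tri|].
    eapply Rle_trans; [apply Rplus_le_compat; [apply Cmod_minus|]; eapply Rle_trans; [apply Cmod_minus|]; apply Rplus_le_compat; apply Cmod_minus|].
    assert (32 * B * t * t <= e / 2 * t) by nra. lra. }
  exists d. intros e He. set (r := Rmin 1 (e / (16 * B + 1))).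
  exists r. split. apply Rmin_pos; [lra|]. apply Rdiv_lt_0_compat; lra.
  intros h Hh. assert (Hr1 : r <= 1) by apply Rmin_l. assert (Hr2 : r <= e / (16 * B + 1)) by apply Rmin_r.
  assert (Hz : Ccv (fun j => P j (w + h)%cx) (F (w + h)%cx)). { apply HF. replace (w + h - w)%cx with h by ring. lra. }
  assert (L : Cmod (F (w + h) - F w - d * h - C0)%cx <= 16 * B * Cmod h * Cmod h).
  { apply (Ccv_le (fun j => P j (w + h) - P j w - Q j w * h)%cx _ _ _ 0%nat).
    - apply Ccv_plus. apply Ccv_plus; auto.
      apply (Ccv_ext (fun n => (- C1) * P n w)%cx _ _ 0%nat). intros; ring. replace (- F w)%cx with ((- C1) * F w)%cx by ring. apply Ccv_scal; auto.
      apply (Ccv_ext (fun n => (- h) * Q n w)%cx _ _ 0%nat). intros; ring. replace (- (d * h))%cx with ((- h) * d)%cx by ring. apply Ccv_scal; auto.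
    - intros j _. replace (P j (w + h) - P j w - Q j w * h - C0)%cx with (P j (w + h) - P j w - Q j w * h)%cx by ring. apply T2; lra. }
  replace (F (w + h) - F w - d * h - C0)%cx with (F (w + h) - F w - d * h)%cx in L by ring.
  eapply Rle_trans; [apply L|]. apply Rmult_le_compat_r. apply Cmod_nonneg.
  apply Rle_trans with ((16 * B + 1) * (e / (16 * B + 1))). apply Rmult_le_compat; try lra. apply Cmod_nonneg. right; field; lra.
Qed.
(** * Gauss sums *)

Lemma Csum_list n f : Csum_lt n f = fold_right Cplus C0 (map f (seq 0 n)).
Proof.
  assert (H : forall l c, fold_right Cplus c l = (fold_right Cplus C0 l + c)%cx).
  { induction l; intros; simpl. ring. rewrite IHl. ring. }
  induction n; auto. rewrite seq_S, map_app, fold_right_app, H. simpl. rewrite IHn. ring.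
Qed.

(** An injection of a finite set into itself is a permutation; written as folds over lists, the two
    sums have permuted entries. *)
Lemma Csum_reindex n (sg : nat -> nat) f :
  (forall i, (i < n)%nat -> (sg i < n)%nat) ->
  (forall i j, (i < n)%nat -> (j < n)%nat -> sg i = sg j -> i = j) ->
  Csum_lt n (fun i => f (sg i)) = Csum_lt n f.
Proof.
  intros H1 H2. rewrite !Csum_list. rewrite <- (map_map sg f).
  assert (P : Permutation (map f (map sg (seq 0 n))) (map f (seq 0 n))).
  { apply Permutation_map. apply NoDup_Permutation_bis.
    - apply NoDup_map_NoDup_ForallPairs; [|apply seq_NoDup].
      intros i j Hi Hj. apply in_seq in Hi, Hj. apply H2; lia.
    - rewrite length_map; auto.
    - intros x Hx. apply in_map_iff in Hx as (i & <- & Hi). apply in_seq in Hi. apply in_seq. specialize (H1 i). lia. }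
  revert P. generalize (map f (map sg (seq 0 n))) (map f (seq 0 n)). intros l l' P.
  induction P; simpl; try rewrite IHP; try ring; congruence.
Qed.

Lemma Cexp_i x : Cexp (Ci * RtoC x) = (cos x, sin x).
Proof.
  unfold Cexp. replace (Re (Ci * RtoC x)) with 0 by (parts).
  replace (Im (Ci * RtoC x)) with x by (parts). rewrite exp_0. f_equal; ring.
Qed.
Lemma Cconj_Cexp_i x : Cconj (Cexp (Ci * RtoC x)) = Cexp (Ci * RtoC (- x)).
Proof. rewrite !Cexp_i, cos_neg, sin_neg. reflexivity. Qed.

(** The minus sign in the exponent places the limits [lip_pt] of [M (1 - x * er)] in the upper
    half-plane. *)
Definition er (N n : nat) : Cplx := Cexp (Ci * RtoC (- (2 * PI * INR n / INR N))).

Lemma Cmod_er N n : Cmod (er N n) = 1.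
Proof. unfold er. rewrite Cmod_Cexp. replace (Re _) with 0 by (parts). apply exp_0. Qed.
Lemma er_neq N n : er N n <> C0.
Proof. apply Cexp_neq. Qed.
Lemma er_0 N : er N 0 = C1.
Proof. unfold er. simpl. replace (Ci * RtoC (- (2 * PI * 0 / INR N)))%cx with C0. apply Cexp_0. unfold Rdiv. rewrite Rmult_0_r, Rmult_0_l, Ropp_0, RtoC_0. ring. Qed.
Lemma er_plus N m n : er N (m + n) = (er N m * er N n)%cx.
Proof. unfold er. rewrite <- Cexp_plus. f_equal. rewrite plus_INR. unfold Rdiv. cplx; ring. Qed.
Lemma er_self N : N <> 0%nat -> er N N = C1.
Proof.
  intros H. rewrite <- Cexp_0. unfold er. rewrite <- (Cexp_per (Ci * _)). f_equal. apply not_0_INR in H. unfold Rdiv. rewrite Rmult_assoc, Rinv_r, Rmult_1_r by auto. cplx; ring.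
Qed.
Lemma er_mulN N k : N <> 0%nat -> er N (k * N) = C1.
Proof. intros H. induction k. apply er_0. simpl. rewrite er_plus, er_self, IHk by auto. ring. Qed.
Lemma er_per N n k : N <> 0%nat -> er N (n + k * N) = er N n.
Proof. intros. rewrite er_plus, er_mulN by auto. ring. Qed.
Lemma er_mod N n : N <> 0%nat -> er N (n mod N) = er N n.
Proof. intros H. rewrite (Nat.div_mod_eq n N) at 2. rewrite Nat.add_comm, Nat.mul_comm, er_per; auto. Qed.
Lemma er_pow N n k : er N (k * n) = (er N n ^ k)%cx.
Proof. induction k; simpl. apply er_0. rewrite er_plus, IHk; auto. Qed.
Lemma er_scale N n k : N <> 0%nat -> k <> 0%nat -> er (k * N) (k * n) = er N n.
Proof. intros H H'. unfold er. do 4 f_equal. rewrite !mult_INR. apply not_0_INR in H, H'. field; auto. Qed.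
Lemma Cconj_er N n : Cconj (er N n) = (/ er N n)%cx.
Proof. unfold er. rewrite <- Cexp_opp, Cconj_Cexp_i. f_equal. rewrite RtoC_opp. ring. Qed.
Lemma er_conj_flip N n k : N <> 0%nat -> (n <= k * N)%nat -> er N (k * N - n) = Cconj (er N n).
Proof.
  intros H L. rewrite Cconj_er. assert (er N (k * N - n) * er N n = C1)%cx.
  { rewrite <- er_plus. replace (k * N - n + n)%nat with (k * N)%nat by lia. apply er_mulN; auto. }
  pose proof (er_neq N n). replace (er N (k * N - n)) with (er N (k * N - n) * er N n / er N n)%cx by (field; auto). rewrite H0. field; auto.
Qed.

Lemma er_neq_1 N n : N <> 0%nat -> n mod N <> 0%nat -> er N n <> C1.
Proof.
  intros H Hn. rewrite <- er_mod by auto. set (r := (n mod N)%nat) in *. assert (Hr : (r < N)%nat) by (apply Nat.mod_upper_bound; auto).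
  unfold er. intros E. apply (f_equal Re) in E. unfold Cexp, Cmult, Ci, RtoC, C1, Re, Im in E; simpl in E.
  replace (0 * - (2 * PI * INR r / INR N) - 1 * 0) with 0 in E by ring.
  replace (0 * 0 + 1 * - (2 * PI * INR r / INR N)) with (- (2 * (PI * INR r / INR N))) in E by (unfold Rdiv; ring).
  rewrite exp_0, cos_neg, cos_2a_sin in E. pose proof PI_RGT_0.
  assert (0 < INR r) by (apply lt_0_INR; lia). assert (INR r < INR N) by (apply lt_INR; auto).
  assert (0 < sin (PI * INR r / INR N)).
  { apply sin_gt_0. apply Rdiv_lt_0_compat; nra. apply Rmult_lt_reg_r with (INR N). lra. unfold Rdiv. rewrite Rmult_assoc, Rinv_l by lra. nra. }
  unfold RtoC in E; simpl in E. nra.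
Qed.

Lemma er_sum N k : N <> 0%nat ->
  Csum_lt N (fun j => er N (j * k)) = if Nat.eq_dec (k mod N) 0 then nC N else C0.
Proof.
  intros H. destruct Nat.eq_dec as [E|E].
  - rewrite (Csum_ext N _ (fun _ => C1)). rewrite Csum_const; ring.
    intros j _. rewrite er_pow, <- er_mod, E, er_0 by auto. clear. induction j; simpl; auto. rewrite IHj; ring.
  - set (z := er N k). assert (Hz : z <> C1) by (apply er_neq_1; auto).
    assert (G : forall n, (Csum_lt n (fun j => er N (j * k)) * (z - C1) = er N (n * k) - C1)%cx).
    { induction n. simpl. rewrite er_0; ring. simpl Csum_lt. replace (S n * k)%nat with (n * k + k)%nat by lia.
      rewrite er_plus. fold z. replace ((Csum_lt n (fun j => er N (j * k)) + er N (n * k)) * (z - C1))%cx with (Csum_lt n (fun j => er N (j * k)) * (z - C1) + er N (n * k) * (z - C1))%cx by ring. rewrite IHn. ring. }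
    specialize (G N). rewrite (Nat.mul_comm N k), er_mulN in G by auto. replace (C1 - C1)%cx with C0 in G by ring.
    assert (Hz' : (z - C1)%cx <> C0). { intros E'. apply Hz. replace z with (z - C1 + C1)%cx by ring. rewrite E'. ring. }
    replace (Csum_lt N (fun j => er N (j * k))) with (Csum_lt N (fun j => er N (j * k)) * (z - C1) / (z - C1))%cx by (field; auto).
    rewrite G. field; auto.
Qed.

Lemma chi_per q chi n k : is_dirichlet_char q chi -> chi (n + k * q)%nat = chi n.
Proof. intros (_ & H & _). induction k. f_equal; lia. replace (n + S k * q)%nat with (n + k * q + q)%nat by lia. rewrite H; auto. Qed.
Lemma chi_mod q chi n : is_dirichlet_char q chi -> chi (n mod q)%nat = chi n.
Proof. intros Hc. rewrite (Nat.div_mod_eq n q) at 2. rewrite Nat.add_comm, Nat.mul_comm. symmetry; apply chi_per; auto. Qed.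
Lemma chi_mul q chi m n : is_dirichlet_char q chi -> chi (m * n)%nat = (chi m * chi n)%cx.
Proof. intros (_ & _ & H & _); auto. Qed.
Lemma chi_one q chi : is_dirichlet_char q chi -> chi 1%nat = C1.
Proof. intros (_ & _ & _ & H & _); auto. Qed.
Lemma q_pos q chi : is_dirichlet_char q chi -> (0 < q)%nat.
Proof. intros (H & _); auto. Qed.

Lemma q_ge2 q chi : is_dirichlet_char q chi -> nonprincipal q chi -> (2 <= q)%nat.
Proof.
  intros Hc [n [_ Hn]]. pose proof (q_pos _ _ Hc). destruct (Nat.eq_dec q 1) as [->|]; [|lia].
  exfalso; apply Hn. rewrite <- (chi_mod 1 chi n Hc), <- (chi_one _ _ Hc), <- (chi_mod 1 chi 1 Hc), !Nat.mod_1_r; auto.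
Qed.

Lemma chi_zero q chi : is_dirichlet_char q chi -> (2 <= q)%nat -> chi 0%nat = C0.
Proof. intros (_ & _ & _ & _ & H) Hq. apply H. simpl. lia. Qed.

(** A value of modulus above 1 would have unbounded powers [chi (n ^ k)], while a periodic function
    is bounded; [B] sums the moduli over one period. *)
Lemma chi_le1 q chi n : is_dirichlet_char q chi -> Cmod (chi n) <= 1.
Proof.
  intros Hc. pose proof (q_pos _ _ Hc) as Hq.
  set (B := Rsum_lt q (fun r => Cmod (chi r))).
  assert (HB : forall m, Cmod (chi m) <= B).
  { intros m. rewrite <- (chi_mod _ _ _ Hc). assert ((m mod q < q)%nat) by (apply Nat.mod_upper_bound; lia). set (r := (m mod q)%nat) in *.
    pose proof (Rsum_mono (S r) q (fun r => Cmod (chi r)) (fun k => Cmod_nonneg _) ltac:(lia)). simpl in H0.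
    assert (0 <= Rsum_lt r (fun r => Cmod (chi r))) by (apply Rsum_nonneg; intros; apply Cmod_nonneg). unfold B; lra. }
  destruct (Rle_or_lt (Cmod (chi n)) 1) as [|L]; auto. exfalso.
  assert (P : forall k, chi (n ^ k)%nat = (chi n ^ k)%cx). { induction k; simpl. apply (chi_one _ _ Hc). rewrite (chi_mul _ _ _ _ Hc), IHk; auto. }
  destruct (Pow_x_infinity (Cmod (chi n))) with (b := B + 1) as (k & Hk). rewrite Rabs_pos_eq; auto; apply Cmod_nonneg.
  specialize (Hk k (le_n k)). specialize (HB (n ^ k)%nat). rewrite P, Cmod_Cpown in HB.
  rewrite Rabs_pos_eq in Hk by (apply pow_le, Cmod_nonneg). lra.
Qed.

(** Bezout's identity. Writing [1 mod q] instead of 1 keeps the modulus 1 included. *)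
Lemma unit_inverse q n : (0 < q)%nat -> Nat.gcd n q = 1%nat -> exists n', ((n * n') mod q = 1 mod q)%nat.
Proof.
  intros Hq H. destruct (Nat.eq_dec n 0) as [->|N].
  { simpl in H. subst. exists 0%nat. reflexivity. }
  destruct (Nat.gcd_bezout_pos n q) as (u & v & E). lia. exists u. rewrite Nat.mul_comm, E, H, Nat.Div0.mod_add. reflexivity.
Qed.

(** The values at [n] and at its inverse have moduli at most 1 and product 1, so both lie on the
    unit circle. *)
Lemma chi_unit q chi n : is_dirichlet_char q chi -> Nat.gcd n q = 1%nat -> (Cconj (chi n) * chi n)%cx = C1.
Proof.
  intros Hc H. destruct (unit_inverse q n (q_pos _ _ Hc) H) as [n' Hn].
  assert (E : (chi n * chi n')%cx = C1). { rewrite <- (chi_mul _ _ _ _ Hc), <- (chi_mod _ _ _ Hc), Hn, (chi_mod _ _ _ Hc). apply (chi_one _ _ Hc). }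
  assert (M : Cmod (chi n) = 1).
  { pose proof (chi_le1 _ _ n Hc). pose proof (chi_le1 _ _ n' Hc). pose proof (Cmod_nonneg (chi n)). apply (f_equal Cmod) in E. rewrite Cmod_mul, Cmod_C1 in E. nra. }
  pose proof (Cmod_sqr (chi n)) as S. rewrite M in S. unfold Re, Im in S. cplx; lra.
Qed.

Lemma mul_unit_inj q n i j : (0 < q)%nat -> Nat.gcd n q = 1%nat -> (i < q)%nat -> (j < q)%nat ->
  ((i * n) mod q = (j * n) mod q)%nat -> i = j.
Proof.
  intros Hq H Hi Hj E. destruct (unit_inverse q n Hq H) as [n' Hn].
  assert (K : forall i, (i < q)%nat -> (((i * n) mod q * n') mod q = i)%nat).
  { intros x Hx. rewrite Nat.Div0.mul_mod_idemp_l, <- Nat.mul_assoc, <- Nat.Div0.mul_mod_idemp_r, Hn, Nat.Div0.mul_mod_idemp_r, Nat.mul_1_r. apply Nat.mod_small; auto. }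
  rewrite <- (K i Hi), <- (K j Hj), E. reflexivity.
Qed.

(** The finite Fourier transform of the conjugate character. *)
Definition twisted (q : nat) (chi : nat -> Cplx) (n : nat) : Cplx :=
  Csum_lt q (fun m => Cconj (chi m) * er q (m * n))%cx.

Lemma Cconj_mult z w : Cconj (z * w) = (Cconj z * Cconj w)%cx.
Proof. cplx; ring. Qed.
Lemma Cconj_invol z : Cconj (Cconj z) = z.
Proof. cplx; ring. Qed.

(** For a unit [a], the substitution [m -> m a] permutes the residues modulo [q]. *)
Lemma twisted_mul q chi a n : is_dirichlet_char q chi -> Nat.gcd a q = 1%nat ->
  (Cconj (chi a) * twisted q chi (a * n) = twisted q chi n)%cx.
Proof.
  intros Hc Ha. pose proof (q_pos _ _ Hc) as Hq. unfold twisted. rewrite <- Csum_scal.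
  rewrite <- (Csum_reindex q (fun m => (m * a) mod q)%nat (fun m => Cconj (chi m) * er q (m * n))%cx).
  - apply Csum_ext. intros m _. rewrite (chi_mod _ _ _ Hc), (chi_mul _ _ _ _ Hc), Cconj_mult.
    replace (er q ((m * a) mod q * n)) with (er q (m * (a * n))). ring.
    rewrite <- (er_mod q ((m * a) mod q * n)), Nat.Div0.mul_mod_idemp_l, er_mod by lia. f_equal; lia.
  - intros; apply Nat.mod_upper_bound; lia.
  - intros; apply (mul_unit_inj q a); auto.
Qed.

Lemma twisted_unit q chi n : is_dirichlet_char q chi -> Nat.gcd n q = 1%nat -> twisted q chi n = (chi n * twisted q chi 1)%cx.
Proof.
  intros Hc H. rewrite <- (twisted_mul q chi n 1 Hc H), Nat.mul_1_r.
  replace (chi n * (Cconj (chi n) * twisted q chi n))%cx with ((Cconj (chi n) * chi n) * twisted q chi n)%cx by ring.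
  rewrite (chi_unit _ _ _ Hc H). ring.
Qed.

(** Let [g = gcd(n, q) > 1] and [d = q / g]. Primitivity supplies a unit [a] with [a = 1] modulo [d]
    and [chi a <> 1]. Then [a n = n] modulo [q], so the transform at [a n] and at [n] agree, whereas
    [twisted_mul] makes them differ by the factor [chi a]. *)
Lemma twisted_nonunit q chi n : is_dirichlet_char q chi -> primitive_char q chi -> Nat.gcd n q <> 1%nat -> twisted q chi n = C0.
Proof.
  intros Hc Hp H. pose proof (q_pos _ _ Hc) as Hq. set (g := Nat.gcd n q) in *.
  destruct (Nat.gcd_divide_r n q) as [d Hd]. fold g in Hd. destruct (Nat.gcd_divide_l n q) as [n' Hn]. fold g in Hn.
  assert (g <> 0)%nat by (intros E; rewrite E in Hd; lia). assert (d <> 0)%nat by (intros E; rewrite E in Hd; simpl in Hd; lia).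
  destruct (Hp d) as (a & Ha & Hmod & Hneq). { exists g. lia. } { nia. }
  assert (E : twisted q chi (a * n) = twisted q chi n).
  { apply Csum_ext. intros m _. f_equal.
    (* Multiples of [q] are added on both sides so that the congruence becomes an equality in [nat]
       without subtraction. *)
    rewrite <- (er_per q (m * (a * n)) (m * n' * (1 / d))), <- (er_per q (m * n) (m * n' * (a / d))) by lia. f_equal.
    pose proof (Nat.div_mod_eq a d). pose proof (Nat.div_mod_eq 1 d). set (x := (a / d)%nat) in *. set (y := (1 / d)%nat) in *.
    assert (a + d * y = 1 + d * x)%nat by lia. clearbody g. rewrite Hn, Hd.
    replace (m * (a * (n' * g)) + m * n' * y * (d * g))%nat with (m * n' * g * (a + d * y))%nat by ring. rewrite H4. ring. }
  pose proof (twisted_mul q chi a n Hc Ha) as T. rewrite E in T. set (t := twisted q chi n) in *.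
  assert (Z : ((chi a - C1) * t = C0)%cx).
  { rewrite <- T at 1. replace ((chi a - C1) * (Cconj (chi a) * t))%cx with ((Cconj (chi a) * chi a) * t - Cconj (chi a) * t)%cx by ring.
    rewrite (chi_unit _ _ _ Hc Ha), T. ring. }
  assert ((chi a - C1)%cx <> C0). { intros E'. apply Hneq. replace (chi a) with (chi a - C1 + C1)%cx by ring. rewrite E'; ring. }
  replace t with ((chi a - C1) * t / (chi a - C1))%cx by (field; auto). rewrite Z. field; auto.
Qed.

Lemma gauss_twisted q chi : is_dirichlet_char q chi -> twisted q chi 1 = Cconj (gauss_sum q chi).
Proof.
  intros Hc. pose proof (q_pos _ _ Hc) as Hq. unfold gauss_sum. rewrite Csum_conj.
  set (f := fun m => (Cconj (chi m) * er q (m * 1))%cx).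
  rewrite (Csum_ext q _ (fun p => f (S p))).
  - change (twisted q chi 1) with (Csum_lt q f).
    (* The Gauss sum runs over [1, ..., q] and [twisted] over [0, ..., q - 1]; the end terms agree
       by periodicity. *)
    assert (E : f q = f 0%nat).
    { unfold f. f_equal. f_equal. pose proof (chi_per q chi 0 1 Hc) as T; rewrite Nat.mul_1_l in T; exact T. simpl (0 * 1)%nat. rewrite Nat.mul_1_r, er_0, er_self by lia; auto. }
    pose proof (Csum_S q f) as S1. simpl in S1. rewrite E in S1.
    replace (Csum_lt q f) with (Csum_lt q f + f 0%nat - f 0%nat)%cx by ring. rewrite S1. ring.
  - intros p _. unfold f. rewrite Cconj_mult, Nat.mul_1_r. f_equal. rewrite Cconj_Cexp_i. reflexivity.
Qed.

Lemma gauss_mod q chi : is_dirichlet_char q chi -> primitive_char q chi -> (gauss_sum q chi * Cconj (gauss_sum q chi))%cx = nC q.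
Proof.
  intros Hc Hp. pose proof (q_pos _ _ Hc) as Hq. set (G := gauss_sum q chi). set (t := twisted q chi).
  set (S := Csum_lt q (fun n => chi n * Cconj (chi n))%cx).
  (* Parseval for the finite Fourier transform of [Cconj chi]. *)
  assert (P1 : Csum_lt q (fun n => t n * Cconj (t n))%cx = (G * Cconj G * S)%cx).
  { unfold S. rewrite <- Csum_scal. apply Csum_ext. intros n _.
    assert (E : t n = (chi n * Cconj G)%cx).
    { destruct (Nat.eq_dec (Nat.gcd n q) 1) as [E|E]. unfold t. rewrite twisted_unit, gauss_twisted by auto; auto.
      unfold t. rewrite twisted_nonunit by auto. destruct Hc as (_ & _ & _ & _ & H0). rewrite (H0 n E). ring. }
    rewrite E, Cconj_mult, Cconj_invol. ring. }
  assert (P2 : Csum_lt q (fun n => t n * Cconj (t n))%cx = (nC q * S)%cx).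
  (* Expand the product and sum over [n] first. The difference of two indices is written with
     [q - m'], which is correct modulo [q] and stays in [nat]. *)
  { transitivity (Csum_lt q (fun n => Csum_lt q (fun m => Csum_lt q (fun m' => (Cconj (chi m) * chi m') * er q (n * (m + (q - m')))))%cx)).
    { apply Csum_ext. intros n _. unfold t at 2, twisted. rewrite Csum_conj. unfold t, twisted.
      transitivity (Csum_lt q (fun m => Csum_lt q (fun m' => Cconj (chi m' ) * er q (m' * n))%cx * Cconj (Cconj (chi m) * er q (m * n)))%cx).
      { rewrite Csum_scal. reflexivity. }
      rewrite (Csum_ext q _ (fun m => Csum_lt q (fun m' => (Cconj (chi m') * chi m) * er q (n * (m' + (q - m)))))%cx).
      apply Csum_exch. intros m Hm.
      transitivity (Cconj (Cconj (chi m) * er q (m * n)) * Csum_lt q (fun m' => Cconj (chi m') * er q (m' * n)))%cx. ring.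
      rewrite <- Csum_scal. apply Csum_ext. intros m' _. rewrite Cconj_mult, Cconj_invol.
      replace (n * (m' + (q - m)))%nat with (m' * n + (n * q - m * n))%nat by nia. rewrite er_plus, er_conj_flip by nia. ring. }
    rewrite Csum_exch. unfold S. rewrite <- Csum_scal. apply Csum_ext. intros m Hm. rewrite Csum_exch.
    rewrite (Csum_ext q _ (fun m' => if Nat.eq_dec m' m then nC q * (chi m * Cconj (chi m)) else C0)%cx).
    { clear - Hm. assert (K : forall n, Csum_lt n (fun m' => if Nat.eq_dec m' m then nC q * (chi m * Cconj (chi m)) else C0)%cx = if le_lt_dec n m then C0 else (nC q * (chi m * Cconj (chi m)))%cx).
      { induction n; cbn [Csum_lt]. destruct (le_lt_dec 0 m); [auto|lia]. rewrite IHn. destruct (le_lt_dec n m), (Nat.eq_dec n m), (le_lt_dec (S n) m); try lia; ring. }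
      rewrite K. destruct le_lt_dec; [lia|auto]. }
    intros m' Hm'. rewrite Csum_scal, er_sum by lia.
    destruct (Nat.eq_dec m' m) as [->|N].
    - replace (m + (q - m))%nat with q by lia. rewrite Nat.Div0.mod_same. simpl. ring.
    - destruct Nat.eq_dec as [E|E]; [|ring]. exfalso. apply Nat.Div0.mod_divides in E as [c Hc']. destruct c as [|[|c]]; [lia | lia | nia]. }
  rewrite P1 in P2.
  (* [S] is a sum of squares in which [chi 1 = 1] occurs. For [q = 1] the index 1 is out of range,
     and [chi 0 = chi 1] takes its place. *)
  assert (HS : S <> C0).
  { intros E. assert (E' : S = RtoC (Rsum_lt q (fun n => Cmod (chi n) ^ 2))).
    { unfold S. rewrite Rsum_RtoC. apply Csum_ext. intros n _. rewrite Cmod_sqr. unfold Re, Im. cplx; ring. }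
    rewrite E in E'. apply (f_equal Re) in E'. change (0 = Rsum_lt q (fun n => Cmod (chi n) ^ 2)) in E'.
    destruct (Nat.eq_dec q 1) as [Q|Q].
    - subst q. cbn [Rsum_lt] in E'. replace (chi 0%nat) with (chi 1%nat) in E'. rewrite (chi_one _ _ Hc), Cmod_C1 in E'. lra.
      rewrite <- (chi_mod 1 chi 1 Hc). reflexivity.
    - pose proof (Rsum_mono 2 q (fun n => Cmod (chi n) ^ 2) (fun k => pow2_ge_0 _) ltac:(lia)) as L.
      cbn [Rsum_lt] in L. rewrite (chi_one _ _ Hc), Cmod_C1 in L. pose proof (pow2_ge_0 (Cmod (chi 0%nat))). lra. }
  replace (G * Cconj G)%cx with (G * Cconj G * S / S)%cx by (field; auto). rewrite P2. field; auto.
Qed.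

Lemma gauss_neq q chi : is_dirichlet_char q chi -> primitive_char q chi -> gauss_sum q chi <> C0.
Proof.
  intros Hc Hp E. pose proof (gauss_mod q chi Hc Hp) as H. rewrite E in H. pose proof (q_pos _ _ Hc).
  apply (nC_neq q); [lia|]. rewrite <- H. ring.
Qed.

(** The conjugate Gauss sum is expressed as [q / G] by [gauss_mod]. Both sides vanish at non-units,
    so every [n] is covered, which the interpolation of [chi] in [character_average] needs. *)
Lemma twisted_eq q chi n : is_dirichlet_char q chi -> primitive_char q chi ->
  twisted q chi n = (nC q / gauss_sum q chi * chi n)%cx.
Proof.
  intros Hc Hp. rewrite <- (gauss_mod q chi Hc Hp). pose proof (gauss_neq q chi Hc Hp).
  transitivity (chi n * Cconj (gauss_sum q chi))%cx; [|field; auto].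
  destruct (Nat.eq_dec (Nat.gcd n q) 1) as [E|E]. rewrite twisted_unit, gauss_twisted by auto; auto.
  rewrite twisted_nonunit by auto. destruct Hc as (_ & _ & _ & _ & H0). rewrite (H0 n E). ring.
Qed.

(** The residue [q - 1] stands for [-1]; the square of its value is 1, so the value is real. *)
Lemma chi_minus_one q chi : is_dirichlet_char q chi -> Cconj (chi (q - 1)%nat) = chi (q - 1)%nat.
Proof.
  intros Hc. pose proof (q_pos _ _ Hc) as Hq.
  assert (E : (chi (q - 1)%nat * chi (q - 1)%nat = C1)%cx).
  { rewrite <- (chi_mul _ _ _ _ Hc). rewrite <- (chi_one _ _ Hc), <- (chi_per q chi ((q - 1) * (q - 1)) 2 Hc), <- (chi_per q chi 1 q Hc). f_equal. nia. }
  destruct (chi (q - 1)%nat) as [a b]. pose proof (f_equal Re E) as E1. pose proof (f_equal Im E) as E2.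
  unfold Cmult, C1, RtoC, Re, Im in E1, E2; simpl in E1, E2. assert (a <> 0) by (intros ->; nra). assert (b = 0) by nra. subst. cplx; ring.
Qed.

Lemma chi_flip q chi m k : is_dirichlet_char q chi -> (m <= k * q)%nat -> chi (k * q - m)%nat = (chi (q - 1)%nat * chi m)%cx.
Proof.
  intros Hc L. pose proof (q_pos _ _ Hc) as Hq. rewrite <- (chi_mul _ _ _ _ Hc).
  rewrite <- (chi_per q chi (k * q - m) m Hc), <- (chi_per q chi ((q - 1) * m) k Hc). f_equal. nia.
Qed.

Lemma chiZ_neg q chi : is_dirichlet_char q chi -> (2 <= q)%nat -> chiZ q chi (- (1)) = chi (q - 1)%nat.
Proof.
  intros Hc Hq. unfold chiZ. f_equal. replace (- (1))%Z with (Z.of_nat q - 1 + (-1) * Z.of_nat q)%Z by ring.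
  rewrite Z.mod_add, Z.mod_small by lia. lia.
Qed.
Lemma chiZ_pos q chi : is_dirichlet_char q chi -> (2 <= q)%nat -> chiZ q chi (- (-1)) = C1.
Proof.
  intros Hc Hq. unfold chiZ. rewrite <- (chi_one _ _ Hc). f_equal. rewrite Z.mod_small by lia. reflexivity.
Qed.
Lemma Ccv_eq u l l' : Ccv u l -> l = l' -> Ccv u l'.
Proof. intros H <-; auto. Qed.

(** * The Gamma function *)

(** The partial products are bounded by the exponential of the sum, so the increments [U n * e n]
    are dominated and the telescoping series converges. To exclude the limit 0, the lemma is applied
    to the reciprocals as well. *)
Lemma infinite_product (U e : nat -> Cplx) a A :
  (forall n, U (S n) = (U n * (C1 + e n))%cx) -> (forall n, Cmod (e n) <= a n) -> Rsummable a A ->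
  (forall n, Cmod (U n) <= Cmod (U 0%nat) * exp A) /\ exists l, Ccv U l.
Proof.
  intros HU He HA. assert (a0 : forall n, 0 <= a n) by (intros n; eapply Rle_trans; [apply Cmod_nonneg|apply He]).
  assert (B : forall n, Cmod (U n) <= Cmod (U 0%nat) * exp (Rsum_lt n a)).
  { induction n; simpl. rewrite exp_0; lra. rewrite HU, Cmod_mul, exp_plus.
    rewrite <- Rmult_assoc. apply Rmult_le_compat; try apply Cmod_nonneg; auto.
    eapply Rle_trans; [apply Cmod_tri|]. rewrite Cmod_C1. pose proof (exp_ineq1_le (a n)). specialize (He n). lra. }
  assert (B' : forall n, Cmod (U n) <= Cmod (U 0%nat) * exp A).
  { intros n. eapply Rle_trans; [apply B|]. apply Rmult_le_compat_l. apply Cmod_nonneg. apply exp_le. apply Rsummable_ge; auto. }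
  split; auto.
  set (D := Cmod (U 0%nat) * exp A) in *.
  destruct (dominated_series (fun n => U n * e n)%cx (fun n => D * a n) (D * A)) as [l Hl].
  - intros n. rewrite Cmod_mul. apply Rmult_le_compat; try apply Cmod_nonneg; auto.
  - apply Rsummable_scal; auto.
  - exists (U 0%nat + l)%cx. apply (Ccv_ext (fun n => U 0%nat + Csum_lt n (fun n => U n * e n))%cx _ _ 0%nat).
    + intros n _. induction n; simpl. ring. rewrite HU, <- IHn. ring.
    + apply Ccv_plus; auto. apply Ccv_const.
Qed.

Definition gauss_prod (n : nat) (z : Cplx) : Cplx :=
  Cdiv (Cmult (RtoC (INR (fact n))) (Cpow (RtoC (INR n)) z)) (Cprod_lt (S n) (fun k => Cplus z (RtoC (INR k)))).

Lemma Cprod_neq n f : (forall k, (k < n)%nat -> f k <> C0) -> Cprod_lt n f <> C0.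
Proof.
  intros H. induction n; simpl. apply C1_neq_0. intros E. apply (f_equal Cmod) in E. rewrite Cmod_mul, Cmod_C0 in E.
  assert (0 < Cmod (Cprod_lt n f)) by (apply Cmod_pos; auto). assert (0 < Cmod (f n)) by (apply Cmod_pos; auto). nra.
Qed.
Lemma Cprod_ext n f g : (forall k, (k < n)%nat -> f k = g k) -> Cprod_lt n f = Cprod_lt n g.
Proof. intros H; induction n; simpl; auto. rewrite IHn, (H n); auto. Qed.
Lemma Cprod_S n f : Cprod_lt (S n) f = (f 0%nat * Cprod_lt n (fun k => f (S k)))%cx.
Proof. induction n. simpl; ring. change (Cprod_lt (S (S n)) f) with (Cprod_lt (S n) f * f (S n))%cx. rewrite IHn. simpl; ring. Qed.
Lemma nC_fact_neq n : nC (fact n) <> C0.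
Proof. apply nC_neq, fact_neq_0. Qed.

Lemma gauss_prod_neq n w : n <> 0%nat -> (forall k, (w + nC k)%cx <> C0) -> gauss_prod n w <> C0.
Proof.
  intros Hn N E. unfold gauss_prod in E.
  assert (NP : Cprod_lt (S n) (fun k => w + RtoC (INR k))%cx <> C0) by (apply Cprod_neq; intros; apply N).
  apply (f_equal Cmod) in E. rewrite Cmod_Cdiv, Cmod_mul, Cmod_C0 in E by auto.
  assert (0 < Cmod (Cpow (RtoC (INR n)) w)) by (apply Cmod_pos, Cpow_neq, (nC_neq n); auto).
  assert (0 < Cmod (RtoC (INR (fact n)))) by (apply Cmod_pos, nC_fact_neq). pose proof (Cmod_pos _ NP).
  assert (0 < Cmod (RtoC (INR (fact n))) * Cmod (Cpow (RtoC (INR n)) w) / Cmod (Cprod_lt (S n) (fun k => w + RtoC (INR k))%cx)); [|lra].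
  apply Rdiv_lt_0_compat; auto. apply Rmult_lt_0_compat; auto.
Qed.

Lemma Re_shift_neq w k : 0 < Re w -> (w + nC k)%cx <> C0.
Proof. intros H. apply Re_pos_neq. rewrite Re_plus. unfold nC, RtoC at 1, Re at 2; simpl. pose proof (pos_INR k). lra. Qed.

Lemma ln_ratio_bounds n : let la := ln (INR (S (S n))) - ln (INR (S n)) in
  / INR (S (S n)) <= la <= / INR (S n).
Proof.
  pose proof (INR_S_ge1 n) as H. rewrite (S_INR (S n)). set (p := INR (S n)) in *. simpl.
  assert (K : forall x, 0 < x -> ln x <= x - 1).
  { intros x Hx. pose proof (exp_ineq1_le (ln x)). rewrite exp_ln in H0 by auto. lra. }
  split.
  - pose proof (K (p / (p + 1)) ltac:(apply Rdiv_lt_0_compat; lra)). rewrite ln_div in H0 by lra.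
    replace (p / (p + 1) - 1) with (- / (p + 1)) in H0 by (field; lra). lra.
  - pose proof (K ((p + 1) / p) ltac:(apply Rdiv_lt_0_compat; lra)). rewrite ln_div in H0 by lra.
    replace ((p + 1) / p - 1) with (/ p) in H0 by (field; lra). lra.
Qed.

(** This is [((n + 2) / (n + 1))^w], the quotient of the consecutive powers in Gauss's product. *)
Definition gauss_ratio (n : nat) (w : Cplx) : Cplx := Cexp (w * RtoC (ln (INR (S (S n))) - ln (INR (S n)))).

Lemma gauss_prod_step n w : 0 < Re w ->
  gauss_prod (S (S n)) w = (gauss_prod (S n) w * (gauss_ratio n w * nC (S (S n)) / (w + nC (S (S n)))))%cx.
Proof.
  intros Hw. unfold gauss_prod. change (RtoC (INR (fact (S (S n))))) with (nC (S (S n) * fact (S n))). rewrite nC_mult.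
  change (RtoC (INR (fact (S n)))) with (nC (fact (S n))).
  assert (E : Cpow (RtoC (INR (S (S n)))) w = (Cpow (RtoC (INR (S n))) w * gauss_ratio n w)%cx).
  { pose proof (INR_S_ge1 n). pose proof (INR_S_ge1 (S n)). rewrite !Cpow_exp by (apply RtoC_neq; lra). rewrite !Cln_RtoC by lra. unfold gauss_ratio.
    rewrite <- Cexp_plus. f_equal. rewrite RtoC_minus. ring. }
  rewrite E. set (f := fun k : nat => (w + RtoC (INR k))%cx).
  change (Cprod_lt (S (S (S n))) f) with (Cprod_lt (S (S n)) f * (w + nC (S (S n))))%cx.
  field. split. apply Re_shift_neq; auto. apply Cprod_neq. intros. apply Re_shift_neq; auto.
Qed.

(** The logarithm of [(n + 2) / (n + 1)] is [1 / (n + 2)] up to order [n^(-2)], and [exp u = 1 + u]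
    up to order [u^2]. The subtracted [w / (n + 2)] is the part that the new linear factor of
    Gauss's denominator cancels; what remains is summable. *)
Lemma gauss_ratio_bound R w n : 0 <= R -> Cmod w <= R ->
  Cmod (gauss_ratio n w - C1 - w / nC (S (S n))) <= (R * R * exp R + R) * Rpower (INR (S n)) (- (1 + 1)).
Proof.
  intros HR Hw. pose proof (ln_ratio_bounds n) as L. unfold gauss_ratio. set (la := ln (INR (S (S n))) - ln (INR (S n))) in *. cbv zeta in L.
  pose proof (INR_S_ge1 n) as H. assert (Ep : INR (S (S n)) = INR (S n) + 1) by apply S_INR. rewrite Ep in L.
  replace (Rpower (INR (S n)) (- (1 + 1))) with (/ INR (S n) * / INR (S n)).
  2:{ replace (- (1 + 1)) with (-1 + -1) by ring. rewrite Rpower_plus. replace (-1) with (- (1)) by ring. rewrite Rpower_Ropp, Rpower_1 by lra. auto. }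
  set (p := INR (S n)) in *. assert (Hp : 0 < / p) by (apply Rinv_0_lt_compat; lra).
  assert (Hp1 : 0 < / (p + 1)) by (apply Rinv_0_lt_compat; lra).
  assert (Hpl : / p <= 1). { rewrite <- Rinv_1. apply Rinv_le_contravar; lra. }
  assert (Hpp : / p - / (p + 1) <= / p * / p). { replace (/ p - / (p + 1)) with (/ p * / (p + 1)) by (field; lra). apply Rmult_le_compat_l; [lra|]. apply Rinv_le_contravar; lra. }
  replace (w / nC (S (S n)))%cx with (w * RtoC (/ (p + 1)))%cx.
  2:{ unfold nC. rewrite Ep, RtoC_inv by lra. unfold Cdiv. auto. }
  replace (Cexp (w * RtoC la) - C1 - w * RtoC (/ (p + 1)))%cx with ((Cexp (w * RtoC la) - C1 - w * RtoC la) + w * RtoC (la - / (p + 1)))%cx by (rewrite RtoC_minus; ring).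
  eapply Rle_trans; [apply Cmod_tri|]. rewrite Cmod_mul, (Cmod_RtoC (la - _)), (Rabs_pos_eq (la - _)) by lra.
  assert (Em : Cmod (w * RtoC la) = Cmod w * la) by (rewrite Cmod_mul, Cmod_RtoC, Rabs_pos_eq; lra).
  pose proof (Cexp_bound2 (w * RtoC la)) as T. rewrite Em in T. pose proof (Cmod_nonneg w).
  assert (Cmod w * la <= R * / p) by (apply Rmult_le_compat; lra). assert (0 <= Cmod w * la) by nra.
  assert (exp (Cmod w * la) <= exp R) by (apply exp_le; nra).
  assert (T2 : Cmod w * la * (Cmod w * la) * exp (Cmod w * la) <= (R * / p * (R * / p)) * exp R).
  { apply Rmult_le_compat; auto. nra. left; apply exp_pos. apply Rmult_le_compat; auto. }
  assert (T3 : Cmod w * (la - / (p + 1)) <= R * (/ p * / p)) by (apply Rmult_le_compat; lra).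
  replace ((R * R * exp R + R) * (/ p * / p)) with ((R * / p * (R * / p)) * exp R + R * (/ p * / p)) by ring. lra.
Qed.

(** The sum of [n^(-2)], fixed once so that the bounds on the Gamma function depend on [R] alone. *)
Definition zeta2 : R := epsilon (inhabits 0) (fun A => Rsummable (fun n => Rpower (INR (S n)) (- (1 + 1))) A).
Lemma zeta2_spec : Rsummable (fun n => Rpower (INR (S n)) (- (1 + 1))) zeta2.
Proof. unfold zeta2. apply epsilon_spec. apply zeta_summable; lra. Qed.

Lemma Re_nC k : Re (nC k) = INR k.
Proof. reflexivity. Qed.

(** [infinite_product] applies to the Gauss products and to their reciprocals, and the two limits
    multiply to 1. The hypothesis [1 <= Re w] bounds the quotients [(n + 2) / (w + n + 2)] and the
    first product [1 / (w (w + 1))] by 1, which makes the estimate uniform on [Cmod w <= R]. *)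
Lemma gauss_prod_cv R w : 1 <= Re w -> Cmod w <= R ->
  exists l, Ccv (fun n => gauss_prod n w) l /\ l <> C0 /\ Cmod l <= exp ((R * R * exp R + R) * zeta2).
Proof.
  intros Hw HR. assert (R0 : 0 <= R) by (pose proof (Cmod_nonneg w); lra).
  set (C := R * R * exp R + R). assert (HC : 0 <= C) by (unfold C; pose proof (exp_pos R); nra).
  assert (N : forall n, (w + nC n)%cx <> C0) by (intros; apply Re_shift_neq; lra).
  assert (N1 : forall n, nC (S n) <> C0) by (intros; apply nC_neq; lia).
  assert (NG : forall n, gauss_ratio n w <> C0) by (intros; apply Cexp_neq).
  destruct (infinite_product (fun n => gauss_prod (S n) w) (fun n => (gauss_ratio n w - C1 - w / nC (S (S n))) * (nC (S (S n)) / (w + nC (S (S n)))))%cx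
     (fun n => C * Rpower (INR (S n)) (- (1 + 1))) (C * zeta2)) as [B [l Hl]].
  { intros n. rewrite gauss_prod_step by lra. f_equal. field. split; auto. }
  { intros n. rewrite Cmod_mul. rewrite <- (Rmult_1_r (C * _)). apply Rmult_le_compat; try apply Cmod_nonneg.
    apply gauss_ratio_bound; auto. rewrite Cmod_Cdiv, Cmod_nC by auto.
    pose proof (INR_S_ge1 (S n)). pose proof (Re_le_Cmod (w + nC (S (S n)))). rewrite Re_plus, Re_nC, Rabs_pos_eq in H0 by lra.
    apply Rmult_le_reg_r with (Cmod (w + nC (S (S n)))). lra. unfold Rdiv. rewrite Rmult_assoc, Rinv_l by lra. lra. }
  { apply Rsummable_scal, zeta2_spec. }
  destruct (infinite_product (fun n => / gauss_prod (S n) w)%cx (fun n => (- C1) * (gauss_ratio n w - C1 - w / nC (S (S n))) * / gauss_ratio n w)%cx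
     (fun n => exp R * (C * Rpower (INR (S n)) (- (1 + 1)))) (exp R * (C * zeta2))) as [_ [l' Hl']].
  { intros n. rewrite gauss_prod_step by lra.
    assert (gauss_prod (S n) w <> C0) by (apply gauss_prod_neq; auto).
    field. repeat split; auto. }
  { intros n. rewrite !Cmod_mul, Cmod_neg, Cmod_C1, Rmult_1_l, Rmult_comm. apply Rmult_le_compat; try apply Cmod_nonneg.
    - unfold gauss_ratio. rewrite <- Cexp_opp. eapply Rle_trans; [apply Cmod_Cexp_le|]. apply exp_le.
      rewrite Cmod_neg, Cmod_mul, Cmod_RtoC. pose proof (ln_ratio_bounds n) as L. cbv zeta in L. pose proof (INR_S_ge1 n). pose proof (INR_S_ge1 (S n)).
      assert (0 < / INR (S (S n))) by (apply Rinv_0_lt_compat; lra).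
      assert (/ INR (S n) <= 1). { rewrite <- Rinv_1. apply Rinv_le_contravar; lra. }
      rewrite Rabs_pos_eq by lra. pose proof (Cmod_nonneg w). nra.
    - apply gauss_ratio_bound; auto. }
  { apply Rsummable_scal, Rsummable_scal, zeta2_spec. }
  assert (P : (l * l')%cx = C1).
  { apply (Ccv_unique (fun n => gauss_prod (S n) w * / gauss_prod (S n) w)%cx). apply Ccv_mult; auto.
    apply (Ccv_ext (fun _ => C1) _ _ 0%nat); [|apply Ccv_const]. intros n _. field. apply gauss_prod_neq; auto. }
  exists l. split; [apply Ccv_S; auto|]. split.
  { intros ->. apply C1_neq_0. rewrite <- P. ring. }
  replace l with (l - C0)%cx by ring. apply (Ccv_le _ _ _ _ 0%nat Hl). intros n _. replace (gauss_prod (S n) w - C0)%cx with (gauss_prod (S n) w) by ring.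
  eapply Rle_trans; [apply B|]. rewrite <- (Rmult_1_l (exp (C * zeta2))) at 2. apply Rmult_le_compat_r. left; apply exp_pos.
  unfold gauss_prod. cbn [fact Cprod_lt]. change (RtoC (INR 1)) with C1. change (RtoC (INR 0)) with C0.
  change (1 * 1)%nat with 1%nat. change (RtoC (INR 1)) with C1. rewrite Cpow_C1.
  assert (L0 : 1 <= Cmod w) by (pose proof (Re_le_Cmod w); rewrite Rabs_pos_eq in H by lra; lra).
  assert (L1 : 1 <= Cmod (w + C1)). { pose proof (Re_le_Cmod (w + C1)). rewrite Re_plus in H. unfold C1, RtoC at 1, Re at 2 in H; simpl in H. rewrite Rabs_pos_eq in H by lra. unfold C1; lra. }
  assert (w <> C0) by (apply Re_pos_neq; lra). assert ((w + C1)%cx <> C0) by (intros E; rewrite E, Cmod_C0 in L1; lra).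
  replace (C1 * C1 / (C1 * (w + C0) * (w + C1)))%cx with (/ (w * (w + C1)))%cx.
  2:{ field. repeat split; auto. }
  rewrite Cmod_Cinv. rewrite Cmod_mul. rewrite <- Rinv_1. apply Rinv_le_contravar; nra.
  intros E. apply (f_equal Cmod) in E. rewrite Cmod_mul, Cmod_C0 in E. nra.
Qed.

Lemma CGamma_eq w l : Ccv (fun n => gauss_prod n w) l -> CGamma w = l.
Proof. apply Clim_eq. Qed.

Lemma CGamma_cv w : 1 <= Re w -> Ccv (fun n => gauss_prod n w) (CGamma w) /\ CGamma w <> C0.
Proof.
  intros H. destruct (gauss_prod_cv (Cmod w) w H (Rle_refl _)) as (l & Hl & H0 & _).
  rewrite (CGamma_eq w l Hl); auto.
Qed.

Lemma CGamma_bound R : exists B, forall w, 1 <= Re w -> Cmod w <= R -> Cmod (CGamma w) <= B.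
Proof.
  exists (exp ((R * R * exp R + R) * zeta2)). intros w H HR. destruct (gauss_prod_cv R w H HR) as (l & Hl & _ & HB).
  rewrite (CGamma_eq w l Hl); auto.
Qed.

Lemma inv_nC_cv0 : Ccv (fun n => / nC n)%cx C0.
Proof.
  apply (Ccv_squeeze _ _ (fun n => / INR n) 1).
  - intros e He. destruct (INR_unbounded (/ e)) as [n Hn]. exists n. intros m Hm. apply le_INR in Hm.
    assert (0 < / e) by (apply Rinv_0_lt_compat; auto). unfold R_dist, Rdist. rewrite Rminus_0_r, Rabs_pos_eq.
    rewrite <- (Rinv_inv e). apply Rinv_lt_contravar; [|lra]. apply Rmult_lt_0_compat; lra. left; apply Rinv_0_lt_compat; lra.
  - intros n Hn. replace (/ nC n - C0)%cx with (/ nC n)%cx by ring. rewrite Cmod_Cinv, Cmod_nC by (apply nC_neq; lia). lra.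
Qed.

Lemma shift_ratio_cv w : Ccv (fun n => (w + nC n) / nC n)%cx C1.
Proof.
  apply (Ccv_ext (fun n => C1 + w * / nC n)%cx _ _ 1%nat). intros n Hn. field. apply nC_neq; lia.
  eapply Ccv_eq. apply Ccv_plus. apply Ccv_const. apply Ccv_scal, inv_nC_cv0. ring.
Qed.

(** The functional equation of Gamma at the level of the products: those at [w] and at [w + 1]
    differ by the factor [(w + 1 + n) / (n w)], which tends to [1 / w]. *)
Lemma gauss_prod_shift w l : (forall k, (w + nC k)%cx <> C0) -> Ccv (fun n => gauss_prod n (w + C1)) l -> Ccv (fun n => gauss_prod n w) (l / w).
Proof.
  intros N H. assert (Hw : w <> C0). { intros E. apply (N 0%nat). rewrite E. cplx; ring. }
  apply (Ccv_ext (fun n => gauss_prod n (w + C1) * ((w + C1 + nC n) / nC n) * / w)%cx _ _ 1%nat).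
  - intros n Hn. unfold gauss_prod.
    set (f := fun k : nat => (w + RtoC (INR k))%cx).
    assert (E : (w * Cprod_lt (S n) (fun k => w + C1 + RtoC (INR k)) = Cprod_lt (S n) f * (w + C1 + nC n))%cx).
    { replace w with (f 0%nat) at 1 by (unfold f; cplx; ring).
      rewrite (Cprod_ext (S n) (fun k => w + C1 + RtoC (INR k))%cx (fun k => f (S k))). 2:{ intros k _. unfold f. fold (nC k). fold (nC (S k)). rewrite nC_S. ring. }
      rewrite <- Cprod_S. simpl Cprod_lt at 1. unfold f at 3. fold (nC (S n)). rewrite nC_S. f_equal. ring. }
    assert (N1 : nC n <> C0) by (apply nC_neq; lia).
    assert (N2 : Cprod_lt (S n) f <> C0) by (apply Cprod_neq; intros; apply N).
    assert (N3 : (w + C1 + nC n)%cx <> C0). { specialize (N (S n)). rewrite nC_S in N. intros E'. apply N. rewrite <- E'. ring. }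
    rewrite Cpow_plus by exact N1. rewrite (Cpow_1 (RtoC (INR n))) by (unfold RtoC, Re; simpl; apply lt_0_INR; lia).
    fold (nC n). set (P := Cprod_lt (S n) (fun k => w + C1 + RtoC (INR k))%cx) in *.
    assert (N4 : P <> C0). { intros E'. rewrite E' in E. apply N3. replace (w + C1 + nC n)%cx with (Cprod_lt (S n) f * (w + C1 + nC n) / Cprod_lt (S n) f)%cx by (field; auto). rewrite <- E. field; auto. }
    replace (Cprod_lt (S n) f) with (w * P / (w + C1 + nC n))%cx by (rewrite E; field; auto). field. repeat split; auto.
  - replace (l / w)%cx with (l * C1 * / w)%cx by (field; auto). apply Ccv_mult. apply Ccv_mult; auto. apply shift_ratio_cv. apply Ccv_const.
Qed.

(** Convergence was shown for [1 <= Re w] only; [k] shifts reach any [w] off the poles, such as the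
    argument [1 - s] in the prefactor. The product is what [prefactor_constant] matches with the
    binomial coefficient. *)
Lemma CGamma_shift k : forall w, (forall j, (w + nC j)%cx <> C0) -> 1 <= Re (w + nC k) ->
  Ccv (fun n => gauss_prod n w) (CGamma w) /\ (CGamma w * Cprod_lt k (fun j => w + nC j) = CGamma (w + nC k))%cx.
Proof.
  induction k; intros w N H.
  - assert (E : (w + nC 0 = w)%cx) by (cplx; ring). rewrite E in *. split. apply CGamma_cv; auto. simpl; ring.
  - assert (E : (w + nC (S k) = w + C1 + nC k)%cx) by (rewrite nC_S; ring). rewrite E in *.
    destruct (IHk (w + C1)%cx) as [H1 H2]; auto. { intros j. specialize (N (S j)). rewrite nC_S in N. intros E'. apply N. rewrite <- E'. ring. }
    assert (Hw : w <> C0). { intros E0. apply (N 0%nat). rewrite E0. cplx; ring. }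
    pose proof (gauss_prod_shift w _ N H1) as H3. rewrite (CGamma_eq _ _ H3). split; auto.
    rewrite <- H2, Cprod_S. rewrite (Cprod_ext k (fun k0 => w + nC (S k0))%cx (fun j => w + C1 + nC j)%cx) by (intros; rewrite nC_S; ring).
    replace (w + nC 0)%cx with w by (cplx; ring). field; auto.
Qed.

(* The coefficient of [u^k] in the binomial series of [(1 - u)^(-z-1)]. *)
Definition bcoef (z : Cplx) (k : nat) : Cplx := (Cprod_lt k (fun j => z + C1 + nC j) / nC (fact k))%cx.

Lemma bcoef_0 z : bcoef z 0 = C1.
Proof. unfold bcoef. simpl. change (nC 1) with C1. field. apply C1_neq_0. Qed.

Lemma bcoef_S z k : (nC (S k) * bcoef z (S k) = (z + C1 + nC k) * bcoef z k)%cx.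
Proof.
  unfold bcoef. cbn [Cprod_lt]. rewrite fact_simpl, nC_mult. field. split. apply nC_fact_neq. apply nC_neq; lia.
Qed.

(** Up to the factor [n / (z + 1 + n)], which tends to 1, this sequence is the reciprocal of Gauss's
    product at [z + 1]. *)
Lemma bcoef_asymptotic z : 0 <= Re z -> Ccv (fun n => bcoef z n * Cpow (nC n) (- z))%cx (/ CGamma (z + C1)).
Proof.
  intros Hz. assert (H : 1 <= Re (z + C1)) by (rewrite Re_plus; unfold C1, RtoC, Re in *; simpl; lra).
  destruct (CGamma_cv _ H) as [Hc H0].
  assert (NG : forall n, (1 <= n)%nat -> gauss_prod n (z + C1) <> C0).
  { intros n Hn. apply gauss_prod_neq; [lia|]. intros; apply Re_shift_neq; lra. }
  assert (L : Ccv (fun n => / gauss_prod n (z + C1))%cx (/ CGamma (z + C1))).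
  { pose proof (Cmod_pos _ H0) as Hm. set (m := Cmod (CGamma (z + C1))) in *. destruct (Hc (m / 2)) as [K HK]; [lra|].
    apply (Ccv_squeeze _ _ (fun n => 2 / (m * m) * Cmod (gauss_prod n (z + C1) - CGamma (z + C1))) (K + 1)).
    - replace 0 with (2 / (m * m) * 0) by ring. apply CV_mult; [apply Un_cv_const|]. apply Ccv_iff; auto.
    - intros n Hn. specialize (HK n ltac:(lia)). pose proof (NG n ltac:(lia)) as Nn.
      pose proof (Cmod_rev (CGamma (z + C1)) (gauss_prod n (z + C1))) as T. rewrite Cmod_sym in T. fold m in T.
      set (g := gauss_prod n (z + C1)) in *. set (G := CGamma (z + C1)) in *.
      replace (/ g - / G)%cx with (- (g - G) / (g * G))%cx by (field; auto).
      assert (HgG : Cmod (g * G) = Cmod g * m) by (rewrite Cmod_mul; auto).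
      rewrite Cmod_Cdiv, Cmod_neg, HgG. 2:{ intros E. rewrite E, Cmod_C0 in HgG. nra. }
      unfold Rdiv. rewrite Rmult_comm. apply Rmult_le_compat_r. apply Cmod_nonneg.
      replace (2 * / (m * m)) with (/ (m / 2 * m)) by (field; lra). apply Rinv_le_contravar; nra. }
  apply (Ccv_ext (fun n => / ((z + C1 + nC n) / nC n) * / gauss_prod n (z + C1))%cx _ _ 1%nat).
  - intros n Hn. assert (N1 : nC n <> C0) by (apply nC_neq; lia).
    assert (N2 : (z + C1 + nC n)%cx <> C0) by (apply Re_shift_neq; lra).
    unfold gauss_prod, bcoef. cbn [Cprod_lt]. fold (nC n). fold (nC (fact n)).
    rewrite Cpow_plus, Cpow_opp by auto. rewrite (Cpow_1 (nC n)) by (rewrite Re_nC; apply lt_0_INR; lia).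
    change (Cprod_lt n (fun k => z + C1 + RtoC (INR k))%cx) with (Cprod_lt n (fun k => z + C1 + nC k)%cx).
    assert (Cprod_lt n (fun k => z + C1 + nC k)%cx <> C0) by (apply Cprod_neq; intros; apply Re_shift_neq; lra).
    pose proof (nC_fact_neq n). assert (Cpow (nC n) z <> C0) by (apply Cpow_neq; auto).
    field. repeat split; auto.
  - replace (/ CGamma (z + C1))%cx with (C1 * / CGamma (z + C1))%cx by ring. apply Ccv_mult; auto.
    (* [n / (z + 1 + n) = 1 - (z + 1) / (z + 1 + n)] *)
    apply (Ccv_squeeze _ _ (fun n => Cmod (z + C1) * Cmod (/ nC n - C0)) 1).
    + replace 0 with (Cmod (z + C1) * 0) by ring. apply CV_mult; [apply Un_cv_const|]. apply Ccv_iff, inv_nC_cv0.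
    + intros n Hn. assert (N1 : nC n <> C0) by (apply nC_neq; lia). assert (N2 : (z + C1 + nC n)%cx <> C0) by (apply Re_shift_neq; lra).
      replace (/ ((z + C1 + nC n) / nC n) - C1)%cx with (- (z + C1) / (z + C1 + nC n))%cx by (field; auto).
      rewrite Cmod_Cdiv, Cmod_neg by auto. unfold Rdiv. apply Rmult_le_compat_l. apply Cmod_nonneg.
      replace (/ nC n - C0)%cx with (/ nC n)%cx by ring. rewrite Cmod_Cinv by auto. apply Rinv_le_contravar. apply Cmod_pos; auto.
      rewrite Cmod_nC. pose proof (Re_le_Cmod (z + C1 + nC n)) as T. rewrite Re_plus, Re_nC in T. pose proof (pos_INR n).
      rewrite Rabs_pos_eq in T by lra. lra.
Qed.

Lemma bcoef_bound z : 0 <= Re z -> exists B, 0 < B /\ forall n, Cmod (bcoef z (S n)) <= B * Rpower (INR (S n)) (Re z).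
Proof.
  intros Hz. destruct (Ccv_bounded _ _ (bcoef_asymptotic z Hz)) as (B & HB & H). exists B. split; auto. intros n.
  specialize (H (S n)). rewrite Cmod_mul, Cpow_nC_mod in H. replace (Re (- z)) with (- Re z) in H by reflexivity. rewrite Rpower_Ropp in H.
  pose proof (Rpower_pos (INR (S n)) (Re z)). apply Rmult_le_reg_r with (/ Rpower (INR (S n)) (Re z)). apply Rinv_0_lt_compat; auto.
  rewrite (Rmult_assoc B), Rinv_r by lra. lra.
Qed.

(** * The binomial series and its average over roots of unity *)

(** The full series solves [(1 - u) S' = (z + 1) S]; by the recurrence for the coefficients, a
    truncation solves it up to its top power. At [k = 0] the truncated exponent [k - 1] is harmless
    because [nC 0] vanishes. *)
Lemma bcoef_partial_ode z u n :
  (Csum_lt (S n) (fun k => bcoef z k * (nC k * u ^ (k - 1))) * (C1 - u) - (z + C1) * Csum_lt (S n) (fun k => bcoef z k * u ^ k)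
   = - (nC (S n) * bcoef z (S n) * u ^ n))%cx.
Proof.
  induction n.
  - rewrite bcoef_S. simpl. rewrite bcoef_0. change (nC 0) with C0. ring.
  - change (Csum_lt (S (S n)) ?f) with (Csum_lt (S n) f + f (S n))%cx. cbv beta.
    replace (S n - 1)%nat with n by lia. rewrite (bcoef_S z (S n)).
    set (A := Csum_lt (S n) (fun k => bcoef z k * (nC k * u ^ (k - 1)))%cx) in *.
    set (D := Csum_lt (S n) (fun k => bcoef z k * u ^ k)%cx) in *.
    replace ((A + bcoef z (S n) * (nC (S n) * u ^ n)) * (C1 - u) - (z + C1) * (D + bcoef z (S n) * u ^ S n))%cx
      with ((A * (C1 - u) - (z + C1) * D) + bcoef z (S n) * (nC (S n) * u ^ n) * (C1 - u) - (z + C1) * bcoef z (S n) * u ^ S n)%cx by ring.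
    rewrite IHn. simpl. ring.
Qed.

Lemma Re_C1_minus u : Re (C1 - u) = 1 - Re u.
Proof. rewrite Re_minus. reflexivity. Qed.

Lemma Un_cv_0_of_bound (a : nat -> R) B : (forall n, 0 <= a n <= B * Rpower (INR (S n)) (- (1 + 1))) -> Un_cv a 0.
Proof.
  intros H e He. assert (HB : 0 <= B). { specialize (H 0%nat). pose proof (Rpower_pos (INR 1) (- (1 + 1))). nra. }
  destruct (INR_unbounded (B / e)) as [n Hn]. exists n. intros m Hm. apply le_INR in Hm. specialize (H m).
  unfold R_dist, Rdist. rewrite Rminus_0_r, Rabs_pos_eq by lra.
  pose proof (INR_S_ge1 m). assert (Rpower (INR (S m)) (- (1 + 1)) <= / INR (S m)).
  { rewrite <- (Rpower_1 (INR (S m))) at 2 by lra. rewrite <- Rpower_Ropp. apply Rpower_ge_1_compat; lra. }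
  apply Rle_lt_trans with (B * / INR (S m)). nra. apply Rmult_lt_reg_r with (INR (S m)). lra. rewrite Rmult_assoc, Rinv_l by lra.
  rewrite S_INR. assert (B < e * INR n). { apply Rmult_lt_reg_r with (/ e). apply Rinv_0_lt_compat; auto. replace (e * INR n * / e) with (INR n) by (field; lra). exact Hn. }
  nra.
Qed.

(** The product [H] of a partial sum with [(1 - u)^(z + 1)] equals 1 at the origin, and by
    [bcoef_partial_ode] its derivative is a single term. The mean value inequality on the segment
    from 0 to [x] then shows that [H] tends to 1 at [x]. *)
Lemma binomial_series z a x : 0 <= Re z -> 0 < a -> Cmod x <= exp (- a) ->
  Ssum (fun k => bcoef z k * x ^ k)%cx (Cpow (C1 - x) (- (z + C1))).
Proof.
  intros Hz Ha Hx. assert (E1 : exp (- a) < 1). { rewrite <- exp_0. apply exp_increasing; lra. }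
  assert (Hu : forall u, Cmod u <= Cmod x -> 0 < Re (C1 - u) /\ Cmod (C1 - u) <= 2).
  { intros u Hu. rewrite Re_C1_minus. pose proof (Re_le_Cmod u). pose proof (Rle_abs (Re u)). split. lra.
    eapply Rle_trans; [apply Cmod_minus|]. rewrite Cmod_C1. lra. }
  set (Sn := fun n u => Csum_lt (S n) (fun k => bcoef z k * u ^ k)%cx).
  set (H := fun n u => (Sn n u * Cpow (C1 - u) (z + C1))%cx).
  set (H' := fun n u => (- (nC (S n) * bcoef z (S n) * u ^ n) * Cpow (C1 - u) z)%cx).
  assert (HD : forall n u, Cmod u <= Cmod x -> cderiv (H n) u (H' n u)).
  { intros n u Lu. destruct (Hu u Lu) as [Hp _]. unfold H, Sn. eapply cderiv_eq.
    - apply cderiv_mult. apply (cderiv_sum (S n) (fun k u => bcoef z k * u ^ k)%cx). intros k _. apply cderiv_scal, cderiv_pow.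
      apply (cderiv_comp (fun w => Cpow w (z + C1)) (fun u => C1 - u)%cx). apply cderiv_minus. apply cderiv_const. apply cderiv_id. apply cderiv_Cpow; auto.
    - unfold H'. rewrite <- bcoef_partial_ode. replace (z + C1 - C1)%cx with z by ring. rewrite Cpow_plus, Cpow_1 by (auto using Re_pos_neq). ring. }
  destruct (bcoef_bound z Hz) as (B & HB & Hb). destruct (pow_exp_bound (Re z + 1) a Ha) as (B' & HB' & Hpe).
  (* [D] bounds the power [(1 - u)^z] on the segment, since [|1 - u| <= 2] and [Re z >= 0]. *)
  set (D := Rpower 2 (Re z) * exp (Rabs (Im z) * PI)). assert (HD0 : 0 < D) by (apply Rmult_lt_0_compat; apply exp_pos).
  assert (K : forall n, Cmod (H n x - C1) <= B * D * (Rpower (INR (S n)) (Re z + 1) * exp (- (INR (S n) * a)))).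
  { intros n. assert (EH : H n C0 = C1).
    { unfold H, Sn. rewrite Csum_S, bcoef_0. rewrite Csum_zero by (intros; simpl; ring). replace (C1 - C0)%cx with C1 by ring.
      rewrite Cpow_C1. simpl; ring. }
    rewrite <- EH.
    destruct (Req_dec (Cmod x) 0) as [E0|E0].
    { apply Cmod_eq0 in E0. rewrite E0. replace (H n C0 - H n C0)%cx with C0 by ring. rewrite Cmod_C0. left. repeat apply Rmult_lt_0_compat; auto; apply exp_pos. }
    pose proof (Cmod_nonneg x).
    eapply Rle_trans.
    - apply (mean_value (H n) (H' n) C0 x (INR (S n) * (B * Rpower (INR (S n)) (Re z)) * Cmod x ^ n * D)).
      + intros t Ht. apply HD. apply seg_mod; auto.
      + intros t Ht. pose proof (seg_mod t x Ht) as L. destruct (Hu _ L) as [Hp H2]. unfold H'. rewrite Cmod_mul, Cmod_neg, !Cmod_mul, Cmod_nC, Cmod_Cpown.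
        apply Rmult_le_compat; try apply Cmod_nonneg. { repeat apply Rmult_le_pos; try apply Cmod_nonneg. apply pos_INR. apply pow_le, Cmod_nonneg. }
        apply Rmult_le_compat. apply Rmult_le_pos. apply pos_INR. apply Cmod_nonneg. apply pow_le, Cmod_nonneg.
        apply Rmult_le_compat_l. apply pos_INR. auto. apply pow_incr; split; auto; apply Cmod_nonneg.
        eapply Rle_trans; [apply Cpow_mod_le; auto|]. apply Rmult_le_compat_r. left; apply exp_pos. apply Rle_Rpower_l; auto. split; auto. apply Cmod_pos, Re_pos_neq; auto.
    - replace (x - C0)%cx with x by ring. pose proof (INR_S_ge1 n). pose proof (Rpower_pos (INR (S n)) (Re z)).
      rewrite Rpower_plus, Rpower_1 by lra.
      assert (Ex : Cmod x ^ n * Cmod x <= exp (- (INR (S n) * a))).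
      { replace (Cmod x ^ n * Cmod x) with (Cmod x ^ S n) by (simpl; ring). replace (exp (- (INR (S n) * a))) with (exp (- a) ^ S n).
        apply pow_incr; auto. rewrite <- Rpower_pow by apply exp_pos. unfold Rpower. rewrite ln_exp. f_equal; ring. }
      replace (INR (S n) * (B * Rpower (INR (S n)) (Re z)) * Cmod x ^ n * D * Cmod x) with (B * D * (Rpower (INR (S n)) (Re z) * INR (S n)) * (Cmod x ^ n * Cmod x)) by ring.
      replace (B * D * (Rpower (INR (S n)) (Re z) * INR (S n) * exp (- (INR (S n) * a)))) with (B * D * (Rpower (INR (S n)) (Re z) * INR (S n)) * exp (- (INR (S n) * a))) by ring.
      apply Rmult_le_compat_l; auto. apply Rmult_le_pos; [apply Rmult_le_pos; lra | apply Rmult_le_pos; lra]. }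
  assert (CV : Ccv (fun n => H n x) C1).
  { apply (Ccv_squeeze _ _ (fun n => B * D * (Rpower (INR (S n)) (Re z + 1) * exp (- (INR (S n) * a)))) 0); auto.
    apply (Un_cv_0_of_bound _ (B * D * B')). intros n. assert (0 < B * D) by (apply Rmult_lt_0_compat; auto). split.
    - apply Rmult_le_pos. lra. apply Rmult_le_pos; left; apply exp_pos.
    - rewrite (Rmult_assoc (B * D) B'). apply Rmult_le_compat_l. lra. apply Hpe. }
  destruct (Hu x (Rle_refl _)) as [Hp _]. apply Re_pos_neq in Hp.
  unfold Ssum. apply Ccv_S. apply (Ccv_ext (fun n => H n x * Cpow (C1 - x) (- (z + C1)))%cx _ _ 0%nat).
  - intros n _. unfold H. rewrite Cpow_opp by auto. fold (Sn n x). field. apply Cpow_neq; auto.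
  - eapply Ccv_eq. apply Ccv_mult. apply CV. apply Ccv_const. ring.
Qed.

(** Write [m = i q + j]. The character sees only [j], and the sum over [i] is a geometric sum over
    [M]-th roots of unity, which is zero unless [M] divides the exponent. In that case the sum over
    [j] is the transform at [n]. *)
Lemma character_er_sum q chi M n r : is_dirichlet_char q chi -> M <> 0%nat -> (r < M)%nat ->
  Csum_lt (M * q) (fun m => Cconj (chi m) * er (M * q) (m * (n * M + r)))%cx = if Nat.eq_dec r 0 then (nC M * twisted q chi n)%cx else C0.
Proof.
  intros Hc HM Hr. pose proof (q_pos _ _ Hc) as Hq. set (k := (n * M + r)%nat).
  rewrite Csum_mul_block.
  rewrite (Csum_ext M _ (fun i => er M (i * k) * Csum_lt q (fun j => Cconj (chi j) * er (M * q) (j * k)))%cx).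
  2:{ intros i _. rewrite <- Csum_scal. apply Csum_ext. intros j _.
      rewrite Nat.add_comm, (chi_per _ _ _ _ Hc). replace ((j + i * q) * k)%nat with (j * k + q * (i * k))%nat by ring.
      rewrite er_plus. replace (er (M * q) (q * (i * k))) with (er M (i * k)). ring.
      rewrite (Nat.mul_comm M q), er_scale by lia. auto. }
  set (A := Csum_lt q (fun j => Cconj (chi j) * er (M * q) (j * k))%cx).
  rewrite (Csum_ext M _ (fun i => A * er M (i * k))%cx) by (intros; ring). rewrite Csum_scal, er_sum by auto.
  replace (k mod M)%nat with r. 2:{ unfold k. rewrite Nat.add_comm, Nat.Div0.mod_add, Nat.mod_small; auto. }
  destruct Nat.eq_dec as [->|]; [|ring]. replace A with (twisted q chi n). ring.
  unfold A, twisted, k. apply Csum_ext. intros j _. f_equal. replace (j * (n * M + 0))%nat with (M * (j * n))%nat by ring. rewrite er_scale by lia. auto.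
Qed.

Lemma Cpown_mult_base z w n : ((z * w) ^ n = z ^ n * w ^ n)%cx.
Proof. induction n; simpl. ring. rewrite IHn; ring. Qed.

Lemma exp_pow a n : exp a ^ n = exp (INR n * a).
Proof. rewrite <- Rpower_pow by apply exp_pos. unfold Rpower. rewrite ln_exp. auto. Qed.

(* The binomial series averaged against the character over the [Mq]-th roots of unity keeps only
   the exponents divisible by [M]. *)
Lemma character_average q chi M z t : is_dirichlet_char q chi -> primitive_char q chi -> (2 <= q)%nat -> M <> 0%nat -> 0 <= Re z -> 0 < t ->
  Ssum (fun n => chi (S n) * bcoef z (S n * M) * RtoC (exp (- (INR (S n) * t))))%cx
    (gauss_sum q chi / (nC M * nC q) *
     Csum_lt (M * q) (fun m => Cconj (chi m) * Cpow (C1 - RtoC (exp (- (t / INR M))) * er (M * q) m) (- (z + C1))))%cx.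
Proof.
  intros Hc Hp Hq HM Hz Ht. set (x := exp (- (t / INR M))). set (G := gauss_sum q chi).
  assert (HM' : 0 < INR M) by (apply lt_0_INR; lia).
  assert (NG : G <> C0) by (apply gauss_neq; auto). assert (NM : nC M <> C0) by (apply nC_neq; auto). assert (Nq : nC q <> C0) by (apply nC_neq; lia).
  set (f := fun n => (chi n * bcoef z (n * M) * RtoC (exp (- (INR n * t))))%cx).
  (* Truncating after [L * M] terms keeps whole blocks of [M] exponents, and in each block only the
     first survives. *)
  assert (E : forall L, Csum_lt (M * q) (fun m => Cconj (chi m) * Csum_lt (L * M) (fun k => bcoef z k * (RtoC x * er (M * q) m) ^ k))%cx = (nC M * nC q / G * Csum_lt L f)%cx).
  { intros L. transitivity (Csum_lt (L * M) (fun k => bcoef z k * RtoC x ^ k * Csum_lt (M * q) (fun m => Cconj (chi m) * er (M * q) (m * k)))%cx).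
    - rewrite (Csum_ext (M * q) _ (fun m => Csum_lt (L * M) (fun k => bcoef z k * RtoC x ^ k * (Cconj (chi m) * er (M * q) (m * k)))%cx)).
      rewrite Csum_exch. apply Csum_ext. intros k _. rewrite Csum_scal. auto.
      intros m _. rewrite <- Csum_scal. apply Csum_ext. intros k _. rewrite Cpown_mult_base, (Nat.mul_comm m k), er_pow. ring.
    - rewrite Csum_mul_block. rewrite <- Csum_scal. apply Csum_ext. intros n _.
      destruct M as [|M']; [lia|]. rewrite Csum_S, (Csum_zero M'); cbv beta.
      + rewrite (character_er_sum q chi (S M') n 0) by (auto; lia). simpl Nat.eq_dec. cbv iota. rewrite twisted_eq, Nat.add_0_r by auto. fold G.
        unfold f. replace (RtoC x ^ (n * S M'))%cx with (RtoC (exp (- (INR n * t)))). field; auto.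
        rewrite <- RtoC_pow. f_equal. unfold x. rewrite exp_pow. f_equal. rewrite mult_INR. field. lra.
      + intros r Hr. rewrite (character_er_sum q chi (S M') n (S r)) by (auto; lia). simpl. ring. }
  assert (Hx : forall m, Cmod (RtoC x * er (M * q) m) <= exp (- (t / INR M))).
  { intros m. rewrite Cmod_mul, Cmod_er, Cmod_RtoC, Rabs_pos_eq by (left; apply exp_pos). unfold x; lra. }
  set (V := Csum_lt (M * q) (fun m => Cconj (chi m) * Cpow (C1 - RtoC x * er (M * q) m) (- (z + C1)))%cx).
  assert (CV : Ccv (fun L => Csum_lt L f) (G / (nC M * nC q) * V)%cx).
  { apply (Ccv_ext (fun L => G / (nC M * nC q) * Csum_lt (M * q) (fun m => Cconj (chi m) * Csum_lt (L * M) (fun k => bcoef z k * (RtoC x * er (M * q) m) ^ k)))%cx _ _ 0%nat).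
    - intros L _. rewrite E. field. auto.
    - apply Ccv_scal. apply (Csum_cv (M * q) (fun L m => Cconj (chi m) * Csum_lt (L * M) (fun k => bcoef z k * (RtoC x * er (M * q) m) ^ k))%cx).
      intros m _. apply Ccv_scal. apply (Ccv_subseq (fun K => Csum_lt K (fun k => bcoef z k * (RtoC x * er (M * q) m) ^ k)%cx) _ (fun L => L * M)%nat). intros; nia.
      apply (binomial_series z (t / INR M)); auto. apply Rdiv_lt_0_compat; auto. }
  apply (Ccv_subseq _ _ S) in CV; [|intros; lia].
  eapply Ccv_ext with (K := 0%nat); [|apply CV]. intros L _. cbv beta. rewrite Csum_S. unfold f at 1. rewrite (chi_zero _ _ Hc Hq). unfold f. ring.
Qed.
(** * Lipschitz's formula *)

Lemma tannery_series (gj : nat -> nat -> Cplx) g a A (T : nat -> Cplx) :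
  (forall n, Ccv (fun j => gj j n) (g n)) -> (forall j n, Cmod (gj j n) <= a n) -> Rsummable a A ->
  (forall j, Ssum (gj j) (T j)) -> exists l, Ssum g l /\ Ccv T l.
Proof.
  intros Hg Hb HA HT.
  assert (Hb' : forall n, Cmod (g n) <= a n).
  { intros n. replace (g n) with (g n - C0)%cx by ring. apply (Ccv_le _ _ _ _ 0%nat (Hg n)). intros j _. replace (gj j n - C0)%cx with (gj j n) by ring. auto. }
  destruct (dominated_series g a A Hb' HA) as [l Hl]. exists l. split; auto.
  apply (tannery gj g a A); auto.
  - intros K. exists 0%nat. intros j _. apply dominated_tail; auto.
  - apply dominated_tail; auto.
Qed.

(** A sum of growing length is an infinite series padded with zeros, so the previous lemma applies;
    [j <= H j] ensures that every fixed index is eventually included. *)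
Lemma tannery_truncated (gj : nat -> nat -> Cplx) g a A (H : nat -> nat) :
  (forall n, Ccv (fun j => gj j n) (g n)) -> (forall j n, (n < H j)%nat -> Cmod (gj j n) <= a n) -> (forall n, 0 <= a n) -> Rsummable a A ->
  (forall j, (j <= H j)%nat) -> exists l, Ssum g l /\ Ccv (fun j => Csum_lt (H j) (gj j)) l.
Proof.
  intros Hg Hb a0 HA HH.
  set (g' := fun j n => if lt_dec n (H j) then gj j n else C0).
  assert (Hb' : forall j n, Cmod (g' j n) <= a n). { intros j n. unfold g'. destruct lt_dec; auto. rewrite Cmod_C0; auto. }
  destruct (tannery_series g' g a A (fun j => Csum_lt (H j) (gj j))) as (l & H1 & H2); auto.
  - intros n. apply (Ccv_ext (fun j => gj j n) _ _ (S n)); auto. intros j Hj. unfold g'. destruct lt_dec; auto. specialize (HH j). lia.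
  - intros j. unfold Ssum. apply (Ccv_ext (fun _ => Csum_lt (H j) (gj j)) _ _ (H j)); [|apply Ccv_const].
    intros K HK. replace K with (H j + (K - H j))%nat by lia. rewrite Csum_add, (Csum_zero (K - H j)).
    + rewrite (Csum_ext (H j) (g' j) (gj j)). ring. intros n Hn. unfold g'. destruct lt_dec; auto. lia.
    + intros n _. unfold g'. destruct lt_dec; auto. lia.
  - exists l. auto.
Qed.

(** The point [t + 2 PI i m / q], the limit of [M (1 - exp (- t / M) * er (M q) m)] as [M] grows. *)
Definition lip_pt (q m : nat) (t : R) : Cplx := (t, 2 * PI * INR m / INR q).
(** The terms of index [m] and [- m] of Lipschitz's sum taken together: the points are conjugate,
    and the characters differ by [chi (-1)]. *)
Definition lip_term (q : nat) (chi : nat -> Cplx) (z : Cplx) (t : R) (m : nat) : Cplx :=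
  (Cconj (chi (S m)) * (Cpow (lip_pt q (S m) t) (- (z + C1)) + chi (q - 1)%nat * Cpow (Cconj (lip_pt q (S m) t)) (- (z + C1))))%cx.
Definition phi_term (chi : nat -> Cplx) (z : Cplx) (t : R) (n : nat) : Cplx :=
  (chi (S n) * Cpow (nC (S n)) z * RtoC (exp (- (INR (S n) * t))))%cx.

Lemma exp_difference_cv p : Ccv (fun n => nC n * (C1 - Cexp (- p / nC n)))%cx p.
Proof.
  apply (Ccv_squeeze _ _ (fun n => Cmod p * Cmod p * exp (Cmod p) * Cmod (/ nC n - C0)) 1).
  - replace 0 with (Cmod p * Cmod p * exp (Cmod p) * 0) by ring. apply CV_mult; [apply Un_cv_const|]. apply Ccv_iff, inv_nC_cv0.
  - intros n Hn. assert (N : nC n <> C0) by (apply nC_neq; lia). assert (Hn1 : 1 <= INR n) by (apply (le_INR 1); auto).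
    replace (nC n * (C1 - Cexp (- p / nC n)) - p)%cx with (- nC n * (Cexp (- p / nC n) - C1 - (- p / nC n)))%cx by (field; auto).
    rewrite Cmod_mul, Cmod_neg, Cmod_nC. replace (/ nC n - C0)%cx with (/ nC n)%cx by ring. rewrite Cmod_Cinv, Cmod_nC by auto.
    pose proof (Cexp_bound2 (- p / nC n)) as T. rewrite Cmod_Cdiv, Cmod_neg, Cmod_nC in T by auto.
    assert (Cmod p / INR n <= Cmod p). { pose proof (Cmod_nonneg p). apply Rmult_le_reg_r with (INR n). lra. unfold Rdiv. rewrite Rmult_assoc, Rinv_l by lra. nra. }
    pose proof (Cmod_nonneg p). pose proof (exp_le _ _ H).
    apply Rle_trans with (INR n * (Cmod p / INR n * (Cmod p / INR n) * exp (Cmod p))).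
    + apply Rmult_le_compat_l. lra. eapply Rle_trans; [apply T|]. apply Rmult_le_compat_l; auto.
      assert (0 <= Cmod p / INR n) by (apply Rdiv_le_0_compat; lra). nra.
    + right. field. lra.
Qed.

(** From [u cos u <= sin u] at [u = y / 2]: [sin y >= y cos^2 (y / 2)], and this squared cosine is
    at least [1 / 2] on the interval. *)
Lemma sin_ge_half y : 0 <= y <= PI / 2 -> y / 2 <= sin y.
Proof.
  intros Hy. pose proof PI_RGT_0. assert (K : forall u, 0 <= u <= PI / 2 -> u * cos u <= sin u).
  { intros u Hu. destruct (Req_dec u 0) as [->|N]. rewrite sin_0; lra.
    destruct (MVT_cor2 sin cos 0 u) as (c & Hc & Hc1). lra. intros; apply derivable_pt_lim_sin.
    rewrite sin_0 in Hc. assert (cos u <= cos c) by (apply cos_decr_1; lra). nra. }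
  specialize (K (y / 2) ltac:(lra)). replace y with (2 * (y / 2)) at 2 by field. rewrite sin_2a.
  assert (C : cos y = 2 * cos (y / 2) * cos (y / 2) - 1). { replace y with (2 * (y / 2)) at 1 by field. apply cos_2a_cos. }
  assert (0 <= cos y) by (apply cos_ge_0; lra). assert (0 <= cos (y / 2)) by (apply cos_ge_0; lra). nra.
Qed.

(** A bound linear in [m] and free of [M] is what gives the folded averages a common majorant. It
    comes from [|1 - x exp(- i th)|^2 = (1 - x)^2 + 4 x sin^2 (th / 2)]; the condition [2 m <= M q]
    keeps [th] in [[0, PI]], and [x >= exp (- t)] removes [M]. *)
Lemma root_distance_bound q M m t : (0 < q)%nat -> (0 < M)%nat -> 0 < t -> (2 * m <= M * q)%nat ->
  exp (- t) / INR q * INR m <= Cmod (nC M * (C1 - RtoC (exp (- (t / INR M))) * er (M * q) m)).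
Proof.
  intros Hq HM Ht Hm. rewrite Cmod_mul, Cmod_nC. set (x := exp (- (t / INR M))).
  assert (HM1 : 1 <= INR M) by (apply (le_INR 1); lia). assert (Hq1 : 1 <= INR q) by (apply (le_INR 1); lia).
  assert (Hx : exp (- t) <= x). { apply exp_le. assert (t / INR M <= t); [|lra]. apply Rmult_le_reg_r with (INR M). lra. unfold Rdiv; rewrite Rmult_assoc, Rinv_l by lra. nra. }
  pose proof (exp_pos (- t)). set (th := 2 * PI * INR m / INR (M * q)). pose proof PI_RGT_0.
  assert (Hmq : 2 * INR m <= INR M * INR q). { rewrite <- mult_INR. apply le_INR in Hm. rewrite mult_INR in Hm. simpl in Hm. lra. }
  assert (Hth : 0 <= th <= PI).
  { unfold th. rewrite mult_INR. pose proof (pos_INR m). split. apply Rdiv_le_0_compat; nra.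
    apply Rmult_le_reg_r with (INR M * INR q). nra. unfold Rdiv; rewrite Rmult_assoc, Rinv_l by nra. nra. }
  assert (L : x * th / 2 <= Cmod (C1 - RtoC x * er (M * q) m)).
  { apply Rsqr_incr_0_var; [|apply Cmod_nonneg]. rewrite (Rsqr_pow2 (Cmod _)), Cmod_sqr. unfold Rsqr. unfold er. fold th. rewrite Cexp_i, cos_neg, sin_neg.
    replace (Re (C1 - RtoC x * (cos th, - sin th))) with (1 - x * cos th) by (parts).
    replace (Im (C1 - RtoC x * (cos th, - sin th))) with (x * sin th) by (parts).
    pose proof (sin2_cos2 th) as SC. unfold Rsqr in SC.
    replace ((1 - x * cos th) ^ 2 + (x * sin th) ^ 2) with ((1 - x) ^ 2 + 2 * x * (1 - cos th)) by nra.
    assert (Ec : cos th = 1 - 2 * sin (th / 2) * sin (th / 2)) by (rewrite <- cos_2a_sin; f_equal; field). rewrite Ec.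
    pose proof (sin_ge_half (th / 2) ltac:(lra)). 
    assert (x <= 1). { unfold x. rewrite <- exp_0. apply exp_le. assert (0 < t / INR M) by (apply Rdiv_lt_0_compat; lra). lra. }
    assert ((th / 2 / 2) * (th / 2 / 2) <= sin (th / 2) * sin (th / 2)) by nra.
    pose proof (pow2_ge_0 (1 - x)). assert (x * (th / 2 / 2 * (th / 2 / 2)) <= x * (sin (th / 2) * sin (th / 2))) by nra.
    assert (x * x * (th * th) <= x * (th * th)) by nra. nra. }
  apply Rle_trans with (INR M * (x * th / 2)); [|apply Rmult_le_compat_l; lra].
  replace (INR M * (x * th / 2)) with (x * (PI * INR m / INR q)). 2:{ unfold th. rewrite mult_INR. field; lra. }
  replace (exp (- t) / INR q * INR m) with (exp (- t) * (INR m / INR q)) by (field; lra).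
  pose proof (pos_INR m). assert (0 <= INR m / INR q) by (apply Rdiv_le_0_compat; lra).
  replace (PI * INR m / INR q) with (PI * (INR m / INR q)) by (field; lra).
  pose proof PI2_3_2. apply Rmult_le_compat; try lra. nra.
Qed.

Lemma Rpower_mult_base x y c : 0 < x -> 0 < y -> Rpower (x * y) c = Rpower x c * Rpower y c.
Proof. intros. symmetry; apply Rpower_mult_distr; auto. Qed.

(** The index [m] is paired with [2 n - m]. The term at 0 has no partner and the one at [n] would be
    counted twice, so both must vanish. *)
Lemma Csum_fold n f : f 0%nat = C0 -> f n = C0 -> Csum_lt (2 * n) f = Csum_lt n (fun m => f (S m) + f (2 * n - S m)%nat)%cx.
Proof.
  intros H0 Hn. replace (2 * n)%nat with (n + n)%nat by lia. rewrite Csum_add, Csum_plus. f_equal.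
  - pose proof (Csum_S n f) as E. simpl in E. rewrite H0, Hn in E. replace (Csum_lt n f) with (Csum_lt n f + C0)%cx by ring. rewrite E. ring.
  - rewrite Csum_rev. apply Csum_ext. intros k Hk. f_equal. lia.
Qed.

Lemma lip_pt_exp q M m t : q <> 0%nat -> M <> 0%nat ->
  (RtoC (exp (- (t / INR M))) * er (M * q) m = Cexp (- lip_pt q m t / nC M))%cx.
Proof.
  intros Hq HM. unfold er. rewrite <- Cexp_RtoC, <- Cexp_plus. f_equal. unfold Cdiv, nC. rewrite <- RtoC_inv by (apply not_0_INR; auto).
  rewrite mult_INR. apply not_0_INR in Hq, HM. apply Cplx_ext; unfold lip_pt, Cplus, Copp, Cmult, Ci, RtoC, Re, Im; simpl; field; auto.
Qed.

Lemma Re_one_minus_root q M m t : (0 < M)%nat -> 0 < t -> 0 < Re (C1 - RtoC (exp (- (t / INR M))) * er (M * q) m).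
Proof.
  intros HM Ht. rewrite Re_C1_minus. pose proof (Re_le_Cmod (RtoC (exp (- (t / INR M))) * er (M * q) m)) as L.
  rewrite Cmod_mul, Cmod_er, Cmod_RtoC, (Rabs_pos_eq (exp _)) in L by (left; apply exp_pos).
  assert (exp (- (t / INR M)) < 1). { rewrite <- exp_0. apply exp_increasing. assert (0 < t / INR M) by (apply Rdiv_lt_0_compat; auto; apply lt_0_INR; auto). lra. }
  pose proof (Rle_abs (Re (RtoC (exp (- (t / INR M))) * er (M * q) m))). lra.
Qed.

Lemma Cpow_cv (u : nat -> Cplx) l p : 0 < Re l -> Ccv u l -> Ccv (fun n => Cpow (u n) p) (Cpow l p).
Proof.
  intros Hl H e He. destruct (cderiv_cont _ _ _ (cderiv_Cpow l p Hl) e He) as (r & Hr & Hc).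
  destruct (H r Hr) as [K HK]. exists K. intros n Hn. apply Hc. apply HK; auto.
Qed.

Lemma Cconj_cv u l : Ccv u l -> Ccv (fun n => Cconj (u n)) (Cconj l).
Proof.
  intros H e He. destruct (H e He) as [K HK]. exists K. intros n Hn. replace (Cconj (u n) - Cconj l)%cx with (Cconj (u n - l)) by (cplx; ring). rewrite Cmod_Cconj; auto.
Qed.

Lemma Re_RtoC_mul r z : Re (RtoC r * z) = r * Re z.
Proof. parts. Qed.

(** The averages [Av j] are evaluated in two ways: as series in [n], whose coefficients tend to
    those of [phi_term] divided by Gamma, and as folded sums over roots of unity, whose terms tend
    to [lip_term]. Tannery's theorem applies on both sides, on the second because [Re z > 0] makes
    [m^(-1 - Re z)] summable; the limits must agree. *)
Lemma lipschitz_formula q chi z t : is_dirichlet_char q chi -> primitive_char q chi -> (2 <= q)%nat -> 0 < Re z -> 0 < t ->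
  exists Phi, Ssum (phi_term chi z t) Phi /\
    Ssum (lip_term q chi z t) (nC q / (gauss_sum q chi * CGamma (z + C1)) * Phi)%cx.
Proof.
  intros Hc Hp Hq Hz Ht. set (G := gauss_sum q chi). assert (NG : G <> C0) by (apply gauss_neq; auto).
  assert (Nq : nC q <> C0) by (apply nC_neq; lia).
  assert (NGam : CGamma (z + C1) <> C0). { apply CGamma_cv. rewrite Re_plus. unfold C1, RtoC, Re in *; simpl; lra. }
  (* [M] is even so that the number [M q = 2 H] of roots can be folded; the midpoint [H] is a
     multiple of [q], where the character vanishes. *)
  set (M := fun j : nat => (2 * S j)%nat). set (H := fun j : nat => (S j * q)%nat).
  assert (HM : forall j, (M j * q = 2 * H j)%nat) by (intros; unfold M, H; ring).
  assert (HM0 : forall j, M j <> 0%nat) by (intros; unfold M; lia).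
  set (U := fun j m => (nC (M j) * (C1 - RtoC (exp (- (t / INR (M j)))) * er (M j * q) m))%cx).
  set (f := fun j m => (Cconj (chi m) * Cpow (U j m) (- (z + C1)))%cx).
  (* Multiplying [character_average] by [M^(-z)] puts [M] inside the powers as [U j m]; with this
     normalization both the points and the coefficients have limits. *)
  set (Av := fun j => (G / nC q * Csum_lt (M j * q) (f j))%cx).
  assert (HU : forall j m, 0 < Re (U j m)).
  { intros j m. unfold U, nC. rewrite Re_RtoC_mul.
    apply Rmult_lt_0_compat. apply lt_0_INR. specialize (HM0 j); lia. apply Re_one_minus_root; auto. specialize (HM0 j); lia. }
  assert (SA : forall j, Ssum (fun n => Cpow (nC (M j)) (- z) * (chi (S n) * bcoef z (S n * M j) * RtoC (exp (- (INR (S n) * t)))))%cx (Av j)).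
  { intros j. pose proof (character_average q chi (M j) z t Hc Hp Hq (HM0 j) ltac:(lra) Ht) as E. apply (Ssum_scal (Cpow (nC (M j)) (- z))) in E.
    unfold Ssum in *. eapply Ccv_eq; [exact E|]. fold G. unfold Av.
    assert (NM : nC (M j) <> C0) by (apply nC_neq; auto).
    transitivity (G / nC q * (Cpow (nC (M j)) (- (z + C1)) * Csum_lt (M j * q) (fun m => Cconj (chi m) * Cpow (C1 - RtoC (exp (- (t / INR (M j)))) * er (M j * q) m) (- (z + C1)))))%cx.
    - assert (E2 : Cpow (nC (M j)) (- (z + C1)) = (Cpow (nC (M j)) (- z) * / nC (M j))%cx).
      { replace (- (z + C1))%cx with (- z + - C1)%cx by ring. rewrite Cpow_plus, (Cpow_opp _ C1), Cpow_1 by (auto; rewrite Re_nC; apply lt_0_INR; specialize (HM0 j); lia). auto. }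
      rewrite E2. field; auto.
    - f_equal. rewrite <- Csum_scal. apply Csum_ext. intros m _. unfold f, U, nC.
      rewrite Cpow_scale. ring. apply lt_0_INR; specialize (HM0 j); lia. apply Re_one_minus_root; auto. specialize (HM0 j); lia. }
  destruct (bcoef_bound z ltac:(lra)) as (B & HB & Hb). destruct (pow_exp_summable (Re z) t Ht) as [A1 HA1].
  destruct (tannery_series (fun j n => Cpow (nC (M j)) (- z) * (chi (S n) * bcoef z (S n * M j) * RtoC (exp (- (INR (S n) * t)))))%cx
     (fun n => / CGamma (z + C1) * phi_term chi z t n)%cx
     (fun n => B * (Rpower (INR (S n)) (Re z) * exp (- (INR (S n) * t)))) (B * A1) Av) as (l1 & Hl1 & Hv1); auto.
  { intros n.
    apply (Ccv_ext (fun j => (bcoef z (S n * M j) * Cpow (nC (S n * M j)) (- z)) * phi_term chi z t n)%cx _ _ 0%nat).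
    - intros j _. unfold phi_term.
      assert (N1 : nC (S n) <> C0) by (apply nC_neq; lia). assert (NM : nC (M j) <> C0) by (apply nC_neq; auto).
      rewrite nC_mult. unfold nC at 1. rewrite Cpow_scale by (try rewrite Re_nC; apply lt_0_INR; specialize (HM0 j); lia). fold (nC (S n)).
      rewrite (Cpow_opp (nC (S n))) by auto. field. apply Cpow_neq; auto.
    - apply Ccv_mult; [|apply Ccv_const]. apply (Ccv_subseq (fun k => bcoef z k * Cpow (nC k) (- z))%cx _ (fun j => (S n * M j)%nat)).
      intros j. unfold M. nia. apply bcoef_asymptotic; lra. }
  { intros j n. rewrite !Cmod_mul, Cmod_RtoC, (Rabs_pos_eq (exp _)) by (left; apply exp_pos).
    destruct (M j) as [|Mj] eqn:EM. { specialize (HM0 j); lia. }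
    rewrite Cpow_nC_mod. replace (Re (- z)) with (- Re z) by reflexivity.
    replace (S n * S Mj)%nat with (S (Mj + n * S Mj)) by lia.
    pose proof (Hb (Mj + n * S Mj)%nat) as Hb1. replace (S (Mj + n * S Mj)) with (S n * S Mj)%nat in Hb1 at 2 by lia.
    pose proof (INR_S_ge1 n). pose proof (INR_S_ge1 Mj).
    rewrite mult_INR, Rpower_mult_base in Hb1 by lra.
    pose proof (chi_le1 _ _ (S n) Hc). pose proof (Cmod_nonneg (chi (S n))). pose proof (Cmod_nonneg (bcoef z (S (Mj + n * S Mj)))).
    rewrite Rpower_Ropp. set (P := Rpower (INR (S Mj)) (Re z)) in *. assert (0 < P) by apply Rpower_pos. pose proof (exp_pos (- (INR (S n) * t))).
    set (e := exp (- (INR (S n) * t))) in *. set (b := Cmod (bcoef z _)) in *. set (R0 := Rpower (INR (S n)) (Re z)) in *.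
    apply Rle_trans with (/ P * (1 * (B * (R0 * P)) * e)).
    - apply Rmult_le_compat_l. left; apply Rinv_0_lt_compat; auto. apply Rmult_le_compat_r. lra. apply Rmult_le_compat; auto.
    - right. field. lra. }
  { apply Rsummable_scal; auto. }
  (* fold the sum over [m] at [m -> M q - m] *)
  set (kap := exp (- t) / INR q). assert (Hk : 0 < kap) by (apply Rdiv_lt_0_compat; [apply exp_pos | apply lt_0_INR; lia]).
  destruct (zeta_summable (Re z) Hz) as [A2 HA2].
  set (D := Rpower kap (- (1 + Re z)) * exp (Rabs (Im (- (z + C1))) * PI)).
  assert (HD : 0 < D) by (apply Rmult_lt_0_compat; apply exp_pos).
  set (s := chi (q - 1)%nat).
  set (gj := fun j m => (Cconj (chi (S m)) * (Cpow (U j (S m)) (- (z + C1)) + s * Cpow (Cconj (U j (S m))) (- (z + C1))))%cx).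
  destruct (tannery_truncated gj (lip_term q chi z t) (fun m => 2 * D * Rpower (INR (S m)) (- (1 + Re z))) (2 * D * A2) H) as (l2 & Hl2 & Hv2).
  { intros m. unfold gj, lip_term. apply Ccv_scal.
    assert (CU : Ccv (fun j => U j (S m)) (lip_pt q (S m) t)).
    { apply (Ccv_ext (fun j => nC (M j) * (C1 - Cexp (- lip_pt q (S m) t / nC (M j))))%cx _ _ 0%nat).
      intros j _. unfold U. rewrite lip_pt_exp by (auto; lia). auto.
      apply (Ccv_subseq (fun n => nC n * (C1 - Cexp (- lip_pt q (S m) t / nC n)))%cx _ M). intros; unfold M; lia. apply exp_difference_cv. }
    apply Ccv_plus. apply Cpow_cv; auto. apply Ccv_scal. apply Cpow_cv; auto. apply Cconj_cv; auto. }
  { intros j m Hm. unfold gj. rewrite Cmod_mul, Cmod_Cconj.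
    assert (W : forall u, 0 < Re u -> kap * INR (S m) <= Cmod u -> Cmod (Cpow u (- (z + C1))) <= D * Rpower (INR (S m)) (- (1 + Re z))).
    { intros u Hu Lu. pose proof (INR_S_ge1 m). eapply Rle_trans; [apply Cpow_mod_le; auto|].
      replace (Re (- (z + C1))) with (- (1 + Re z)) by (parts).
      unfold D. rewrite (Rmult_comm (Rpower kap _)), Rmult_assoc, <- Rpower_mult_base by lra. rewrite Rmult_comm. apply Rmult_le_compat_l. left; apply exp_pos.
      rewrite !Rpower_Ropp. apply Rinv_le_contravar. apply Rpower_pos. apply Rle_Rpower_l. lra. split; auto. nra. }
    assert (LU : kap * INR (S m) <= Cmod (U j (S m))).
    { apply root_distance_bound; auto; try lia. specialize (HM0 j); lia. rewrite HM. lia. }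
    pose proof (W _ (HU j (S m)) LU) as W1. pose proof (W (Cconj (U j (S m))) (HU j (S m)) ltac:(rewrite Cmod_Cconj; auto)) as W2.
    set (R0 := D * Rpower (INR (S m)) (- (1 + Re z))) in *.
    assert (W3 : Cmod (Cpow (U j (S m)) (- (z + C1)) + s * Cpow (Cconj (U j (S m))) (- (z + C1))) <= 2 * R0).
    { eapply Rle_trans; [apply Cmod_tri|]. rewrite Cmod_mul. pose proof (chi_le1 _ _ (q - 1) Hc). fold s in H0.
      pose proof (Cmod_nonneg s). pose proof (Cmod_nonneg (Cpow (Cconj (U j (S m))) (- (z + C1)))). nra. }
    pose proof (chi_le1 _ _ (S m) Hc). pose proof (Cmod_nonneg (chi (S m))).
    match goal with |- _ * Cmod ?w <= _ => pose proof (Cmod_nonneg w) end.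
    replace (2 * D * Rpower (INR (S m)) (- (1 + Re z))) with (1 * (2 * R0)) by (unfold R0; ring).
    apply Rmult_le_compat; auto. }
  { intros n. pose proof (Rpower_pos (INR (S n)) (- (1 + Re z))). nra. }
  { apply Rsummable_scal; auto. }
  { intros j. unfold H. nia. }
  assert (EA : forall j, Av j = (G / nC q * Csum_lt (H j) (gj j))%cx).
  { intros j. unfold Av. f_equal. rewrite HM, Csum_fold.
    - apply Csum_ext. intros m Hm. unfold f, gj.
      assert (E1 : Cconj (chi (2 * H j - S m)%nat) = (s * Cconj (chi (S m)))%cx).
      { rewrite <- HM, (chi_flip q chi (S m) (M j)), Cconj_mult by (auto; rewrite HM; lia). f_equal. apply chi_minus_one; auto. }
      assert (E2 : U j (2 * H j - S m)%nat = Cconj (U j (S m))).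
      { unfold U. rewrite HM. replace (2 * H j - S m)%nat with (1 * (2 * H j) - S m)%nat by lia. rewrite er_conj_flip by (unfold H in *; nia).
        set (w := er _ _). set (x := exp _). cplx; ring. }
      rewrite E1, E2. ring.
    - unfold f. rewrite (chi_zero _ _ Hc Hq). replace (Cconj C0) with C0 by (cplx; ring). ring.
    - unfold f, H. replace (S j * q)%nat with (0 + S j * q)%nat by lia. rewrite (chi_per _ _ _ _ Hc), (chi_zero _ _ Hc Hq). replace (Cconj C0) with C0 by (cplx; ring). ring. }
  exists (CGamma (z + C1) * l1)%cx. split.
  - apply (Ssum_ext (fun n => CGamma (z + C1) * (/ CGamma (z + C1) * phi_term chi z t n))%cx). intros; field; auto. apply Ssum_scal; auto.
  - assert (E : l1 = (G / nC q * l2)%cx).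
    { apply (Ccv_unique Av); auto. apply (Ccv_ext (fun j => G / nC q * Csum_lt (H j) (gj j))%cx _ _ 0%nat). intros; rewrite EA; auto. apply Ccv_scal; auto. }
    replace (nC q / (G * CGamma (z + C1)) * (CGamma (z + C1) * l1))%cx with l2. exact Hl2. rewrite E. field; auto.
Qed.
(** * The smoothed Dirichlet series *)

Lemma mean_value_real F G a b B : a <= b ->
  (forall t, a <= t <= b -> cderiv F (RtoC t) (G t)) -> (forall t, a <= t <= b -> Cmod (G t) <= B) ->
  Cmod (F (RtoC b) - F (RtoC a)) <= B * (b - a).
Proof.
  intros Hab HF HB. replace (b - a) with (Cmod (RtoC b - RtoC a)).
  2:{ rewrite <- RtoC_minus, Cmod_RtoC, Rabs_pos_eq; lra. }
  assert (S : forall t, seg (RtoC a) (RtoC b) t = RtoC (a + t * (b - a))).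
  { intros t. unfold seg. rewrite RtoC_plus, RtoC_mult, RtoC_minus. auto. }
  apply (mean_value F (fun u => G (Re u))); intros t Ht; rewrite S; change (Re (RtoC (a + t * (b - a)))) with (a + t * (b - a)).
  apply HF. nra. apply HB; nra.
Qed.

(** [Qinc v (n u)] for a complex [u], so that [cderiv] and the mean value inequality apply in the
    variable [u = 1 / N]. *)
Definition QC (v n : nat) (u : Cplx) : Cplx :=
  Csum_lt v (fun w => (nC n * u) ^ w / nC (fact w) * Cexp (- (nC n * u)))%cx.

Lemma QC_real v n t : QC v n (RtoC t) = RtoC (Qinc v (INR n * t)).
Proof.
  unfold QC, Qinc. rewrite Rsum_RtoC. apply Csum_ext. intros w _. unfold nC. rewrite <- RtoC_mult, <- RtoC_opp, Cexp_RtoC, <- RtoC_pow.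
  rewrite <- RtoC_div by apply INR_fact_neq_0. rewrite <- RtoC_mult. auto.
Qed.

(** In the derivative of [exp (- x)] times the truncated exponential series, consecutive terms
    cancel and only the last one is left. *)
Lemma cderiv_QC v n u : cderiv (QC (S v) n) u (- (nC n * ((nC n * u) ^ v / nC (fact v) * Cexp (- (nC n * u))))).
Proof.
  assert (T : forall w, cderiv (fun u => (nC n * u) ^ w / nC (fact w) * Cexp (- (nC n * u)))%cx u
     (nC w * (nC n * u) ^ (w - 1) * nC n / nC (fact w) * Cexp (- (nC n * u)) - nC n * ((nC n * u) ^ w / nC (fact w) * Cexp (- (nC n * u))))%cx).
  { intros w. assert (L : cderiv (fun u => nC n * u)%cx u (nC n * C1)) by (apply cderiv_scal, cderiv_id).
    eapply cderiv_eq. apply cderiv_mult. apply (cderiv_mult (fun u => (nC n * u) ^ w)%cx (fun _ => / nC (fact w))%cx).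
    apply (cderiv_comp (fun x => x ^ w)%cx (fun u => nC n * u)%cx). exact L. apply cderiv_pow. apply cderiv_const.
    apply (cderiv_comp Cexp (fun u => - (nC n * u))%cx). apply cderiv_opp, L. apply cderiv_Cexp. unfold Cdiv. ring. }
  induction v.
  - unfold QC. cbn [Csum_lt]. eapply cderiv_eq. apply cderiv_plus. apply cderiv_const. apply T. simpl. change (nC 0) with C0. unfold Cdiv. ring.
  - eapply cderiv_eq. apply (cderiv_plus (QC (S v) n) (fun u => (nC n * u) ^ (S v) / nC (fact (S v)) * Cexp (- (nC n * u)))%cx). apply IHv. apply T.
    replace (S v - 1)%nat with v by lia. rewrite fact_simpl, nC_mult. simpl Cpown. field. split. apply nC_fact_neq. apply nC_neq; lia.
Qed.

(** At [t = / N] this is convertible to [D_term] at [S n], and [Xval] to [Dfun]. *)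
Definition x_term (chi : nat -> Cplx) (v : nat) (s : Cplx) (t : R) (n : nat) : Cplx :=
  (chi (S n) * Cpow (nC (S n)) (- s) * RtoC (Qinc v (INR (S n) * t)))%cx.

Definition x_partial (chi : nat -> Cplx) (v : nat) (s : Cplx) (K : nat) (u : Cplx) : Cplx :=
  Csum_lt K (fun n => chi (S n) * Cpow (nC (S n)) (- s) * QC v (S n) u)%cx.

Lemma x_partial_real chi v s K t : x_partial chi v s K (RtoC t) = Csum_lt K (x_term chi v s t).
Proof. apply Csum_ext. intros n _. rewrite QC_real. auto. Qed.

Lemma phi_term_power chi s v t n :
  (phi_term chi (nC v - s) t n = chi (S n) * Cpow (nC (S n)) (- s) * (nC (S n) ^ v * RtoC (exp (- (INR (S n) * t)))))%cx.
Proof.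
  unfold phi_term. replace (nC v - s)%cx with (- s + nC v)%cx by ring. rewrite Cpow_plus, Cpow_Cpown by (try apply nC_neq; try rewrite Re_nC; try apply lt_0_INR; lia). ring.
Qed.

(** The order is [S v], so the exponent and factorial [v - 1] of the usual formula appear as [v].
    The derivative brings down [n^(v+1)], which turns [n^(-s)] into the power in [phi_term]. *)
Lemma cderiv_x_partial chi v s K t :
  cderiv (x_partial chi (S v) s K) (RtoC t) (- RtoC (t ^ v / INR (fact v)) * Csum_lt K (phi_term chi (nC (S v) - s) t)).
Proof.
  unfold x_partial. eapply cderiv_eq.
  - apply (cderiv_sum K (fun n u => chi (S n) * Cpow (nC (S n)) (- s) * QC (S v) (S n) u)%cx). intros n _. apply cderiv_scal, cderiv_QC.
  - rewrite <- Csum_scal. apply Csum_ext. intros n _. rewrite phi_term_power.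
    replace (Cexp (- (nC (S n) * RtoC t))) with (RtoC (exp (- (INR (S n) * t)))) by (unfold nC; rewrite <- RtoC_mult, <- RtoC_opp, Cexp_RtoC; auto).
    rewrite RtoC_div, RtoC_pow by apply INR_fact_neq_0. rewrite Cpown_mult_base. fold (nC (fact v)). simpl Cpown. field. apply nC_fact_neq.
Qed.

(** Half of the exponential decay pays for the powers: [m^w / w! = 2^w (m / 2)^w / w! <= 2^w exp (m
    / 2)], and the powers of 2 sum to less than [2^v]. *)
Lemma Qinc_bound v m : 0 <= m -> 0 <= Qinc v m <= 2 ^ v * exp (- (m / 2)).
Proof.
  intros Hm. unfold Qinc. pose proof (exp_pos (- (m / 2))) as E2.
  assert (T : forall w, 0 <= m ^ w / INR (fact w) * exp (- m) <= 2 ^ w * exp (- (m / 2))).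
  { intros w. pose proof (exp_pos (- m)). pose proof (INR_fact_lt_0 w). split.
    - apply Rmult_le_pos; [|lra]. apply Rdiv_le_0_compat; auto. apply pow_le; auto.
    - pose proof (exp_ge_pow w (m / 2) ltac:(lra)) as L. replace (- (m / 2)) with (m / 2 + - m) by field. rewrite exp_plus, <- Rmult_assoc.
      apply Rmult_le_compat_r; [lra|]. replace m with (2 * (m / 2)) at 1 by field. rewrite Rpow_mult_distr. unfold Rdiv at 1. rewrite Rmult_assoc.
      apply Rmult_le_compat_l. apply pow_le; lra. exact L. }
  split. apply Rsum_nonneg. intros; apply T.
  induction v. simpl; lra. cbn [Rsum_lt]. specialize (T v). simpl. assert (0 < 2 ^ v) by (apply pow_lt; lra). nra.
Qed.

Lemma x_term_bound q chi v s t a n : is_dirichlet_char q chi -> 0 < a <= t ->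
  Cmod (x_term chi v s t n) <= 2 ^ v * (Rpower (INR (S n)) (- Re s) * exp (- (INR (S n) * (a / 2)))).
Proof.
  intros Hc Ha. unfold x_term. rewrite !Cmod_mul, Cmod_RtoC, Cpow_nC_mod. replace (Re (- s)) with (- Re s) by reflexivity.
  pose proof (INR_S_ge1 n). destruct (Qinc_bound v (INR (S n) * t)) as [Q0 Q1]; [nra|]. rewrite Rabs_pos_eq by auto.
  assert (Q2 : Qinc v (INR (S n) * t) <= 2 ^ v * exp (- (INR (S n) * (a / 2)))).
  { eapply Rle_trans; [apply Q1|]. apply Rmult_le_compat_l. apply pow_le; lra. apply exp_le. nra. }
  pose proof (chi_le1 _ _ (S n) Hc). pose proof (Cmod_nonneg (chi (S n))). pose proof (Rpower_pos (INR (S n)) (- Re s)).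
  replace (2 ^ v * (Rpower (INR (S n)) (- Re s) * exp (- (INR (S n) * (a / 2))))) with (1 * Rpower (INR (S n)) (- Re s) * (2 ^ v * exp (- (INR (S n) * (a / 2))))) by ring.
  apply Rmult_le_compat; auto. nra. apply Rmult_le_compat; lra.
Qed.

Lemma phi_term_bound q chi z t a n : is_dirichlet_char q chi -> a <= t ->
  Cmod (phi_term chi z t n) <= Rpower (INR (S n)) (Re z) * exp (- (INR (S n) * a)).
Proof.
  intros Hc Ha. unfold phi_term. rewrite !Cmod_mul, Cmod_RtoC, Cpow_nC_mod, (Rabs_pos_eq (exp _)) by (left; apply exp_pos).
  pose proof (INR_S_ge1 n). pose proof (chi_le1 _ _ (S n) Hc). pose proof (Cmod_nonneg (chi (S n))). pose proof (Rpower_pos (INR (S n)) (Re z)).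
  apply Rmult_le_compat. nra. left; apply exp_pos. nra. apply exp_le; nra.
Qed.

Definition Xval (chi : nat -> Cplx) (v : nat) (s : Cplx) (t : R) : Cplx := Clim (fun K => Csum_lt K (x_term chi v s t)).

Lemma Xval_spec q chi v s t : is_dirichlet_char q chi -> 0 < t -> Ssum (x_term chi v s t) (Xval chi v s t).
Proof.
  intros Hc Ht. destruct (pow_exp_summable (- Re s) (t / 2)) as [A HA]; [lra|].
  destruct (dominated_series (x_term chi v s t) (fun n => 2 ^ v * (Rpower (INR (S n)) (- Re s) * exp (- (INR (S n) * (t / 2))))) (2 ^ v * A)) as [l Hl].
  - intros n. apply (x_term_bound q); auto. lra.
  - apply Rsummable_scal; auto.
  - unfold Xval. rewrite (Clim_eq _ l Hl). exact Hl.
Qed.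

Lemma phi_exists q chi z t : is_dirichlet_char q chi -> 0 < t -> exists P, Ssum (phi_term chi z t) P.
Proof.
  intros Hc Ht. destruct (pow_exp_summable (Re z) t Ht) as [A HA].
  apply (dominated_series _ (fun n => Rpower (INR (S n)) (Re z) * exp (- (INR (S n) * t))) A); auto.
  intros n. apply (phi_term_bound q); auto. lra.
Qed.

(** The imaginary part alone gives [|t + 2 PI i m / q| >= m / q]. Hence the majorant does not
    contain [t], the source of all control as [t] tends to 0. *)
Lemma lip_term_bound q chi z t m : is_dirichlet_char q chi -> (2 <= q)%nat -> 0 < Re z -> 0 < t ->
  Cmod (lip_term q chi z t m) <= 2 * (Rpower (INR q) (1 + Re z) * exp (Rabs (Im z) * PI)) * Rpower (INR (S m)) (- (1 + Re z)).
Proof.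
  intros Hc Hq Hz Ht. unfold lip_term. rewrite Cmod_mul, Cmod_Cconj. set (p := lip_pt q (S m) t).
  assert (Hq0 : 0 < INR q) by (apply lt_0_INR; lia). pose proof (INR_S_ge1 m) as Hm. pose proof PI2_3_2.
  assert (Lp : INR (S m) / INR q <= Cmod p).
  { pose proof (Im_le_Cmod p) as H0. set (X := INR (S m) / INR q).
    assert (H1 : 0 < X) by (apply Rdiv_lt_0_compat; lra).
    assert (E : Im p = 2 * PI * X) by (unfold p, lip_pt, X, Im; cbn [snd]; field; lra).
    assert (X <= 2 * PI * X) by (clear - H1 H; nra). rewrite E, Rabs_pos_eq in H0; lra. }
  assert (Lq : 0 < INR (S m) / INR q) by (apply Rdiv_lt_0_compat; lra).
  set (R0 := Rpower (INR q) (1 + Re z) * exp (Rabs (Im z) * PI) * Rpower (INR (S m)) (- (1 + Re z))).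
  assert (W : forall u, 0 < Re u -> INR (S m) / INR q <= Cmod u -> Cmod (Cpow u (- (z + C1))) <= R0).
  { intros u Hu Lu. eapply Rle_trans; [apply Cpow_mod_le; auto|].
    replace (Re (- (z + C1))) with (- (1 + Re z)) by (parts).
    replace (Im (- (z + C1))) with (- Im z) by (parts). rewrite Rabs_Ropp.
    replace R0 with (Rpower (INR (S m) / INR q) (- (1 + Re z)) * exp (Rabs (Im z) * PI)).
    - apply Rmult_le_compat_r. left; apply exp_pos. rewrite !Rpower_Ropp. apply Rinv_le_contravar. apply Rpower_pos. apply Rle_Rpower_l; lra.
    - unfold R0, Rdiv. rewrite Rpower_mult_base by (try apply Rinv_0_lt_compat; lra).
      replace (Rpower (/ INR q) (- (1 + Re z))) with (Rpower (INR q) (1 + Re z)). ring. unfold Rpower. rewrite ln_Rinv by lra. f_equal; ring. }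
  pose proof (W p Ht Lp) as W1. pose proof (W (Cconj p) Ht ltac:(rewrite Cmod_Cconj; auto)) as W2.
  assert (W3 : Cmod (Cpow p (- (z + C1)) + chi (q - 1)%nat * Cpow (Cconj p) (- (z + C1))) <= 2 * R0).
  { eapply Rle_trans; [apply Cmod_tri|]. rewrite Cmod_mul. pose proof (chi_le1 _ _ (q - 1) Hc).
    pose proof (Cmod_nonneg (chi (q - 1)%nat)). pose proof (Cmod_nonneg (Cpow (Cconj p) (- (z + C1)))). nra. }
  pose proof (chi_le1 _ _ (S m) Hc). pose proof (Cmod_nonneg (chi (S m))).
  match goal with |- _ * Cmod ?w <= _ => pose proof (Cmod_nonneg w) end.
  match goal with |- _ <= ?r => replace r with (1 * (2 * R0)) by (unfold R0; ring) end.
  apply Rmult_le_compat; auto.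
Qed.

(** Termwise bounds on [phi_term] blow up as [t] tends to 0. Lipschitz's formula rewrites the sum as
    a constant times a series whose majorant is independent of [t] and uniform in the given range of
    [z]. *)
Lemma phi_uniform_bound q chi x0 R : is_dirichlet_char q chi -> primitive_char q chi -> (2 <= q)%nat -> 0 < x0 ->
  exists C, 0 <= C /\ forall z t P, x0 <= Re z -> Cmod z <= R -> 0 < t -> Ssum (phi_term chi z t) P -> Cmod P <= C.
Proof.
  intros Hc Hp Hq Hx. destruct (CGamma_bound (R + 1)) as [B HB]. destruct (zeta_summable x0 Hx) as [A HA].
  assert (A0 : 0 <= A). { eapply Rle_trans; [|apply (Rsummable_ge _ _ (fun n => Rlt_le _ _ (Rpower_pos _ _)) HA 0)]. simpl; lra. }
  set (D := 2 * (Rpower (INR q) (1 + R) * exp (R * PI))). assert (HD : 0 < D) by (unfold D; pose proof (Rpower_pos (INR q) (1 + R)); pose proof (exp_pos (R * PI)); nra).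
  assert (Hq1 : 1 <= INR q) by (apply (le_INR 1); lia).
  set (G := gauss_sum q chi). assert (NG : G <> C0) by (apply gauss_neq; auto).
  (* [Rmax B 0] because [CGamma_bound] gives no sign for [B]. *)
  exists (Cmod G * Rmax B 0 / INR q * (D * A)). split.
  { apply Rmult_le_pos. apply Rdiv_le_0_compat; [|lra]. apply Rmult_le_pos. apply Cmod_nonneg. apply Rmax_r. nra. }
  intros z t P Hz HR Ht HP.
  assert (H1 : 1 <= Re (z + C1)) by (rewrite Re_plus; unfold C1, RtoC, Re in *; simpl; lra).
  destruct (lipschitz_formula q chi z t Hc Hp Hq ltac:(lra) Ht) as (P' & HP' & HL). rewrite <- (Ssum_unique _ _ _ HP HP') in HL. clear P' HP'. fold G in HL.
  destruct (CGamma_cv _ H1) as [_ NGam]. set (Ga := CGamma (z + C1)) in *. assert (Nq : nC q <> C0) by (apply nC_neq; lia).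
  set (Psi := (nC q / (G * Ga) * P)%cx) in *.
  assert (LP : Cmod Psi <= D * A).
  { apply (dominated_le (lip_term q chi z t) (fun n => D * Rpower (INR (S n)) (- (1 + x0)))); auto. 2: apply Rsummable_scal; auto.
    intros n. eapply Rle_trans; [apply lip_term_bound; auto; lra|]. pose proof (INR_S_ge1 n).
    pose proof (Re_le_Cmod z). pose proof (Im_le_Cmod z). pose proof (Rle_abs (Re z)). pose proof PI_RGT_0.
    pose proof (Rpower_pos (INR q) (1 + Re z)). pose proof (exp_pos (Rabs (Im z) * PI)).
    apply Rmult_le_compat. nra. left; apply Rpower_pos. unfold D. apply Rmult_le_compat_l; [lra|]. apply Rmult_le_compat; try lra. apply Rpower_ge_1_compat; lra. apply exp_le; nra.
    apply Rpower_ge_1_compat; lra. }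
  replace P with (G * Ga / nC q * Psi)%cx by (unfold Psi; field; auto).
  rewrite Cmod_mul, Cmod_Cdiv, Cmod_mul, Cmod_nC by auto. apply Rmult_le_compat; auto; try apply Cmod_nonneg.
  - apply Rdiv_le_0_compat; [|lra]. apply Rmult_le_pos; apply Cmod_nonneg.
  - apply Rmult_le_compat_r. left; apply Rinv_0_lt_compat; lra. apply Rmult_le_compat_l. apply Cmod_nonneg.
    eapply Rle_trans; [|apply Rmax_l]. apply HB; auto. eapply Rle_trans; [apply Cmod_tri|]. rewrite Cmod_C1. lra.
Qed.

Lemma pow_fact_le1 t v : 0 <= t <= 1 -> 0 <= t ^ v / INR (fact v) <= 1.
Proof.
  intros Ht. pose proof (INR_fact_lt_0 v). pose proof (pow_le t v (proj1 Ht)). pose proof (pow_incr t 1 v Ht). rewrite pow1 in H1.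
  assert (1 <= INR (fact v)) by (apply (le_INR 1); pose proof (lt_O_fact v); lia). split. apply Rdiv_le_0_compat; auto.
  apply Rmult_le_reg_r with (INR (fact v)); auto. unfold Rdiv; rewrite Rmult_assoc, Rinv_l by lra. lra.
Qed.

(** The derivative in [t] is [- t^v / v!] times [Phi], at most [C] for [t <= 1]. For partial sums
    the slope is bounded by [C] plus a tail uniform on [[a, b]], and the tail disappears in the
    limit. *)
Lemma Xval_lipschitz q chi v s C : is_dirichlet_char q chi ->
  (forall t P, 0 < t -> Ssum (phi_term chi (nC (S v) - s) t) P -> Cmod P <= C) ->
  forall a b, 0 < a <= b -> b <= 1 -> Cmod (Xval chi (S v) s b - Xval chi (S v) s a) <= C * (b - a).
Proof.
  intros Hc HC a b Hab Hb. set (z := (nC (S v) - s)%cx) in *.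
  destruct (pow_exp_summable (Re z) a) as [A HA]; [lra|]. set (al := fun n => Rpower (INR (S n)) (Re z) * exp (- (INR (S n) * a))) in *.
  assert (al0 : forall n, 0 <= al n) by (intros; unfold al; apply Rmult_le_pos; left; apply exp_pos).
  assert (L : forall K, Cmod (Csum_lt K (x_term chi (S v) s b) - Csum_lt K (x_term chi (S v) s a)) <= (C + (A - Rsum_lt K al)) * (b - a)).
  { intros K. rewrite <- !x_partial_real. apply (mean_value_real _ (fun t => - RtoC (t ^ v / INR (fact v)) * Csum_lt K (phi_term chi z t))%cx). lra.
    - intros t _. apply cderiv_x_partial.
    - intros t Ht. rewrite Cmod_mul, Cmod_neg, Cmod_RtoC. destruct (pow_fact_le1 t v) as [p0 p1]; [lra|]. rewrite Rabs_pos_eq by auto.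
      destruct (phi_exists q chi z t Hc) as [P HP]; [lra|]. pose proof (HC t P ltac:(lra) HP) as B.
      pose proof (dominated_tail (phi_term chi z t) al A P (fun n => phi_term_bound q chi z t a n Hc (proj1 Ht)) HA HP K) as T.
      pose proof (Cmod_rev (Csum_lt K (phi_term chi z t)) P) as T2. rewrite Cmod_sym in T2. pose proof (Cmod_nonneg (Csum_lt K (phi_term chi z t))). nra. }
  assert (CV : Ccv (fun K => Csum_lt K (x_term chi (S v) s b) - Csum_lt K (x_term chi (S v) s a))%cx (Xval chi (S v) s b - Xval chi (S v) s a)%cx).
  { apply Ccv_plus. apply (Xval_spec q); auto; lra. apply (Ccv_ext (fun K => (- C1) * Csum_lt K (x_term chi (S v) s a))%cx _ _ 0%nat). intros; ring.
    eapply Ccv_eq. apply Ccv_scal. apply (Xval_spec q); auto; lra. ring. }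
  set (V := (Xval chi (S v) s b - Xval chi (S v) s a)%cx) in *.
  apply Rnot_lt_le. intros Hlt. destruct (Req_dec a b) as [->|Nab].
  { replace V with C0 in Hlt by (unfold V; ring). rewrite Cmod_C0 in Hlt. lra. }
  (* The tail is chosen to contribute at most half of the supposed excess over [C (b - a)]. *)
  destruct (Rsummable_tail al A HA ((Cmod V - C * (b - a)) / (2 * (b - a)))) as [K0 HK]. { apply Rdiv_lt_0_compat; lra. }
  pose proof (Ccv_le _ _ C0 (C * (b - a) + (Cmod V - C * (b - a)) / 2) K0 CV) as T.
  replace (V - C0)%cx with V in T by ring. assert (Cmod V <= C * (b - a) + (Cmod V - C * (b - a)) / 2); [|lra]. apply T.
  intros K HK'. match goal with |- Cmod (?u - C0) <= _ => replace (u - C0)%cx with u by ring end. eapply Rle_trans; [apply L|]. specialize (HK K HK').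
  rewrite Rmult_plus_distr_r. apply Rplus_le_compat_l.
  apply Rle_trans with ((Cmod V - C * (b - a)) / (2 * (b - a)) * (b - a)). apply Rmult_le_compat_r; lra. right; field; lra.
Qed.
(** * The Taylor remainders *)

(** The remainder of [x^(s - 1)] at [x = m] for the Taylor expansion about [m + a], reached by the
    step [- a]. It is a function of a complex [a] in order to be differentiated in [a]. *)
Definition taylor_rest (s : Cplx) (v m : nat) (a : Cplx) : Cplx :=
  (Cpow (nC m) (s - C1) - Csum_lt v (fun w => gbinom (s - C1) w * Cpow (nC m + a) (s - C1 - nC w) * (- a) ^ w))%cx.

Lemma gbinom_S z w : (nC (S w) * gbinom z (S w) = gbinom z w * (z - nC w))%cx.
Proof. unfold gbinom. cbn [Cprod_lt]. rewrite fact_simpl, nC_mult. field. split. apply nC_fact_neq. apply nC_neq; lia. Qed.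
Lemma gbinom_0 z : gbinom z 0 = C1.
Proof. unfold gbinom. simpl. change (nC 1) with C1. field. apply C1_neq_0. Qed.

(* The derivatives of consecutive Taylor terms telescope. *)
Lemma cderiv_taylor_rest s v m a : 0 < Re (nC m + a) ->
  cderiv (taylor_rest s (S v) m) a
    (- (nC (S v) * gbinom (s - C1) (S v) * (- a) ^ v * Cpow (nC m + a) (s - C1 - nC (S v)))).
Proof.
  intros H. set (z := (s - C1)%cx).
  assert (T : forall w, cderiv (fun a => gbinom z w * Cpow (nC m + a) (z - nC w) * (- a) ^ w)%cx a
     (gbinom z w * ((z - nC w) * Cpow (nC m + a) (z - nC (S w)) * (- a) ^ w - Cpow (nC m + a) (z - nC w) * (nC w * (- a) ^ (w - 1))))%cx).
  { intros w. eapply cderiv_eq. apply cderiv_mult. apply cderiv_scal.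
    apply (cderiv_comp (fun x => Cpow x (z - nC w)) (fun a => nC m + a)%cx). apply cderiv_plus. apply cderiv_const. apply cderiv_id. apply cderiv_Cpow; auto.
    apply (cderiv_comp (fun x => x ^ w)%cx (fun a => - a)%cx). apply cderiv_opp, cderiv_id. apply cderiv_pow.
    cbv beta. replace (z - nC w - C1)%cx with (z - nC (S w))%cx by (rewrite nC_S; ring). ring. }
  assert (T' : forall v, cderiv (taylor_rest s v m) a (- Csum_lt v (fun w => gbinom z w * ((z - nC w) * Cpow (nC m + a) (z - nC (S w)) * (- a) ^ w - Cpow (nC m + a) (z - nC w) * (nC w * (- a) ^ (w - 1)))))%cx).
  { intros u. unfold taylor_rest. fold z. eapply cderiv_eq. apply cderiv_minus. apply cderiv_const.
    apply (cderiv_sum u (fun w a => gbinom z w * Cpow (nC m + a) (z - nC w) * (- a) ^ w)%cx). intros w _; apply T. ring. }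
  eapply cderiv_eq. apply T'. f_equal.
  induction v.
  - cbn [Csum_lt]. rewrite gbinom_S, gbinom_0. simpl. change (nC 0) with C0. ring.
  - change (Csum_lt (S (S v)) ?f) with (Csum_lt (S v) f + f (S v))%cx. cbv beta. rewrite IHv, (gbinom_S z (S v)).
    replace (S v - 1)%nat with v by lia. simpl Cpown. ring.
Qed.

Lemma taylor_rest_0 s v m : m <> 0%nat -> taylor_rest s (S v) m C0 = C0.
Proof.
  intros Hm. unfold taylor_rest. rewrite Csum_S, Csum_zero.
  - rewrite gbinom_0. replace (nC m + C0)%cx with (nC m) by ring. replace (s - C1 - nC 0)%cx with (s - C1)%cx by (change (nC 0) with C0; ring). simpl. ring.
  - intros k _. simpl. ring.
Qed.

Lemma Cpow_shift_bound m y p : Re p <= 0 ->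
  Cmod (Cpow (nC (S m) + Ci * RtoC y) p) <= Rpower (INR (S m)) (Re p) * exp (Rabs (Im p) * PI).
Proof.
  intros Hp. pose proof (INR_S_ge1 m). assert (E : Re (nC (S m) + Ci * RtoC y) = INR (S m)) by (parts).
  eapply Rle_trans; [apply Cpow_mod_le; rewrite E; lra|]. apply Rmult_le_compat_r. left; apply exp_pos.
  replace (Re p) with (- (- Re p)) by ring. rewrite !(Rpower_Ropp _ (- Re p)). apply Rinv_le_contravar. apply Rpower_pos. apply Rle_Rpower_l. lra. split. lra.
  rewrite <- E. eapply Rle_trans; [apply Rle_abs | apply Re_le_Cmod].
Qed.

Definition rest_const (s : Cplx) (v : nat) : R := INR (S v) * Cmod (gbinom (s - C1) (S v)) * exp (Rabs (Im s) * PI).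

Lemma rest_const_nonneg s v : 0 <= rest_const s v.
Proof. unfold rest_const. repeat apply Rmult_le_pos. apply pos_INR. apply Cmod_nonneg. left; apply exp_pos. Qed.

(** The remainder vanishes at [a = 0], and its derivative is a single power. The mean value
    inequality gains both [|y|^(v+1)], which sends the mu-terms to 0 with [t], and a power of [m]
    that is summable for [Re s < v + 1]. *)
Lemma taylor_rest_bound s v m y : Re s < INR (S v) ->
  Cmod (taylor_rest s (S v) (S m) (Ci * RtoC y)) <= rest_const s v * Rabs y ^ S v * Rpower (INR (S m)) (- (1 + (INR (S v) - Re s))).
Proof.
  intros Hs. rewrite <- (Cmod_neg (taylor_rest _ _ _ _)). replace (- taylor_rest s (S v) (S m) (Ci * RtoC y))%cx with (- (taylor_rest s (S v) (S m) (Ci * RtoC y) - taylor_rest s (S v) (S m) C0))%cx by (rewrite taylor_rest_0 by lia; ring).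
  rewrite Cmod_neg. set (p := (s - C1 - nC (S v))%cx).
  assert (Rp : Re p = - (1 + (INR (S v) - Re s))) by (unfold p; rewrite !Re_minus, Re_nC; parts).
  assert (Ip : Im p = Im s) by (unfold p; rewrite !Im_minus; parts).
  assert (Ea : Cmod (Ci * RtoC y - C0) = Rabs y). { replace (Ci * RtoC y - C0)%cx with (Ci * RtoC y)%cx by ring. rewrite Cmod_mul, Cmod_I, Cmod_RtoC; ring. }
  assert (Sg : forall t, seg C0 (Ci * RtoC y) t = (Ci * RtoC (t * y))%cx) by (intros; unfold seg; rewrite RtoC_mult; ring).
  eapply Rle_trans.
  - apply (mean_value (taylor_rest s (S v) (S m)) (fun a => - (nC (S v) * gbinom (s - C1) (S v) * (- a) ^ v * Cpow (nC (S m) + a) p))%cx C0 (Ci * RtoC y)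
       (INR (S v) * Cmod (gbinom (s - C1) (S v)) * Rabs y ^ v * (Rpower (INR (S m)) (Re p) * exp (Rabs (Im p) * PI)))).
    + intros t Ht. apply cderiv_taylor_rest. rewrite Sg. replace (Re _) with (INR (S m)) by (parts). pose proof (INR_S_ge1 m); lra.
    + intros t Ht. rewrite Sg, Cmod_neg, !Cmod_mul, Cmod_nC, Cmod_Cpown, Cmod_neg, Cmod_mul, Cmod_I, Cmod_RtoC, Rmult_1_l.
      apply Rmult_le_compat; try apply Cmod_nonneg. { repeat apply Rmult_le_pos. apply pos_INR. apply Cmod_nonneg. apply pow_le, Rabs_pos. }
      apply Rmult_le_compat_l. { repeat apply Rmult_le_pos. apply pos_INR. apply Cmod_nonneg. }
      apply pow_incr. split. apply Rabs_pos. rewrite Rabs_mult, (Rabs_pos_eq t) by lra. pose proof (Rabs_pos y). nra.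
      apply Cpow_shift_bound. rewrite Rp. lra.
  - rewrite Ea, Rp, Ip. unfold rest_const. right. simpl. ring.
Qed.

Definition rest_term (chi : nat -> Cplx) (s : Cplx) (v : nat) (y : R) (m : nat) : Cplx :=
  (Cconj (chi (S m)) * taylor_rest s v (S m) (Ci * RtoC y))%cx.

Lemma rest_term_bound q chi s v y m : is_dirichlet_char q chi -> Re s < INR (S v) ->
  Cmod (rest_term chi s (S v) y m) <= rest_const s v * Rabs y ^ S v * Rpower (INR (S m)) (- (1 + (INR (S v) - Re s))).
Proof.
  intros Hc Hs. unfold rest_term. rewrite Cmod_mul, Cmod_Cconj. rewrite <- Rmult_1_l. apply Rmult_le_compat; try apply Cmod_nonneg.
  apply (chi_le1 q); auto. apply taylor_rest_bound; auto.
Qed.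

Definition rest_sum (chi : nat -> Cplx) (s : Cplx) (v : nat) (y : R) : Cplx := Clim (fun K => Csum_lt K (rest_term chi s v y)).

Lemma rest_sum_spec q chi s v : is_dirichlet_char q chi -> Re s < INR (S v) ->
  exists A, 0 <= A /\ forall y, Ssum (rest_term chi s (S v) y) (rest_sum chi s (S v) y) /\ Cmod (rest_sum chi s (S v) y) <= A * Rabs y ^ S v
   /\ exists r, Rsummable (fun m => Cmod (rest_term chi s (S v) y m)) r.
Proof.
  intros Hc Hs. destruct (zeta_summable (INR (S v) - Re s)) as [A HA]; [lra|].
  assert (A0 : 0 <= A). { eapply Rle_trans; [|apply (Rsummable_ge _ _ (fun n => Rlt_le _ _ (Rpower_pos _ _)) HA 0)]. simpl; lra. }
  exists (rest_const s v * A). pose proof (rest_const_nonneg s v). split. apply Rmult_le_pos; auto. intros y.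
  pose proof (Rsummable_scal (rest_const s v * Rabs y ^ S v) _ _ HA) as HA'.
  pose proof (fun m => rest_term_bound q chi s v y m Hc Hs) as B.
  destruct (dominated_series _ _ _ B HA') as [l Hl]. unfold rest_sum. rewrite (Clim_eq _ l Hl). split; auto. split.
  - pose proof (dominated_le _ _ _ l B HA' Hl) as L. eapply Rle_trans; [apply L|]. right; ring.
  - apply (dominated_abs _ _ _ B HA').
Qed.

Definition mu_prefactor (q : nat) (chi : nat -> Cplx) (s : Cplx) : Cplx :=
  (Cpow (RtoC (2 * PI)) (s - C1) * CGamma (C1 - s) * Cpow (nC q) (- s) * gauss_sum q chi)%cx.
Definition mu_phase (q : nat) (chi : nat -> Cplx) (mu : Z) (s : Cplx) : Cplx :=
  (chiZ q chi (- mu) * Cexp (Ci * RtoC (IZR mu * PI / 2) * (C1 - s)))%cx.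

Definition w_partial (q : nat) (chi : nat -> Cplx) (s : Cplx) (v K : nat) (u : Cplx) : Cplx :=
  let c := INR q / (2 * PI) in
  (mu_prefactor q chi s *
    (mu_phase q chi 1 s * Csum_lt K (fun m => Cconj (chi (S m)) * taylor_rest s v (S m) (Ci * RtoC c * u))
     + mu_phase q chi (-1) s * Csum_lt K (fun m => Cconj (chi (S m)) * taylor_rest s v (S m) (Ci * RtoC (- c) * u))))%cx.

Lemma w_partial_real q chi s v K t : w_partial q chi s v K (RtoC t) =
  (mu_prefactor q chi s *
    (mu_phase q chi 1 s * Csum_lt K (rest_term chi s v (INR q / (2 * PI) * t))
     + mu_phase q chi (-1) s * Csum_lt K (rest_term chi s v (- (INR q / (2 * PI)) * t))))%cx.
Proof.
  unfold w_partial, rest_term. do 2 f_equal; f_equal; apply Csum_ext; intros m _; rewrite RtoC_mult; do 2 f_equal; ring.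
Qed.

Lemma Cexp_half_pi n : Cexp (Ci * RtoC (PI / 2) * nC n) = (Ci ^ n)%cx.
Proof.
  induction n. simpl. change (nC 0) with C0. replace (Ci * RtoC (PI / 2) * C0)%cx with C0 by ring. apply Cexp_0.
  rewrite nC_S. replace (Ci * RtoC (PI / 2) * (nC n + C1))%cx with (Ci * RtoC (PI / 2) + Ci * RtoC (PI / 2) * nC n)%cx by ring.
  rewrite Cexp_plus, IHn, Cexp_i, cos_PI2, sin_PI2. reflexivity.
Qed.

Lemma Cpown_opp_sign z n : ((- z) ^ n = (- C1) ^ n * z ^ n)%cx.
Proof. rewrite <- Cpown_mult_base. f_equal. ring. Qed.

(** In the derivative of the mu-terms, [(- a)^v] and the inner derivative of [a] leave the power
    [(- i)^(v+1)]. Together with the phase of the term it becomes the phase that [Cpow_lip_pt]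
    produces; [phase_minus] is the counterpart for [mu = -1]. *)
Lemma phase_plus s n : (Cexp (Ci * RtoC (1 * PI / 2) * (C1 - s)) * (- Ci) ^ n = (- C1) ^ n * Cexp (- (Ci * RtoC (PI / 2)) * (s - C1 - nC n)))%cx.
Proof.
  replace (1 * PI / 2) with (PI / 2) by field.
  replace (- (Ci * RtoC (PI / 2)) * (s - C1 - nC n))%cx with (Ci * RtoC (PI / 2) * (C1 - s) + Ci * RtoC (PI / 2) * nC n)%cx by ring.
  rewrite Cexp_plus, Cexp_half_pi, Cpown_opp_sign. ring.
Qed.

Lemma phase_minus s n : (Cexp (Ci * RtoC (-1 * PI / 2) * (C1 - s)) * Ci ^ n = (- C1) ^ n * Cexp (Ci * RtoC (PI / 2) * (s - C1 - nC n)))%cx.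
Proof.
  replace (RtoC (-1 * PI / 2)) with (- RtoC (PI / 2))%cx by (rewrite <- RtoC_opp; f_equal; field).
  replace (Ci * RtoC (PI / 2) * (s - C1 - nC n))%cx with (Ci * - RtoC (PI / 2) * (C1 - s) + - (Ci * RtoC (PI / 2) * nC n))%cx by ring.
  rewrite (Cexp_plus (Ci * - RtoC (PI / 2) * (C1 - s))), Cexp_opp, Cexp_half_pi.
  assert (N : (Ci ^ n)%cx <> C0). { rewrite <- Cexp_half_pi. apply Cexp_neq. }
  assert (E : (Ci ^ n * Ci ^ n = (- C1) ^ n)%cx). { rewrite <- Cpown_mult_base. f_equal. apply Ci_sqr. }
  transitivity (Cexp (Ci * - RtoC (PI / 2) * (C1 - s)) * (Ci ^ n * Ci ^ n) / Ci ^ n)%cx. field; auto. rewrite E. field; auto.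
Qed.

(** The point equals [(2 PI / q) i (m - i y)]. Both [m - i y] and its product with [i] lie in the
    right half-plane, so the principal power splits into three factors; the conjugate point is
    treated with [- i]. *)
Lemma Cpow_lip_pt q m t p : (0 < q)%nat -> 0 < t -> let y := INR q / (2 * PI) * t in
  Cpow (lip_pt q (S m) t) p = (Cpow (RtoC (2 * PI / INR q)) p * (Cexp (Ci * RtoC (PI / 2) * p) * Cpow (nC (S m) + Ci * RtoC (- y)) p))%cx /\
  Cpow (Cconj (lip_pt q (S m) t)) p = (Cpow (RtoC (2 * PI / INR q)) p * (Cexp (- (Ci * RtoC (PI / 2)) * p) * Cpow (nC (S m) + Ci * RtoC y) p))%cx.
Proof.
  intros Hq Ht y. pose proof PI_RGT_0. assert (Hq0 : 0 < INR q) by (apply lt_0_INR; auto). pose proof (INR_S_ge1 m).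
  assert (Hy : 0 < y). { unfold y. apply Rmult_lt_0_compat; auto. apply Rdiv_lt_0_compat; lra. }
  assert (HR : 0 < 2 * PI / INR q) by (apply Rdiv_lt_0_compat; lra).
  set (zm := (nC (S m) + Ci * RtoC (- y))%cx). set (zp := (nC (S m) + Ci * RtoC y)%cx).
  assert (Rm : Re zm = INR (S m)) by (unfold zm, nC, Cplus, Cmult, Ci, RtoC, Re, Im; simpl; ring).
  assert (Rp : Re zp = INR (S m)) by (unfold zp, nC, Cplus, Cmult, Ci, RtoC, Re, Im; simpl; ring).
  assert (Im_m : Im zm = - y) by (unfold zm, nC, Cplus, Cmult, Ci, RtoC, Re, Im; simpl; ring).
  assert (Im_p : Im zp = y) by (unfold zp, nC, Cplus, Cmult, Ci, RtoC, Re, Im; simpl; ring).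
  assert (E1 : lip_pt q (S m) t = (RtoC (2 * PI / INR q) * (Ci * zm))%cx).
  { unfold lip_pt, zm, nC, y. apply Cplx_ext; unfold Cplus, Cmult, Ci, RtoC, Re, Im; cbn [fst snd]; field; lra. }
  assert (E2 : Cconj (lip_pt q (S m) t) = (RtoC (2 * PI / INR q) * (- Ci * zp))%cx).
  { unfold lip_pt, zp, nC, y. apply Cplx_ext; unfold Cconj, Copp, Cplus, Cmult, Ci, RtoC, Re, Im; cbn [fst snd]; field; lra. }
  assert (P1 : 0 < Re (Ci * zm)) by (rewrite Re_Ci_mul, Im_m; lra).
  assert (P2 : 0 < Re (- Ci * zp)). { replace (- Ci * zp)%cx with (- (Ci * zp))%cx by ring. replace (Re (- (Ci * zp))) with (- Re (Ci * zp)) by reflexivity. rewrite Re_Ci_mul, Im_p; lra. }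
  assert (Z1 : zm <> C0) by (apply Re_pos_neq; lra). assert (Z2 : zp <> C0) by (apply Re_pos_neq; lra).
  split.
  - rewrite E1, Cpow_scale by auto. f_equal. rewrite (Cpow_exp (Ci * zm)), Cln_Ci_mul, (Cpow_exp zm), <- Cexp_plus by (auto using Re_pos_neq; lra). f_equal. ring.
  - rewrite E2, Cpow_scale by auto. f_equal. rewrite (Cpow_exp (- Ci * zp)), Cln_mCi_mul, (Cpow_exp zp), <- Cexp_plus by (auto using Re_pos_neq; lra). f_equal. ring.
Qed.

(** The shift of Gamma from [1 - s] to [v + 2 - s] produces a product that agrees with the numerator
    of the binomial coefficient up to the sign [(-1)^(v+1)]. The factor [v + 1] reduces [(v + 1)!]
    to [v!], and the powers of [2 PI] and of [q] regroup. *)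
Lemma prefactor_constant q chi s v : (0 < q)%nat -> (forall j, (C1 - s + nC j)%cx <> C0) -> Re s < INR (S v) ->
  (mu_prefactor q chi s * (nC (S v) * gbinom (s - C1) (S v)) * (- C1) ^ S v * RtoC (INR q / (2 * PI)) ^ S v
   = gauss_sum q chi * CGamma (nC (S v) - s + C1) / (nC q * nC (fact v)) * Cpow (RtoC (2 * PI / INR q)) (s - C1 - nC (S v)))%cx.
Proof.
  intros Hq N Hs. pose proof PI_RGT_0. assert (Hq0 : 0 < INR q) by (apply lt_0_INR; auto).
  destruct (CGamma_shift (S v) (C1 - s)%cx N) as [_ HG].
  { rewrite Re_plus, Re_C1_minus, Re_nC. lra. }
  replace (C1 - s + nC (S v))%cx with (nC (S v) - s + C1)%cx in HG by ring. rewrite <- HG.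
  assert (E1 : ((- C1) ^ S v * Cprod_lt (S v) (fun j => s - C1 - nC j) = Cprod_lt (S v) (fun j => C1 - s + nC j))%cx).
  { generalize (S v). intros k. induction k; simpl. ring. rewrite <- IHk. ring. }
  assert (Nq : nC q <> C0) by (apply nC_neq; lia). assert (Np : RtoC (2 * PI) <> C0) by (apply RtoC_neq; lra).
  assert (E2 : Cpow (RtoC (2 * PI / INR q)) (s - C1 - nC (S v)) = (Cpow (RtoC (2 * PI)) (s - C1) / RtoC (2 * PI) ^ S v * (Cpow (nC q) (- s) * nC q * nC q ^ S v))%cx).
  { rewrite Cpow_exp by (apply RtoC_neq; assert (0 < 2 * PI / INR q) by (apply Rdiv_lt_0_compat; lra); lra).
    rewrite Cln_RtoC by (apply Rdiv_lt_0_compat; lra). rewrite ln_div by lra. rewrite RtoC_minus.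
    transitivity (Cpow (RtoC (2 * PI)) (s - C1 - nC (S v)) * Cpow (nC q) (- (s - C1 - nC (S v))))%cx.
    - rewrite !Cpow_exp by auto. assert (Lq : Cln (nC q) = RtoC (ln (INR q))) by (apply Cln_RtoC; auto).
      rewrite Lq, Cln_RtoC by lra. rewrite <- Cexp_plus. f_equal. ring.
    - replace (- (s - C1 - nC (S v)))%cx with (- s + C1 + nC (S v))%cx by ring. replace (s - C1 - nC (S v))%cx with (s - C1 + - nC (S v))%cx by ring.
      rewrite !Cpow_plus, Cpow_opp, Cpow_1, !Cpow_Cpown by (auto; unfold nC, RtoC, Re; simpl; lra). unfold Cdiv. ring. }
  assert (E3 : RtoC (INR q / (2 * PI)) = (nC q / RtoC (2 * PI))%cx) by (apply RtoC_div; lra).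
  rewrite E2, E3, <- E1. unfold mu_prefactor, gbinom, Cdiv. rewrite Cpown_mult_base.
  assert (E4 : ((/ RtoC (2 * PI)) ^ S v = / RtoC (2 * PI) ^ S v)%cx).
  { assert (NP : forall k, (RtoC (2 * PI) ^ k)%cx <> C0). { intros k E. apply (f_equal Cmod) in E. rewrite Cmod_Cpown, Cmod_C0, Cmod_RtoC in E. pose proof (pow_lt (Rabs (2 * PI)) k ltac:(rewrite Rabs_pos_eq; lra)). lra. }
    generalize (S v). intros k. induction k; simpl. field. apply C1_neq_0. rewrite IHk. field. split; auto. }
  rewrite E4, fact_simpl, nC_mult.
  assert (NP : (RtoC (2 * PI) ^ S v)%cx <> C0). { intros E. apply (f_equal Cmod) in E. rewrite Cmod_Cpown, Cmod_C0, Cmod_RtoC in E. pose proof (pow_lt (Rabs (2 * PI)) (S v) ltac:(rewrite Rabs_pos_eq; lra)). lra. }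
  field. repeat split; auto. apply nC_fact_neq. apply nC_neq; lia.
Qed.

(** The factor [t^v / v!] is that of [cderiv_x_partial] with the opposite sign, and the constant
    inverts the one in [lipschitz_formula]. In the limit the two derivatives therefore cancel. *)
Lemma cderiv_w_partial q chi s v K t : is_dirichlet_char q chi -> (2 <= q)%nat -> (forall j, (C1 - s + nC j)%cx <> C0) -> Re s < INR (S v) -> 0 < t ->
  cderiv (w_partial q chi s (S v) K) (RtoC t)
    (RtoC (t ^ v / INR (fact v)) * (gauss_sum q chi * CGamma (nC (S v) - s + C1) / nC q * Csum_lt K (lip_term q chi (nC (S v) - s) t))).
Proof.
  intros Hc Hq N Hs Ht. assert (Hq' : (0 < q)%nat) by lia. pose proof PI_RGT_0.
  set (c := INR q / (2 * PI)). set (p := (s - C1 - nC (S v))%cx). set (g := (nC (S v) * gbinom (s - C1) (S v))%cx).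
  assert (D : forall k m, cderiv (fun u => Cconj (chi (S m)) * taylor_rest s (S v) (S m) (Ci * RtoC k * u))%cx (RtoC t)
     (Cconj (chi (S m)) * (- (g * (- (Ci * RtoC (k * t))) ^ v * Cpow (nC (S m) + Ci * RtoC (k * t)) p) * (Ci * RtoC k)))%cx).
  { intros k m. apply cderiv_scal. eapply cderiv_eq. apply (cderiv_comp (taylor_rest s (S v) (S m)) (fun u => Ci * RtoC k * u)%cx).
    apply cderiv_scal, cderiv_id. apply cderiv_taylor_rest.
    replace (Re _) with (INR (S m)) by (parts). pose proof (INR_S_ge1 m); lra.
    replace (Ci * RtoC k * RtoC t)%cx with (Ci * RtoC (k * t))%cx by (rewrite RtoC_mult; ring). fold p g. ring. }
  unfold w_partial. fold c. eapply cderiv_eq.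
  - apply cderiv_scal. apply cderiv_plus; apply cderiv_scal; apply (cderiv_sum K (fun m u => Cconj (chi (S m)) * taylor_rest s (S v) (S m) (Ci * RtoC _ * u))%cx); intros m _; apply D.
  - rewrite <- !Csum_scal, <- Csum_plus, <- Csum_scal. apply Csum_ext. intros m _.
    unfold lip_term. replace (- (nC (S v) - s + C1))%cx with p by (unfold p; ring).
    destruct (Cpow_lip_pt q m t p Hq' Ht) as [L1 L2]. fold c in L1, L2. rewrite L1, L2.
    set (A := Cpow (nC (S m) + Ci * RtoC (c * t)) p). replace (- (c * t)) with (- c * t) by ring. set (B := Cpow (nC (S m) + Ci * RtoC (- c * t)) p).
    pose proof (prefactor_constant q chi s v Hq' N Hs) as PC. fold c p g in PC.
    pose proof (phase_plus s (S v)) as PP. pose proof (phase_minus s (S v)) as PM. fold p in PP, PM.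
    unfold mu_phase. rewrite chiZ_neg, chiZ_pos by auto.
    replace (- (Ci * RtoC (c * t)))%cx with (- Ci * (RtoC c * RtoC t))%cx by (rewrite RtoC_mult; ring).
    replace (- (Ci * RtoC (- c * t)))%cx with (Ci * (RtoC c * RtoC t))%cx by (rewrite RtoC_mult, RtoC_opp; ring).
    rewrite RtoC_opp, !Cpown_mult_base, (RtoC_div (t ^ v)), RtoC_pow by apply INR_fact_neq_0. fold (nC (fact v)).
    set (X1 := Cexp (Ci * RtoC (1 * PI / 2) * (C1 - s))) in *. set (X2 := Cexp (Ci * RtoC (-1 * PI / 2) * (C1 - s))) in *.
    set (Y1 := Cexp (- (Ci * RtoC (PI / 2)) * p)) in *. set (Y2 := Cexp (Ci * RtoC (PI / 2) * p)) in *.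
    set (Kp := mu_prefactor q chi s) in *. set (tv := (RtoC t ^ v)%cx). set (ch := chi (q - 1)%nat). set (cj := Cconj (chi (S m))).
    set (Rp := Cpow (RtoC (2 * PI / INR q)) p) in *. set (GG := (gauss_sum q chi * CGamma (nC (S v) - s + C1))%cx) in *.
    pose proof (nC_fact_neq v) as Nf. assert (Nq : nC q <> C0) by (apply nC_neq; lia).
    (* Collect the powers of [i] next to the phases and the rest into one constant, the shapes of
       [PP], [PM] and [PC]. *)
    transitivity (cj * tv * (Kp * g * RtoC c ^ S v) * (ch * (X1 * (- Ci) ^ S v) * A + (X2 * Ci ^ S v) * B))%cx. simpl Cpown; ring.
    rewrite PP, PM.
    transitivity (cj * tv * (Kp * g * (- C1) ^ S v * RtoC c ^ S v) * (ch * Y1 * A + Y2 * B))%cx. ring.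
    rewrite PC. field. auto.
Qed.

Definition Wval (q : nat) (chi : nat -> Cplx) (s : Cplx) (v : nat) (t : R) : Cplx :=
  (mu_prefactor q chi s *
    (mu_phase q chi 1 s * rest_sum chi s v (INR q / (2 * PI) * t)
     + mu_phase q chi (-1) s * rest_sum chi s v (- (INR q / (2 * PI)) * t)))%cx.

(* The derivatives of the two partial sums cancel in the limit, by the Lipschitz formula. *)
Lemma X_plus_W_constant q chi s v a b : is_dirichlet_char q chi -> primitive_char q chi -> (2 <= q)%nat ->
  (forall j, (C1 - s + nC j)%cx <> C0) -> Re s < INR (S v) -> 0 < a <= b ->
  (Xval chi (S v) s b + Wval q chi s (S v) b = Xval chi (S v) s a + Wval q chi s (S v) a)%cx.
Proof.
  intros Hc Hp Hq N Hs Hab. set (z := (nC (S v) - s)%cx).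
  assert (Rz : Re z = INR (S v) - Re s) by (unfold z; rewrite Re_minus, Re_nC; auto).
  assert (Hz : 0 < Re z) by lra.
  set (k := (gauss_sum q chi * CGamma (z + C1) / nC q)%cx).
  assert (NG : gauss_sum q chi <> C0) by (apply gauss_neq; auto). assert (Nq : nC q <> C0) by (apply nC_neq; lia).
  assert (NGam : CGamma (z + C1) <> C0). { apply CGamma_cv. rewrite Re_plus. change (Re C1) with 1. lra. }
  destruct (pow_exp_summable (Re z) a) as [A HA]; [lra|]. set (al := fun n => Rpower (INR (S n)) (Re z) * exp (- (INR (S n) * a))) in *.
  destruct (zeta_summable (Re z) Hz) as [A2 HA2]. set (D := 2 * (Rpower (INR q) (1 + Re z) * exp (Rabs (Im z) * PI))).
  apply (Rsummable_scal D) in HA2. set (be := fun n => D * Rpower (INR (S n)) (- (1 + Re z))) in *. set (A' := D * A2) in *.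
  set (P := fun K u => (x_partial chi (S v) s K u + w_partial q chi s (S v) K u)%cx).
  set (E := b ^ v / INR (fact v)). assert (E0 : 0 <= E) by (apply Rdiv_le_0_compat; [apply pow_le; lra | apply INR_fact_lt_0]).
  (* By Lipschitz's formula the derivative of [P K] is a multiple of a difference of two tails, both
     dominated uniformly on [[a, b]]. *)
  assert (L : forall K, Cmod (P K (RtoC b) - P K (RtoC a)) <= E * ((A - Rsum_lt K al) + Cmod k * (A' - Rsum_lt K be)) * (b - a)).
  { intros K. apply (mean_value_real (P K) (fun t => RtoC (t ^ v / INR (fact v)) * (k * Csum_lt K (lip_term q chi z t) - Csum_lt K (phi_term chi z t)))%cx). lra.
    - intros t Ht. eapply cderiv_eq. apply cderiv_plus. apply cderiv_x_partial. apply cderiv_w_partial; auto; lra. fold z k. ring.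
    - intros t Ht. destruct (lipschitz_formula q chi z t Hc Hp Hq Hz ltac:(lra)) as (Phi & HPhi & HL).
      rewrite Cmod_mul, Cmod_RtoC. apply Rmult_le_compat; try apply Cmod_nonneg. apply Rabs_pos.
      { rewrite Rabs_pos_eq. apply Rmult_le_compat_r. left; apply Rinv_0_lt_compat, INR_fact_lt_0. apply pow_incr; lra. apply Rdiv_le_0_compat; [apply pow_le; lra | apply INR_fact_lt_0]. }
      pose proof (dominated_tail (phi_term chi z t) al A Phi (fun n => phi_term_bound q chi z t a n Hc (proj1 Ht)) HA HPhi K) as T1.
      pose proof (dominated_tail (lip_term q chi z t) be A' _ (fun n => lip_term_bound q chi z t n Hc Hq Hz ltac:(lra)) HA2 HL K) as T2.
      set (Psi := (nC q / (gauss_sum q chi * CGamma (z + C1)) * Phi)%cx) in *. assert (EP : (k * Psi)%cx = Phi) by (unfold k, Psi; field; auto).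
      replace (k * Csum_lt K (lip_term q chi z t) - Csum_lt K (phi_term chi z t))%cx with ((Phi - Csum_lt K (phi_term chi z t)) - k * (Psi - Csum_lt K (lip_term q chi z t)))%cx by (rewrite <- EP; ring).
      eapply Rle_trans; [apply Cmod_minus|]. rewrite (Cmod_mul k). pose proof (Cmod_nonneg k). nra. }
  assert (CV : forall t, 0 < t -> Ccv (fun K => P K (RtoC t)) (Xval chi (S v) s t + Wval q chi s (S v) t)%cx).
  { intros t Ht. destruct (rest_sum_spec q chi s v Hc Hs) as (A0 & _ & HR).
    apply (Ccv_ext (fun K => Csum_lt K (x_term chi (S v) s t) + mu_prefactor q chi s *
      (mu_phase q chi 1 s * Csum_lt K (rest_term chi s (S v) (INR q / (2 * PI) * t)) + mu_phase q chi (-1) s * Csum_lt K (rest_term chi s (S v) (- (INR q / (2 * PI)) * t))))%cx _ _ 0%nat).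
    - intros K _. unfold P. rewrite x_partial_real, w_partial_real. auto.
    - apply Ccv_plus. apply (Xval_spec q); auto. apply Ccv_scal. apply Ccv_plus; apply Ccv_scal; apply HR. }
  apply small_eq. intros e He.
  assert (HE1 : 0 < E * (b - a) + 1) by (assert (0 <= E * (b - a)) by (apply Rmult_le_pos; lra); lra).
  assert (Hk1 : 0 < Cmod k + 1) by (pose proof (Cmod_nonneg k); lra).
  set (eta := e / ((E * (b - a) + 1) * (1 + (Cmod k + 1)))). assert (Heta : 0 < eta) by (apply Rdiv_lt_0_compat; auto; apply Rmult_lt_0_compat; lra).
  destruct (Rsummable_tail al A HA eta Heta) as [K1 HK1]. destruct (Rsummable_tail be A' HA2 eta Heta) as [K2 HK2].
  replace (Xval chi (S v) s b + Wval q chi s (S v) b - (Xval chi (S v) s a + Wval q chi s (S v) a))%cx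
    with ((Xval chi (S v) s b + Wval q chi s (S v) b + (- C1) * (Xval chi (S v) s a + Wval q chi s (S v) a)) - C0)%cx by ring.
  apply (Ccv_le (fun K => P K (RtoC b) + (- C1) * P K (RtoC a))%cx _ _ _ (K1 + K2)).
  - apply Ccv_plus. apply CV; lra. apply Ccv_scal, CV; lra.
  - intros K HK. replace (P K (RtoC b) + - C1 * P K (RtoC a) - C0)%cx with (P K (RtoC b) - P K (RtoC a))%cx by ring.
    eapply Rle_trans; [apply L|]. specialize (HK1 K ltac:(lia)). specialize (HK2 K ltac:(lia)). pose proof (Cmod_nonneg k).
    assert (T : (A - Rsum_lt K al) + Cmod k * (A' - Rsum_lt K be) <= eta * (1 + (Cmod k + 1))) by nra.
    apply Rle_trans with (E * (b - a) * (eta * (1 + (Cmod k + 1)))).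
    + replace (E * ((A - Rsum_lt K al) + Cmod k * (A' - Rsum_lt K be)) * (b - a)) with (E * (b - a) * ((A - Rsum_lt K al) + Cmod k * (A' - Rsum_lt K be))) by ring.
      apply Rmult_le_compat_l; auto. apply Rmult_le_pos; lra.
    + apply Rle_trans with ((E * (b - a) + 1) * (eta * (1 + (Cmod k + 1)))). apply Rmult_le_compat_r. apply Rmult_le_pos; lra. lra.
      right. unfold eta. field. split; lra.
Qed.

(** The sum of the two parts at [t] equals the one at [1 / (j + 1)], where the mu-terms are
    [O(1 / (j + 1))] because the Taylor remainders carry a positive power of [y]. *)
Lemma formula_of_limit q chi s v l t : is_dirichlet_char q chi -> primitive_char q chi -> (2 <= q)%nat ->
  (forall j, (C1 - s + nC j)%cx <> C0) -> Re s < INR (S v) -> 0 < t ->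
  Ccv (fun j => Xval chi (S v) s (/ INR (S j))) l -> l = (Xval chi (S v) s t + Wval q chi s (S v) t)%cx.
Proof.
  intros Hc Hp Hq N Hs Ht Hl. apply (Ccv_unique _ _ _ Hl). set (R0 := (Xval chi (S v) s t + Wval q chi s (S v) t)%cx).
  destruct (rest_sum_spec q chi s v Hc Hs) as (A & HA & HR).
  set (c := INR q / (2 * PI)). assert (Hc0 : 0 <= c). { unfold c. apply Rdiv_le_0_compat. apply pos_INR. pose proof PI_RGT_0; lra. }
  set (D := Cmod (mu_prefactor q chi s) * ((Cmod (mu_phase q chi 1 s) + Cmod (mu_phase q chi (-1) s)) * (A * c ^ S v))).
  destruct (INR_unbounded (/ t)) as [J HJ].
  apply (Ccv_squeeze _ _ (fun j => D * Cmod (/ nC (S j) - C0)) J).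
  - replace 0 with (D * 0) by ring. apply CV_mult; [apply Un_cv_const|].
    apply (Ccv_iff (fun j => / nC (S j))%cx C0). apply (Ccv_subseq (fun n => / nC n)%cx C0 S); [intros; lia | apply inv_nC_cv0].
  - intros j Hj. pose proof (INR_S_ge1 j) as Hj1. set (e := / INR (S j)). assert (He : 0 < e) by (apply Rinv_0_lt_compat; lra).
    assert (He1 : e <= 1) by (unfold e; rewrite <- Rinv_1; apply Rinv_le_contravar; lra).
    assert (Het : e <= t). { unfold e. rewrite <- (Rinv_inv t). apply Rinv_le_contravar. apply Rinv_0_lt_compat; auto. apply le_INR in Hj. rewrite S_INR. lra. }
    unfold R0. rewrite (X_plus_W_constant q chi s v e t) by auto.
    replace (Xval chi (S v) s e - (Xval chi (S v) s e + Wval q chi s (S v) e))%cx with (- Wval q chi s (S v) e)%cx by ring.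
    replace (/ nC (S j) - C0)%cx with (/ nC (S j))%cx by ring. rewrite Cmod_neg, Cmod_Cinv, Cmod_nC by (apply nC_neq; lia). fold e.
    unfold Wval. fold c. rewrite Cmod_mul. unfold D. rewrite Rmult_assoc. apply Rmult_le_compat_l. apply Cmod_nonneg.
    (* Since [e <= 1], a single factor [e] of [e^(v+1)] is kept, which is enough for convergence to
       0. *)
    assert (B : forall y, Rabs y = c * e -> Cmod (rest_sum chi s (S v) y) <= A * c ^ S v * e).
    { intros y Hy. destruct (HR y) as (_ & By & _). rewrite Hy in By. eapply Rle_trans; [apply By|]. rewrite Rpow_mult_distr, Rmult_assoc.
      apply Rmult_le_compat_l; auto. apply Rmult_le_compat_l. apply pow_le; auto. pose proof (pow_incr e 1 v ltac:(lra)) as T. rewrite pow1 in T. simpl. pose proof (pow_le e v ltac:(lra)). nra. }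
    assert (B1 : Cmod (rest_sum chi s (S v) (c * e)) <= A * c ^ S v * e) by (apply B; rewrite Rabs_pos_eq; nra).
    assert (B2 : Cmod (rest_sum chi s (S v) (- c * e)) <= A * c ^ S v * e) by (apply B; rewrite <- Rabs_Ropp, Rabs_pos_eq; nra).
    eapply Rle_trans; [apply Cmod_tri|]. rewrite !Cmod_mul. pose proof (Cmod_nonneg (mu_phase q chi 1 s)). pose proof (Cmod_nonneg (mu_phase q chi (-1) s)).
    rewrite Rmult_assoc, Rmult_plus_distr_r. apply Rplus_le_compat; apply Rmult_le_compat_l; auto.
Qed.
(** * The analytic continuation *)

Lemma phi_bound q chi z : is_dirichlet_char q chi -> primitive_char q chi -> (2 <= q)%nat -> 0 < Re z ->
  exists C, 0 <= C /\ forall t P, 0 < t -> Ssum (phi_term chi z t) P -> Cmod P <= C.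
Proof.
  intros Hc Hp Hq Hz. destruct (phi_uniform_bound q chi (Re z) (Cmod z) Hc Hp Hq Hz) as (C & HC & H).
  exists C. split; auto. intros t P Ht HP. apply (H z t P); auto; lra.
Qed.

Lemma inv_INR_S j : 0 < / INR (S j) <= 1.
Proof. pose proof (INR_S_ge1 j). split. apply Rinv_0_lt_compat; lra. rewrite <- Rinv_1. apply Rinv_le_contravar; lra. Qed.
Lemma inv_INR_S_le m n : (m <= n)%nat -> / INR (S n) <= / INR (S m).
Proof. intros H. pose proof (INR_S_ge1 m). apply Rinv_le_contravar. lra. apply le_INR; lia. Qed.
Lemma inv_INR_S_small e : 0 < e -> exists K, / INR (S K) < e.
Proof.
  intros He. destruct (INR_unbounded (/ e)) as [K HK]. exists K. pose proof (Rinv_0_lt_compat e He).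
  rewrite <- (Rinv_inv e). apply Rinv_lt_contravar. apply Rmult_lt_0_compat; auto. apply lt_0_INR; lia. rewrite S_INR; lra.
Qed.

Lemma Xval_limit q chi v s : is_dirichlet_char q chi -> primitive_char q chi -> (2 <= q)%nat -> Re s < INR (S v) ->
  exists l, Ccv (fun j => Xval chi (S v) s (/ INR (S j))) l.
Proof.
  intros Hc Hp Hq Hs. destruct (phi_bound q chi (nC (S v) - s)%cx Hc Hp Hq) as (C & HC & H). { rewrite Re_minus, Re_nC. lra. }
  assert (L : forall m n, (m <= n)%nat -> Cmod (Xval chi (S v) s (/ INR (S m)) - Xval chi (S v) s (/ INR (S n))) <= C * / INR (S m)).
  { intros m n Hmn. pose proof (inv_INR_S m). pose proof (inv_INR_S n). pose proof (inv_INR_S_le m n Hmn).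
    eapply Rle_trans; [apply (Xval_lipschitz q chi v s C Hc H); lra|]. apply Rmult_le_compat_l; lra. }
  apply Ccauchy_complete. intros e He. destruct (inv_INR_S_small (e / (C + 1))) as [K HK]. { apply Rdiv_lt_0_compat; lra. }
  exists K. assert (W : forall m, (K <= m)%nat -> C * / INR (S m) <= e).
  { intros m Hm. pose proof (inv_INR_S_le K m Hm). pose proof (inv_INR_S m). apply Rle_trans with ((C + 1) * (e / (C + 1))). apply Rmult_le_compat; lra. right; field; lra. }
  intros m n Hm Hn. destruct (le_lt_dec m n).
  - eapply Rle_trans; [apply L; auto|]. auto.
  - rewrite Cmod_sym. eapply Rle_trans; [apply L; lia|]. auto.
Qed.

Lemma x_term_S chi v s t n :
  x_term chi (S v) s t n = (x_term chi v s t n + RtoC (t ^ v / INR (fact v)) * phi_term chi (nC v - s) t n)%cx.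
Proof.
  rewrite phi_term_power. unfold x_term, Qinc. cbn [Rsum_lt]. rewrite RtoC_plus, RtoC_mult, !RtoC_div, !RtoC_pow, RtoC_mult, Cpown_mult_base by apply INR_fact_neq_0.
  fold (nC (S n)). unfold Cdiv. ring.
Qed.

(** Raising the order adds [t^(v+1) / (v+1)!] times a sum of type [Phi], which is bounded. The limit
    as [t] tends to 0 is thus the same for all admissible orders. *)
Lemma Xval_limit_S q chi v s l : is_dirichlet_char q chi -> primitive_char q chi -> (2 <= q)%nat -> Re s < INR (S v) ->
  Ccv (fun j => Xval chi (S v) s (/ INR (S j))) l -> Ccv (fun j => Xval chi (S (S v)) s (/ INR (S j))) l.
Proof.
  intros Hc Hp Hq Hs H. destruct (phi_bound q chi (nC (S v) - s)%cx Hc Hp Hq) as (C & HC & HB). { rewrite Re_minus, Re_nC. lra. }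
  set (df := fun j => (Xval chi (S (S v)) s (/ INR (S j)) + (- C1) * Xval chi (S v) s (/ INR (S j)))%cx).
  apply (Ccv_ext (fun j => df j + Xval chi (S v) s (/ INR (S j)))%cx _ _ 0%nat). intros; unfold df; ring.
  eapply Ccv_eq with (l := (C0 + l)%cx); [|ring]. apply Ccv_plus; auto.
  apply (Ccv_squeeze _ _ (fun j => C * Cmod (/ nC (S j) - C0)) 0).
  - replace 0 with (C * 0) by ring. apply CV_mult; [apply Un_cv_const|].
    apply (Ccv_iff (fun j => / nC (S j))%cx C0). apply (Ccv_subseq (fun n => / nC n)%cx C0 S); [intros; lia | apply inv_nC_cv0].
  - intros j _. replace (/ nC (S j) - C0)%cx with (/ nC (S j))%cx by ring. rewrite Cmod_Cinv, Cmod_nC by (apply nC_neq; lia).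
    destruct (inv_INR_S j) as [t0 t1]. set (t := / INR (S j)) in *.
    destruct (phi_exists q chi (nC (S v) - s)%cx t Hc t0) as [P HP].
    assert (E : df j = (RtoC (t ^ S v / INR (fact (S v))) * P)%cx).
    { unfold df. fold t. apply (Ssum_unique (fun n => RtoC (t ^ S v / INR (fact (S v))) * phi_term chi (nC (S v) - s) t n)%cx); [|apply Ssum_scal; auto].
      apply (Ssum_ext (fun n => x_term chi (S (S v)) s t n + (- C1) * x_term chi (S v) s t n)%cx). intros n. rewrite (x_term_S chi (S v)). ring.
      apply Ssum_plus. apply (Xval_spec q); auto. apply Ssum_scal, (Xval_spec q); auto. }
    replace (df j - C0)%cx with (df j) by ring. rewrite E, Cmod_mul, Cmod_RtoC.
    pose proof (HB t P t0 HP). destruct (pow_fact_le1 t v ltac:(lra)) as [p0 p1].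
    assert (0 <= t ^ S v / INR (fact (S v)) <= t).
    { pose proof (INR_fact_lt_0 (S v)). pose proof (pow_le t (S v) ltac:(lra)). split. apply Rdiv_le_0_compat; auto.
      assert (1 <= INR (fact (S v))) by (apply (le_INR 1); pose proof (lt_O_fact (S v)); lia).
      assert (t ^ S v <= t). { pose proof (pow_incr t 1 v ltac:(lra)). rewrite pow1 in *. simpl. pose proof (pow_le t v ltac:(lra)). nra. }
      apply Rmult_le_reg_r with (INR (fact (S v))); auto. unfold Rdiv; rewrite Rmult_assoc, Rinv_l by lra. nra. }
    rewrite Rabs_pos_eq by lra. rewrite Rmult_comm. apply Rmult_le_compat; try lra. apply Cmod_nonneg.
Qed.

Definition order_above (x : R) : nat := Z.to_nat (up x).
Lemma order_above_spec x : x < INR (S (order_above x)).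
Proof.
  unfold order_above. destruct (archimed x) as [H _]. rewrite S_INR. destruct (Z_lt_le_dec (up x) 0) as [L|L].
  - apply IZR_lt in L. pose proof (pos_INR (Z.to_nat (up x))). lra.
  - rewrite INR_IZR_INZ, Z2Nat.id by auto. lra.
Qed.

(** The order must exceed [Re s], so no single one serves the whole plane and the one used here
    jumps with [s]. [Lval_spec] replaces it by any admissible order, which can then be fixed near a
    given point. *)
Definition Lval (chi : nat -> Cplx) (s : Cplx) : Cplx := Clim (fun j => Xval chi (S (order_above (Re s))) s (/ INR (S j))).

Lemma Lval_spec q chi v s : is_dirichlet_char q chi -> primitive_char q chi -> (2 <= q)%nat -> Re s < INR (S v) ->
  Ccv (fun j => Xval chi (S v) s (/ INR (S j))) (Lval chi s).
Proof.
  intros Hc Hp Hq Hs.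
  assert (Up : forall k u l, Re s < INR (S u) -> Ccv (fun j => Xval chi (S u) s (/ INR (S j))) l -> Ccv (fun j => Xval chi (S (u + k)) s (/ INR (S j))) l).
  { induction k; intros u l Hu Hl. rewrite Nat.add_0_r; auto. rewrite Nat.add_succ_r. apply (Xval_limit_S q); auto.
    apply Rlt_le_trans with (1 := Hu). apply le_INR; lia. }
  pose proof (order_above_spec (Re s)) as Ho. set (u := order_above (Re s)) in *.
  destruct (Xval_limit q chi u s Hc Hp Hq Ho) as [l Hl]. destruct (Xval_limit q chi v s Hc Hp Hq Hs) as [l' Hl'].
  unfold Lval. fold u. rewrite (Clim_eq _ l Hl). replace l with l'; auto.
  pose proof (Up v u l Ho Hl) as A. pose proof (Up u v l' Hs Hl') as B. rewrite Nat.add_comm in B. apply (Ccv_unique _ _ _ B A).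
Qed.

(** Dirichlet polynomials are differentiable everywhere, with derivatives of the same form: the
    shape of data that [limit_differentiable] asks for. *)
Definition dpoly (a : nat -> Cplx) (K : nat) (s : Cplx) : Cplx := Csum_lt K (fun n => a n * Cpow (nC (S n)) (- s))%cx.

Lemma cderiv_dpoly a K s : cderiv (dpoly a K) s (dpoly (fun n => - Cln (nC (S n)) * a n)%cx K s).
Proof.
  apply (cderiv_sum K (fun n s => a n * Cpow (nC (S n)) (- s))%cx). intros n _. eapply cderiv_eq. apply cderiv_scal.
  apply (cderiv_comp (fun z => Cpow (nC (S n)) z) (fun s => - s)%cx). apply cderiv_opp, cderiv_id. apply cderiv_Cpow_exponent. apply nC_neq; lia. ring.
Qed.

Definition x_coef (chi : nat -> Cplx) (v : nat) (t : R) (n : nat) : Cplx := (chi (S n) * RtoC (Qinc v (INR (S n) * t)))%cx.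
Lemma dpoly_x_term chi v t K s : dpoly (x_coef chi v t) K s = Csum_lt K (x_term chi v s t).
Proof. apply Csum_ext. intros n _. unfold x_coef, x_term. ring. Qed.

Lemma Re_ball s w r : Cmod (s - w) <= r -> Re w - r <= Re s <= Re w + r.
Proof.
  intros H. pose proof (Re_le_Cmod (s - w)) as R0. rewrite Re_minus in R0. pose proof (Rle_abs (Re s - Re w)). pose proof (Rle_abs (- (Re s - Re w))). rewrite Rabs_Ropp in H1. lra.
Qed.

Lemma x_term_ball_bound q chi v w t : is_dirichlet_char q chi -> 0 < t ->
  exists A al, Rsummable al A /\ forall s n, Cmod (s - w) <= 3 -> Cmod (x_term chi v s t n) <= al n.
Proof.
  intros Hc Ht. destruct (pow_exp_summable (3 - Re w) (t / 2)) as [A HA]; [lra|].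
  exists (2 ^ v * A), (fun n => 2 ^ v * (Rpower (INR (S n)) (3 - Re w) * exp (- (INR (S n) * (t / 2))))). split. apply Rsummable_scal; auto.
  intros s n Hs. eapply Rle_trans; [apply (x_term_bound q chi v s t t); auto; lra|]. apply Rmult_le_compat_l. apply pow_le; lra.
  apply Rmult_le_compat_r. left; apply exp_pos. apply Rpower_ge_1_compat. apply INR_S_ge1. pose proof (Re_ball s w 3 Hs). lra.
Qed.

Lemma Xval_differentiable q chi v t : is_dirichlet_char q chi -> 0 < t -> differentiable (fun s => Xval chi v s t).
Proof.
  intros Hc Ht w. destruct (x_term_ball_bound q chi v w t Hc Ht) as (A & al & HA & HB).
  assert (al0 : forall n, 0 <= al n). { intros n. eapply Rle_trans; [apply Cmod_nonneg|]. apply (HB w n). replace (w - w)%cx with C0 by ring. rewrite Cmod_C0; lra. }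
  apply (limit_differentiable (dpoly (x_coef chi v t)) (dpoly (fun n => - Cln (nC (S n)) * x_coef chi v t n)%cx) _ w A).
  - intros; apply cderiv_dpoly.
  - intros K z. eexists; apply cderiv_dpoly.
  - intros K z Hz. rewrite dpoly_x_term. eapply Rle_trans; [apply Csum_mod_le|]. eapply Rle_trans; [apply Rsum_le|]. intros k _; apply HB; auto. apply Rsummable_ge; auto.
  - intros z Hz. apply (Ccv_ext (fun K => Csum_lt K (x_term chi v z t)) _ _ 0%nat). intros; rewrite dpoly_x_term; auto. apply (Xval_spec q); auto.
Qed.

(** To obtain Dirichlet polynomials, [Xval] at [t = 1 / (j + 1)] is truncated where its tail is at
    most [t] on the whole ball of radius 3. They are bounded there because the series at [t = 1] is
    dominated and the Lipschitz estimate carries this bound down to small [t]. *)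
Lemma Lval_differentiable q chi : is_dirichlet_char q chi -> primitive_char q chi -> (2 <= q)%nat -> differentiable (Lval chi).
Proof.
  (* The margin 4 leaves [Re (nC (S v) - s) >= 1] on the ball of radius 3, where [phi_uniform_bound]
     is applied. *)
  intros Hc Hp Hq w. set (v := order_above (Re w + 4)). pose proof (order_above_spec (Re w + 4)) as Hv. fold v in Hv.
  destruct (phi_uniform_bound q chi 1 (Cmod (nC (S v) - w) + 3) Hc Hp Hq ltac:(lra)) as (C & HC & HB).
  assert (HB' : forall s, Cmod (s - w) <= 3 -> forall t P, 0 < t -> Ssum (phi_term chi (nC (S v) - s) t) P -> Cmod P <= C).
  { intros s Hs t P Ht HP. apply (HB (nC (S v) - s)%cx t P); auto.
    - rewrite Re_minus, Re_nC. pose proof (Re_ball s w 3 Hs). lra.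
    - replace (nC (S v) - s)%cx with ((nC (S v) - w) - (s - w))%cx by ring. eapply Rle_trans; [apply Cmod_minus|]. lra. }
  destruct (x_term_ball_bound q chi (S v) w 1 Hc ltac:(lra)) as (A1 & al1 & HA1 & HX1).
  assert (BX : forall j s, Cmod (s - w) <= 3 -> Cmod (Xval chi (S v) s (/ INR (S j))) <= A1 + C).
  { intros j s Hs. pose proof (inv_INR_S j).
    pose proof (Xval_lipschitz q chi v s C Hc (HB' s Hs) (/ INR (S j)) 1 ltac:(lra) ltac:(lra)) as L.
    pose proof (dominated_le _ al1 A1 _ (fun n => HX1 s n Hs) HA1 (Xval_spec q chi (S v) s 1 Hc ltac:(lra))) as L1.
    pose proof (Cmod_rev (Xval chi (S v) s (/ INR (S j))) (Xval chi (S v) s 1)) as T. rewrite Cmod_sym in T.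
    assert (C * (1 - / INR (S j)) <= C) by nra. lra. }
  assert (CH : forall j, exists K, forall s, Cmod (s - w) <= 3 -> Cmod (Xval chi (S v) s (/ INR (S j)) - Csum_lt K (x_term chi (S v) s (/ INR (S j)))) <= / INR (S j)).
  { intros j. pose proof (inv_INR_S j) as Hj. destruct (x_term_ball_bound q chi (S v) w (/ INR (S j)) Hc ltac:(lra)) as (A & al & HA & HX).
    destruct (Rsummable_tail al A HA (/ INR (S j)) ltac:(lra)) as [K HK]. exists K. intros s Hs. specialize (HK K (le_n K)).
    eapply Rle_trans; [apply (dominated_tail _ al A _ (fun n => HX s n Hs) HA (Xval_spec q chi (S v) s _ Hc (proj1 Hj)))|]. lra. }
  destruct (choice _ CH) as [K HK].
  apply (limit_differentiable (fun j => dpoly (x_coef chi (S v) (/ INR (S j))) (K j)) (fun j => dpoly (fun n => - Cln (nC (S n)) * x_coef chi (S v) (/ INR (S j)) n)%cx (K j)) _ w (A1 + C + 1)).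
  - intros; apply cderiv_dpoly.
  - intros j z. eexists; apply cderiv_dpoly.
  - intros j z Hz. rewrite dpoly_x_term. specialize (HK j z Hz). specialize (BX j z Hz). pose proof (inv_INR_S j).
    pose proof (Cmod_rev (Csum_lt (K j) (x_term chi (S v) z (/ INR (S j)))) (Xval chi (S v) z (/ INR (S j)))) as T. rewrite Cmod_sym in T. lra.
  - intros z Hz. assert (Hz3 : Cmod (z - w) <= 3) by lra.
    assert (HL : Ccv (fun j => Xval chi (S v) z (/ INR (S j))) (Lval chi z)). { apply (Lval_spec q); auto. pose proof (Re_ball z w 3 Hz3). lra. }
    apply (Ccv_squeeze _ _ (fun j => Cmod (/ nC (S j) - C0) + Cmod (Xval chi (S v) z (/ INR (S j)) - Lval chi z)) 0).
    + replace 0 with (0 + 0) by ring. apply CV_plus; [|apply Ccv_iff; auto].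
      apply (Ccv_iff (fun j => / nC (S j))%cx C0). apply (Ccv_subseq (fun n => / nC n)%cx C0 S); [intros; lia | apply inv_nC_cv0].
    + intros j _. rewrite dpoly_x_term. replace (/ nC (S j) - C0)%cx with (/ nC (S j))%cx by ring. rewrite Cmod_Cinv, Cmod_nC by (apply nC_neq; lia).
      specialize (HK j z Hz3). rewrite Cmod_sym in HK.
      pose proof (Cmod_tri3 (Csum_lt (K j) (x_term chi (S v) z (/ INR (S j)))) (Xval chi (S v) z (/ INR (S j))) (Lval chi z)). lra.
Qed.

Lemma QC_at_0 v n : QC (S v) n C0 = C1.
Proof.
  unfold QC. rewrite Csum_S, Csum_zero.
  - replace (- (nC n * C0))%cx with C0 by ring. rewrite Cexp_0. simpl. change (nC 1) with C1. field. apply C1_neq_0.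
  - intros k _. replace (nC n * C0)%cx with C0 by ring. simpl. unfold Cdiv. ring.
Qed.

(** As [t] tends to 0 the smoothing factor tends to its value 1 at the origin, and for [Re s > 1] it
    stays bounded by [2^(v+1)], so Tannery's theorem applies. *)
Lemma Lval_dirichlet_series q chi s : is_dirichlet_char q chi -> primitive_char q chi -> (2 <= q)%nat -> 1 < Re s ->
  Ssum (fun n => chi (S n) * Cpow (nC (S n)) (- s))%cx (Lval chi s).
Proof.
  intros Hc Hp Hq Hs. set (v := order_above (Re s)). pose proof (order_above_spec (Re s)) as Hv. fold v in Hv.
  pose proof (Lval_spec q chi v s Hc Hp Hq Hv) as HL.
  destruct (zeta_summable (Re s - 1)) as [A HA]; [lra|]. apply (Rsummable_scal (2 ^ S v)) in HA.
  destruct (tannery_series (fun j n => x_term chi (S v) s (/ INR (S j)) n) (fun n => chi (S n) * Cpow (nC (S n)) (- s))%cx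
     (fun n => 2 ^ S v * Rpower (INR (S n)) (- (1 + (Re s - 1)))) (2 ^ S v * A) (fun j => Xval chi (S v) s (/ INR (S j)))) as (l & H1 & H2); auto.
  - intros n. unfold x_term. eapply Ccv_eq with (l := (chi (S n) * Cpow (nC (S n)) (- s) * C1)%cx); [|ring]. apply Ccv_scal.
    rewrite <- (QC_at_0 v (S n)). apply (Ccv_ext (fun j => QC (S v) (S n) (/ nC (S j))%cx) _ _ 0%nat).
    { intros j _. rewrite <- QC_real. f_equal. symmetry. apply RtoC_inv. pose proof (INR_S_ge1 j); lra. }
    intros e He. destruct (cderiv_cont _ _ _ (cderiv_QC v (S n) C0) e He) as (r & Hr & HD).
    destruct (Ccv_subseq (fun n => / nC n)%cx C0 S ltac:(intros; lia) inv_nC_cv0 r Hr) as [K HK]. exists K. intros j Hj. apply HD. apply HK; auto.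
  - intros j n. destruct (inv_INR_S j). eapply Rle_trans; [apply (x_term_bound q chi (S v) s _ (/ INR (S j))); auto; lra|].
    apply Rmult_le_compat_l. apply pow_le; lra. replace (- (1 + (Re s - 1))) with (- Re s) by ring. pose proof (Rpower_pos (INR (S n)) (- Re s)).
    assert (exp (- (INR (S n) * (/ INR (S j) / 2))) <= 1). { rewrite <- exp_0. apply exp_le. pose proof (INR_S_ge1 n). nra. } nra.
  - intros j. apply (Xval_spec q); auto. apply inv_INR_S.
  - rewrite (Ccv_unique _ _ _ HL H2). exact H1.
Qed.

(** [Lval] witnesses that the predicate under [epsilon] can be satisfied, so the chosen function
    satisfies it too. Their difference is entire and zero for [Re z > 1]. *)
Lemma Lfun_eq q chi s : is_dirichlet_char q chi -> primitive_char q chi -> (2 <= q)%nat -> Lfun chi s = Lval chi s.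
Proof.
  intros Hc Hp Hq. unfold Lfun.
  match goal with |- epsilon ?i ?P s = _ => pose proof (epsilon_spec i P) as E; set (F := epsilon i P) in * end.
  destruct E as [E1 E2].
  { exists (Lval chi). split. intros z. destruct (Lval_differentiable q chi Hc Hp Hq z) as [d Hd]. apply (cderiv_Cdifferentiable _ _ d Hd).
    intros z Hz. apply (Lval_dirichlet_series q); auto. }
  assert (Z : (F s - Lval chi s)%cx = C0).
  { apply (identity_halfplane (fun z => F z - Lval chi z)%cx 1).
    - intros z. destruct (Cdifferentiable_cderiv F z (E1 z)) as [d Hd]. destruct (Lval_differentiable q chi Hc Hp Hq z) as [d' Hd'].
      exists (d - d')%cx. apply cderiv_minus; auto.
    - intros z Hz. rewrite (Ssum_unique _ _ _ (E2 z Hz) (Lval_dirichlet_series q chi z Hc Hp Hq Hz)). ring. }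
  replace (F s) with (F s - Lval chi s + Lval chi s)%cx by ring. rewrite Z. ring.
Qed.

(** * The formula and its limit at the integers *)

Lemma E_term_rest q chi v N mu s m : 0 < N ->
  E_term q chi v N mu s (S m) = rest_term chi s v (IZR mu * (INR q / (2 * PI)) * / N) m.
Proof.
  intros HN. unfold rest_term, taylor_rest. replace (IZR mu * (INR q / (2 * PI)) * / N) with (IZR mu * INR q / (2 * PI * N)). reflexivity.
  pose proof PI_RGT_0. field. lra.
Qed.

Lemma mu_terms_Wval q chi v N s : 0 < N -> mu_terms q chi v N s = Wval q chi s v (/ N).
Proof.
  intros HN. unfold mu_terms, mu_summand, Wval, mu_prefactor, mu_phase.
  assert (E : forall mu y, y = IZR mu * (INR q / (2 * PI)) * / N -> Efun q chi v N mu s = rest_sum chi s v y).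
  { intros mu y ->. unfold Efun, Cseries, rest_sum. f_equal. apply functional_extensionality. intros K. apply Csum_ext. intros m _. apply E_term_rest; auto. }
  rewrite (E 1%Z (INR q / (2 * PI) * / N)), (E (-1)%Z (- (INR q / (2 * PI)) * / N)) by (simpl; ring). reflexivity.
Qed.

Lemma Re_eq_nC s j : (C1 - s + nC j)%cx = C0 -> s = nC (S j).
Proof. intros H. rewrite nC_S. replace s with (C1 + nC j - (C1 - s + nC j))%cx by ring. rewrite H. ring. Qed.

Lemma functional_formula q chi v N s : is_dirichlet_char q chi -> primitive_char q chi -> (2 <= q)%nat -> (1 <= v)%nat -> 0 < N -> Re s < INR v ->
  (forall k, (1 <= k < v)%nat -> s <> nC k) -> Lfun chi s = (Dfun chi v N s + mu_terms q chi v N s)%cx.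
Proof.
  intros Hc Hp Hq Hv HN Hs Hk. destruct v as [|v]; [lia|]. rewrite (Lfun_eq q), mu_terms_Wval by auto.
  apply (formula_of_limit q chi s v); auto.
  (* A pole of [Gamma(1 - s)] means [s = j + 1], and [Re s < v] places it among the excluded
     integers. *)
  - intros j E. apply Re_eq_nC in E. apply (Hk (S j)); auto. rewrite E, Re_nC in Hs. apply INR_lt in Hs. lia.
  - apply Rinv_0_lt_compat; auto.
  - apply (Lval_spec q); auto.
Qed.

Lemma D_abs_conv q chi v N s : is_dirichlet_char q chi -> 0 < N -> Cabs_conv (D_term chi v N s).
Proof.
  intros Hc HN. assert (Ht : 0 < / N) by (apply Rinv_0_lt_compat; auto).
  destruct (x_term_ball_bound q chi v s (/ N) Hc Ht) as (A & al & HA & HB).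
  apply (dominated_abs (x_term chi v s (/ N)) al A); auto. intros n. apply HB. replace (s - s)%cx with C0 by ring. rewrite Cmod_C0; lra.
Qed.

Lemma E_abs_conv q chi v N mu s : is_dirichlet_char q chi -> (1 <= v)%nat -> 0 < N -> Re s < INR v -> Cabs_conv (E_term q chi v N mu s).
Proof.
  intros Hc Hv HN Hs. destruct v as [|v]; [lia|]. destruct (rest_sum_spec q chi s v Hc Hs) as (A & _ & H).
  destruct (H (IZR mu * (INR q / (2 * PI)) * / N)) as (_ & _ & r & Hr). exists r.
  replace (fun n => Cmod (E_term q chi (S v) N mu s (S n))) with (fun m => Cmod (rest_term chi s (S v) (IZR mu * (INR q / (2 * PI)) * / N) m)). exact Hr.
  apply functional_extensionality. intros m. rewrite E_term_rest; auto.
Qed.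

Lemma Re_close_nC j k : Cmod (nC j - nC k) < 1 -> j = k.
Proof.
  intros H. pose proof (Re_le_Cmod (nC j - nC k)) as L. rewrite Re_minus, !Re_nC in L.
  assert (A : Rabs (INR j - INR k) < 1) by lra. apply Rabs_def2 in A.
  destruct (lt_eq_lt_dec j k) as [[C|C]|C]; auto; exfalso; apply (le_INR (S _)) in C; rewrite S_INR in C; lra.
Qed.

Theorem theorem3 :
  forall (q : nat) (chi : nat -> Cplx) (v : nat) (N sigma0 : R),
    is_dirichlet_char q chi -> nonprincipal q chi -> primitive_char q chi ->
    (1 <= v)%nat -> 0 < N -> sigma0 < INR v ->
    (forall s : Cplx,
        Re s <= sigma0 ->
        (forall k : nat, (1 <= k < v)%nat -> s <> nC k) ->
        Cabs_conv (D_term chi v N s) /\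
        Cabs_conv (E_term q chi v N 1 s) /\
        Cabs_conv (E_term q chi v N (-1) s) /\
        Lfun chi s = Cplus (Dfun chi v N s) (mu_terms q chi v N s))
    /\
    (forall k : nat,
        (1 <= k < v)%nat -> INR k <= sigma0 ->
        Cabs_conv (D_term chi v N (nC k)) /\
        Clim_at (fun s => Re s <= sigma0) (mu_terms q chi v N) (nC k)
                (Cminus (Lfun chi (nC k)) (Dfun chi v N (nC k)))).
Proof.
  intros q chi v N sigma0 Hc Hn Hp Hv HN Hs0. pose proof (q_ge2 q chi Hc Hn) as Hq. split.
  - intros s Hs Hk. split; [apply (D_abs_conv q); auto|]. split; [apply E_abs_conv; auto; lra|]. split; [apply E_abs_conv; auto; lra|].
    apply functional_formula; auto. lra.
  - intros k Hk Hk0. split; [apply (D_abs_conv q); auto|]. intros e He.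
    assert (Ht : 0 < / N) by (apply Rinv_0_lt_compat; auto).
    (* The mu-terms coincide with [Lval - Xval] near [k] away from [k] itself. This difference is
       differentiable at [k], so the limit is its value there. *)
    destruct (Lval_differentiable q chi Hc Hp Hq (nC k)) as [d Hd]. destruct (Xval_differentiable q chi v (/ N) Hc Ht (nC k)) as [d' Hd'].
    destruct (cderiv_cont _ _ _ (cderiv_minus _ _ _ _ _ Hd Hd') e He) as (r & Hr & HD). cbv beta in HD.
    (* Within distance 1 of [k] there is no other integer, so the formula holds at every [s]
       considered. *)
    exists (Rmin r 1). split. apply Rmin_pos; lra. intros s Hs Hsk Hm.
    pose proof (Rmin_l r 1). pose proof (Rmin_r r 1).
    replace (mu_terms q chi v N s) with (Lval chi s - Xval chi v s (/ N))%cx.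
    + rewrite (Lfun_eq q) by auto. apply (HD s). lra.
    + rewrite <- (Lfun_eq q), (functional_formula q chi v N s) by (auto; try lra; intros j Hj E; apply Hsk; rewrite E in Hm |- *; f_equal; apply Re_close_nC; lra).
      change (Xval chi v s (/ N)) with (Dfun chi v N s). ring.
Qed.
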